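(* Let $\Omega\subseteq\mathbb{R}^n$ be open and let $f\in{}^*\mathcal{C}^\infty(\Omega)$. Then $f\approx_{\mathcal{D}'(\Omega)}0$ if and only if for each compact $K\subset\Omega$ there exist $\alpha\in\mathbb{N}^n$ and $g\in{}^*\mathcal{D}(\Omega)$ such that $g(x)\approx 0$ for all $x\in{}^*\Omega$ and $f=\partial^\alpha g$ on ${}^*K$.
   Context: We work in Robinson-style nonstandard analysis: ${}^*A$ is the nonstandard extension of $A$. $\mathbb{N}$ contains $0$ and $\alpha\in\mathbb{N}^n$ is a standard multi-index; $x\approx y$ means that $x-y$ is infinitesimal. $\mathrm{Fin}({}^*\mathbb{C})$ is the set of finite (limited) elements of ${}^*\mathbb{C}$. Integrals of internal functions are $*$-integrals. $K$ ranges over standard compact sets. $\mathcal{C}^\infty(\Omega)$ is the space of smooth functions $\Omega\to\mathbb{C}$, $\mathcal{D}(\Omega)$ the test functions (smooth with compact support in $\Omega$). $\mathrm{ns}({}^*\Omega)=\{x\in{}^*\Omega:\exists y\in\Omega,\ x\approx y\}$. $\phi\in{}^*\mathcal{D}(\Omega)$ is a finite element, $\phi\in\mathrm{Fin}({}^*\mathcal{D}(\Omega))$, iff its support is contained in $\mathrm{ns}({}^*\Omega)$ and $\partial^\alpha\phi(x)\in\mathrm{Fin}({}^*\mathbb{C})$ for all standard multi-indices $\alpha\in\mathbb{N}^n$ and all $x\in{}^*\Omega$. For $f\in{}^*\mathcal{C}^\infty(\Omega)$, $f\approx_{\mathcal{D}'(\Omega)}0$ means that $\int_{{}^*\Omega}f\phi\approx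 0$ for all $\phi\in\mathrm{Fin}({}^*\mathcal{D}(\Omega))$ (i.e. $f$ is a representative of the zero distribution). *)

(* Defs.v *)
From HB Require Import structures.
From mathcomp Require Import all_boot all_order all_algebra.
From mathcomp Require Import all_classical all_reals all_analysis.
From mathcomp Require Export complex.

Set Implicit Arguments.
Unset Strict Implicit.
Unset Printing Implicit Defensive.

Import Order.TTheory GRing.Theory Num.Theory.
Import numFieldNormedType.Exports.

Local Open Scope classical_set_scope.
Local Open Scope ring_scope.

(* A nonstandard extension of the full set-theoretic universe, axiomatised in
   the style of Henson ("Foundations of nonstandard analysis: a gentle
   introduction to nonstandard extensions"): the extension commutes with the
   Boolean operations, equality, finite products, substitution and projection.
   By induction on formulas these clauses amount to the transfer principle for
   all first-order formulas with arbitrarily many sorts.  Since function spaces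
   and power sets are themselves sorts, the elements of [star A] are the
   internal elements of *A also when A is a set of functions.  The last clause
   makes the extension proper; no further saturation is assumed.  Ultrapowers
   by nonprincipal ultrafilters on nat are instances. *)
Record nonstandard_extension : Type := NonstandardExtension {
  star : Type -> Type ;
  std : forall A : Type, A -> star A ;
  smap : forall A B : Type, (A -> B) -> star A -> star B ;
  sset : forall A : Type, set A -> set (star A) ;
  spair : forall A B : Type, star A -> star B -> star (A * B)%type ;
  smap_id : forall (A : Type) (x : star A), smap id x = x ;
  smap_comp : forall (A B C : Type) (g : B -> C) (f : A -> B) (x : star A),
    smap (g \o f) x = smap g (smap f x) ;
  smap_cst : forall (A B : Type) (b : B) (x : star A),
    smap (fun=> b) x = std b ;
  smap_fst : forall (A B : Type) (x : star A) (y : star B),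
    smap fst (spair x y) = x ;
  smap_snd : forall (A B : Type) (x : star A) (y : star B),
    smap snd (spair x y) = y ;
  spair_eta : forall (A B : Type) (p : star (A * B)%type),
    spair (smap fst p) (smap snd p) = p ;
  sset_setI : forall (A : Type) (P Q : set A),
    sset (P `&` Q) = sset P `&` sset Q ;
  sset_setC : forall (A : Type) (P : set A), sset (~` P) = ~` sset P ;
  sset_eq : forall (A B : Type) (f g : A -> B),
    sset [set a | f a = g a] = [set x | smap f x = smap g x] ;
  sset_preimage : forall (A B : Type) (f : A -> B) (Q : set B),
    sset (f @^-1` Q) = smap f @^-1` sset Q ;
  sset_image : forall (A B : Type) (f : A -> B) (P : set A),
    sset (f @` P) = smap f @` sset P ;
  star_proper : exists N : star nat, forall k : nat, N <> std k
}.

Arguments std E [A] a : rename.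
Arguments smap E [A B] f x : rename.
Arguments sset E [A] P x : rename.
Arguments spair E [A B] x y : rename.

Section internal.
Variable E : nonstandard_extension.

Definition smap2 (A B C : Type) (h : A -> B -> C)
    (x : star E A) (y : star E B) : star E C :=
  smap E (fun p => h p.1 p.2) (spair E x y).

Definition srel (A B : Type) (r : A -> B -> Prop)
    (x : star E A) (y : star E B) : Prop :=
  sset E [set p | r p.1 p.2] (spair E x y).

Variable R : realType.

Definition approx (V : normedZmodType R) (x y : star E V) : Prop :=
  forall e : R, 0 < e -> srel (fun u v => `|u - v| < e) x y.

Definition limited (V : normedZmodType R) (x : star E V) : Prop :=
  exists M : R, sset E [set u | `|u| <= M] x.

End internal.

(* The R-valued modulus of complex numbers is the norm of [Rcomplex R]. *)
Definition approxC (E : nonstandard_extension) (R : realType)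
  (z w : star E R[i]) : Prop := @approx E R (Rcomplex R) z w.
Definition limitedC (E : nonstandard_extension) (R : realType)
  (z : star E R[i]) : Prop := @limited E R (Rcomplex R) z.

Section smooth_functions.
Variables (R : realType) (n : nat).
Implicit Types (f : 'rV[R]_n -> R[i]) (x : 'rV[R]_n) (Omega : set 'rV[R]_n).

Definition basis_vec (i : 'I_n) : 'rV[R]_n := delta_mx 0 i.

Definition partial (i : 'I_n) f x : R[i] :=
  Complex ('D_(basis_vec i) (fun y => complex.Re (f y)) x)
          ('D_(basis_vec i) (fun y => complex.Im (f y)) x).

Definition partials (s : seq 'I_n) f : 'rV[R]_n -> R[i] := foldr partial f s.

Definition derivableC (i : 'I_n) f x : Prop :=
  derivable (fun y => complex.Re (f y)) x (basis_vec i) /\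
  derivable (fun y => complex.Im (f y)) x (basis_vec i).

Definition continuousC f x : Prop :=
  {for x, continuous (fun y => complex.Re (f y))} /\
  {for x, continuous (fun y => complex.Im (f y))}.

Definition smooth_on Omega f : Prop :=
  forall (s : seq 'I_n) x, Omega x ->
    continuousC (partials s f) x /\
    forall i : 'I_n, derivableC i (partials s f) x.

Definition multi_index := {ffun 'I_n -> nat}.

Definition dpow (alpha : multi_index) f : 'rV[R]_n -> R[i] :=
  foldr (fun i => iter (alpha i) (partial i)) f (enum 'I_n).

(* A function Omega -> R[i] is represented by its extension by 0 to the whole
   space; for Omega open this does not affect derivatives at points of Omega. *)
Record Cinfty Omega := MkCinfty {
  Cinfty_fun :> 'rV[R]_n -> R[i] ;
  Cinfty_smooth : smooth_on Omega Cinfty_fun ;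
  Cinfty_out : forall x, ~ Omega x -> Cinfty_fun x = 0
}.

Definition supp f : set 'rV[R]_n := closure [set x | f x <> 0].

Record testfun Omega := MkTestfun {
  testfun_Cinfty :> Cinfty Omega ;
  testfun_compact : compact (supp testfun_Cinfty) ;
  testfun_supp : supp testfun_Cinfty `<=` Omega
}.

End smooth_functions.

(* The library's sigma-finite instance for [m1 \x m2] is shadowed by the one for
   finite measures, hence this alias. *)
Section sigma_finite_product.
Context d1 d2 (T1 : measurableType d1) (T2 : measurableType d2) (R : realType).
Variables (m1 : {sigma_finite_measure set T1 -> \bar R})
          (m2 : {sigma_finite_measure set T2 -> \bar R}).

Definition sfprod : set (T1 * T2) -> \bar R := (m1 \x m2)%E.

HB.instance Definition _ := Measure.copy sfprod (m1 \x m2)%E.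

Let sfprod_sigma_finite : sigma_finite setT sfprod.
Proof.
have /sigma_finiteP[F [TF ndF Foo]] := sigma_finiteT m1.
have /sigma_finiteP[G [TG ndG Goo]] := sigma_finiteT m2.
exists (fun n => F n `*` G n).
  rewrite -setXTT TF TG predeqE => -[x y]; split.
    move=> [/= [n _ Fnx] [k _ Gky]]; exists (maxn n k) => //; split.
    - by move: x Fnx; exact/subsetPset/ndF/leq_maxl.
    - by move: y Gky; exact/subsetPset/ndG/leq_maxr.
  by move=> [n _ []/= ? ?]; split; exists n.
move=> k; have [? ?] := Foo k; have [? ?] := Goo k.
split; first exact: measurableX.
by rewrite /sfprod product_measure1E// lte_mul_pinfty// ge0_fin_numE.
Qed.

HB.instance Definition _ :=
  Measure_isSigmaFinite.Build _ _ _ sfprod sfprod_sigma_finite.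

End sigma_finite_product.

(* Lebesgue measure on R^n, on the Borel sets, as the iterated product measure
   on R * (R * ( ... * unit)); [coords] identifies this space with 'rV[R]_n. *)
Section lebesgue_Rn.
Variable R : realType.

Fixpoint Rn_display (n : nat) : measure_display :=
  if n is m.+1 then
    measure_prod_display ((R.-ocitv.-measurable).-sigma, Rn_display m)%mdisp
  else default_measure_display.

Fixpoint Rn (n : nat) : measurableType (Rn_display n) :=
  if n is m.+1 then (measurableTypeR R * Rn m)%type else unit.

Fixpoint lebesgue_Rn (n : nat) : {sigma_finite_measure set (Rn n) -> \bar R} :=
  match n return {sigma_finite_measure set (Rn n) -> \bar R} with
  | 0 => \d_(tt : unit) : {sigma_finite_measure set unit -> \bar R}
  | m.+1 => sfprod (@lebesgue_measure R) (lebesgue_Rn m)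
            : {sigma_finite_measure set (measurableTypeR R * Rn m)%type -> \bar R}
  end.

Fixpoint coords (n : nat) : Rn n -> 'rV[R]_n :=
  match n return Rn n -> 'rV[R]_n with
  | 0 => fun=> 0
  | m.+1 => fun p : measurableTypeR R * Rn m =>
      row_mx (p.1 : R)%:M (coords p.2)
  end.

Definition integralC (n : nat) (Omega : set 'rV[R]_n) (h : 'rV[R]_n -> R[i])
    : R[i] :=
  Complex
    (\int[lebesgue_Rn n]_(y in @coords n @^-1` Omega) complex.Re (h (coords y)))
    (\int[lebesgue_Rn n]_(y in @coords n @^-1` Omega) complex.Im (h (coords y))).

End lebesgue_Rn.

Section distributions.
Variables (E : nonstandard_extension) (R : realType) (n : nat).
Variable Omega : set 'rV[R]_n.

Definition nearstandard (x : star E 'rV[R]_n) : Prop :=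
  sset E Omega x /\ exists y, Omega y /\ approx x (std E y).

Definition seval (f : star E (Cinfty Omega)) (x : star E 'rV[R]_n)
    : star E R[i] := smap2 (fun (u : Cinfty Omega) y => u y) f x.

Definition stest_eval (phi : star E (testfun Omega)) (x : star E 'rV[R]_n)
    : star E R[i] := smap2 (fun (u : testfun Omega) y => u y) phi x.

Definition stest_dpow (alpha : multi_index n) (phi : star E (testfun Omega))
    (x : star E 'rV[R]_n) : star E R[i] :=
  smap2 (fun (u : testfun Omega) y => dpow alpha u y) phi x.

Definition in_supp (phi : star E (testfun Omega)) (x : star E 'rV[R]_n) : Prop :=
  srel (fun (u : testfun Omega) y => supp u y) phi x.

Definition finite_test (phi : star E (testfun Omega)) : Prop :=
  (forall x, in_supp phi x -> nearstandard x) /\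
  (forall alpha x, sset E Omega x -> limitedC (stest_dpow alpha phi x)).

Definition spairing (f : star E (Cinfty Omega)) (phi : star E (testfun Omega))
    : star E R[i] :=
  smap2 (fun (u : Cinfty Omega) (v : testfun Omega) =>
           integralC Omega (fun y => u y * v y)) f phi.

Definition approx0_distr (f : star E (Cinfty Omega)) : Prop :=
  forall phi, finite_test phi -> approxC (spairing f phi) (std E 0).

End distributions.

(* Main.v *)
Require Import Defs.
From HB Require Import structures.
From mathcomp Require Import all_boot all_order all_algebra.
From mathcomp Require Import all_classical all_reals all_analysis.
From mathcomp Require Import finmap lra ring.
Set Implicit Arguments.
Unset Strict Implicit.
Unset Printing Implicit Defensive.
Import Order.TTheory GRing.Theory Num.Theory.
Import numFieldNormedType.Exports.
Import ComplexField.Normc.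
Local Open Scope classical_set_scope.
Local Open Scope ring_scope.

(** Sufficiency is integration by parts. By underspill the support of a finite
test function phi, which consists of nearstandard points, lies in one member
of a standard compact exhaustion of Omega, and each standard derivative of phi
is bounded by a standard number ([finite_test_supp], [finite_test_bound]). If
f = d^alpha g on that compact set with g infinitesimal, then the integral of
f phi is, up to sign, that of g d^alpha phi, hence infinitesimal
([weak_bound_holds]).

Necessity rests on the principle that f is controlled by finitely many
derivatives. Let K' be a compact neighbourhood of K and chi a standard cutoff,
equal to 1 near K and supported in K'. For infinite m, an internal test
function supported in K' with all derivatives of order at most m bounded by 1
is finite, so its integral against f is at most 1 in modulus. By underspill
this holds for some standard m ([approx0_controlled]). Put N = m + 1 and
  E(z) = prod_i (z_i)_+^N / N!,
whose derivative of order N + 1 in each variable is the Dirac mass. The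
function
  g = chi * (the convolution of chi f with E)
is smooth because chi f is, and its derivative of order N + 1 in each variable
is f near K ([fundamental_identity], [primitiveP]).

That g is infinitesimal is an approximation argument in the C^m norm. The
value g(x) is the integral of f against the function
  y |-> chi(x) chi(y) E(x - y),
which is only of class C^m. Replacing (z_i)_+^N by (z_i)_+^N exp(- d / z_i)
turns it into a smooth function Phi_(d,x), and Phi_(d,x) - Phi_(e,x) is
O(d + e) in the C^m norm, uniformly in x ([probe_close]). As f is controlled
by the C^m norm, the integrals of f against Phi_(d,x) and Phi_(e,x) differ by
O(d + e); letting e tend to 0, the integral of f against Phi_(d,x) differs
from g(x) by at most C d, with C standard. For standard d > 0 the function
Phi_(d,x) is a finite test function even at nonstandard x, so that integral is
infinitesimal. As d is arbitrary, g(x) is infinitesimal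
([primitive_of_approx0]).

The analysis concerns standard functions only; it enters the nonstandard
argument through the two statements [weak_bound] and [small_primitives].
Derivatives and integrals are taken of real and imaginary parts separately. *)

(** * Transfer and underspill *)

Section transfer.
Variable E : nonstandard_extension.

Lemma sset_all (A : Type) (P : set A) (x : star E A) :
  (forall a, P a) -> sset E P x.
Proof.
move=> allP.
have -> : P = [set a | id a = id a] by apply/seteqP; split.
by rewrite sset_eq.
Qed.

Lemma sset_imply (A : Type) (P Q : set A) (x : star E A) :
  P `<=` Q -> sset E P x -> sset E Q x.
Proof.
by move=> /setIidPl PQ; rewrite -[in sset E P x]PQ sset_setI => -[].
Qed.

Lemma sset_and (A : Type) (P Q : set A) (x : star E A) :
  sset E [set a | P a /\ Q a] x <-> sset E P x /\ sset E Q x.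
Proof. by rewrite -[[set a | _]]/(P `&` Q) sset_setI. Qed.

Lemma sset_not (A : Type) (P : set A) (x : star E A) :
  sset E [set a | ~ P a] x <-> ~ sset E P x.
Proof. by rewrite -[[set a | _]]/(~` P) sset_setC. Qed.

Lemma sset_smap (A B : Type) (f : A -> B) (Q : set B) (x : star E A) :
  sset E Q (smap E f x) <-> sset E [set a | Q (f a)] x.
Proof. by rewrite -[[set a | _]]/(f @^-1` Q) sset_preimage. Qed.

(** The computation rule behind all transfers below. Finitely many internal
objects are written as values [smap E h c] at one common point [c]; relations
between them then become membership of [c] in a standard set. *)
Lemma smap_pair (A B C : Type) (f : A -> B) (g : A -> C) (x : star E A) :
  spair E (smap E f x) (smap E g x) = smap E (fun a => (f a, g a)) x.
Proof.
rewrite -[RHS]spair_eta -!smap_comp.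
by congr (spair _ (smap _ _ _) (smap _ _ _)).
Qed.

Lemma smap2E (A B C D : Type) (h : B -> C -> D) (f : A -> B) (g : A -> C)
    (x : star E A) :
  smap2 h (smap E f x) (smap E g x) = smap E (fun a => h (f a) (g a)) x.
Proof. by rewrite /smap2 smap_pair -smap_comp. Qed.

Lemma srelE (A B C : Type) (r : B -> C -> Prop) (f : A -> B) (g : A -> C)
    (x : star E A) :
  srel r (smap E f x) (smap E g x) <-> sset E [set a | r (f a) (g a)] x.
Proof. by rewrite /srel smap_pair sset_smap. Qed.

Lemma smap_eqP (A B : Type) (f g : A -> B) (x : star E A) :
  smap E f x = smap E g x <-> sset E [set a | f a = g a] x.
Proof. by rewrite sset_eq. Qed.

Lemma sset_std (A : Type) (P : set A) (a : A) :
  sset E P (std E a) <-> P a.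
Proof.
have [N _] := star_proper E.
rewrite -(@smap_cst E _ _ a N) sset_smap; split.
  by apply: contraPP => nPa; apply/sset_not; apply: sset_all.
by move=> Pa; apply: sset_all.
Qed.

(** A universal quantifier is the complement of a projection, so the clause on
images gives its transfer. *)
Lemma sset_forall (A B : Type) (Q : A -> B -> Prop) (x : star E A) :
  sset E [set a | forall b, Q a b] x <-> forall y : star E B, srel Q x y.
Proof.
pose D := [set p : A * B | ~ Q p.1 p.2].
have -> : [set a | forall b, Q a b] = ~` (fst @` D).
  apply/seteqP; split => a /=.
    by move=> Qa [[a' b] /= nQ eqa]; apply: nQ; rewrite eqa; apply: Qa.
  by move=> na b; apply: contrapT => nQ; apply: na; exists (a, b).
rewrite sset_setC sset_image; split.
  move=> nx y; apply: contrapT => nr; apply: nx; exists (spair E x y).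
    by apply/sset_not.
  by rewrite smap_fst.
move=> Qx [p /sset_not np px]; apply: np.
by rewrite -(spair_eta p) px; exact: Qx.
Qed.

(** Finite disjunctions transfer, whereas infinite ones do not: this is where
compactness enters. *)
Lemma sset_has (A : Type) (I : eqType) (s : seq I) (P : I -> set A) (x : star E A) :
  sset E [set a | exists2 i, i \in s & P i a] x ->
  exists2 i, i \in s & sset E (P i) x.
Proof.
elim: s => [|i s IH] Px.
  suff : sset E set0 x by move/sset_not : (@sset_all _ (~` set0) x (fun=> id)).
  by apply: sset_imply Px => a [].
have [Pi|nPi] := pselect (sset E (P i) x); first by exists i => //; exact: mem_head.
have [|j js Pj] := IH; last by exists j => //; rewrite in_cons js orbT.
have := (sset_and _ _ _).2 (conj Px ((sset_not _ _).2 nPi)).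
apply: sset_imply => a [[j +] Pj nPia].
by rewrite in_cons => /predU1P[ji|js]; [case: nPia; rewrite -ji|exists j].
Qed.

Lemma sset_forall_in (A B : Type) (U : set B) (P : A -> B -> Prop)
    (x : star E A) :
  sset E [set a | forall b, U b -> P a b] x <->
  forall y : star E B, sset E U y -> srel P x y.
Proof.
rewrite (sset_forall (fun a b => U b -> P a b)); split=> xP y; last first.
  have [Uy|nUy] := pselect (sset E U y).
    by apply: sset_imply (xP _ Uy) => p /=.
  have : ~ sset E [set p : A * B | U p.2] (spair E x y).
    by move=> h; apply: nUy; rewrite -(smap_snd x y); apply/sset_smap.
  by move/sset_not; apply: sset_imply => p /= nU /nU.
move=> Uy; have {}Uy : sset E [set p : A * B | U p.2] (spair E x y).
  by apply/sset_smap; rewrite smap_snd.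
have := (sset_and _ _ _).2 (conj (xP y) Uy).
by apply: sset_imply => p /= [h /h].
Qed.

Definition nonstd (N : star E nat) := forall k, N <> std E k.

Lemma nonstd_ge (N : star E nat) (k : nat) :
  nonstd N -> sset E [set j | (k <= j)%N] N.
Proof.
move=> infN; elim: k => [|k IH]; first exact: sset_all.
have nk : ~ sset E [set j | j = k] N.
  move=> /(smap_eqP id (cst k)); rewrite smap_id smap_cst; exact: infN.
move/sset_not : nk => nk.
have := (sset_and _ _ _).2 (conj IH nk); apply: sset_imply => j [/= kj].
by rewrite ltn_neqAle kj andbT => /eqP; rewrite eq_sym.
Qed.

(** Infinite numbers have no least element; this is what drives underspill. *)
Lemma nonstd_pred (N : star E nat) : nonstd N -> nonstd (smap E predn N).
Proof.
move=> infN k /(congr1 (fun M => sset E [set j | (k < j)%N] M)).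
suff : sset E [set j | (k < j)%N] (smap E predn N).
  by move=> h eqs; move: h; rewrite eqs => /sset_std /=; rewrite ltnn.
by apply/sset_smap; have := nonstd_ge k.+2 infN; apply: sset_imply => -[//|j].
Qed.

(** If no standard index worked at [x], the least index at which [Q] holds would
be infinite, and its predecessor, being infinite too, would contradict
minimality. *)
Lemma underspill (A : Type) (Q : nat -> A -> Prop) (x : star E A) :
  (forall N : star E nat, nonstd N -> srel Q N x) ->
  exists k, sset E (Q k) x.
Proof.
move=> Qinf; have [N0 infN0] := star_proper E.
(* the first index at which [Q] holds, and 0 when there is none *)
have [m mP] : exists m : A -> nat, forall a,
    (forall k, Q k a -> Q (m a) a) /\ (forall k, (k < m a)%N -> ~ Q k a).
  suff /choice[m mP] : forall a, exists m, (forall k, Q k a -> Q m a) /\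
      (forall k, (k < m)%N -> ~ Q k a) by exists m.
  move=> a.
  have [[k Qk]|nQ] := pselect (exists k, Q k a); last first.
    by exists 0%N; split => // k Qk; case: nQ; exists k.
  have exQ : exists k, `[< Q k a >] by exists k; apply/asboolP.
  exists (ex_minn exQ); case: ex_minnP => j /asboolP Qj minj; split => //.
  by move=> i ij /asboolP /minj; rewrite leqNgt ij.
have Qm : sset E [set a | Q (m a) a] x.
  have : sset E [set p : nat * A | Q p.1 p.2] (spair E N0 x) by exact: Qinf.
  move=> h; rewrite -(smap_snd N0 x); apply/sset_smap.
  by apply: sset_imply h => -[k a] /= /((mP a).1 k).
have [[k mk]|nm] := pselect (exists k, smap E m x = std E k).
  exists k; move: mk; rewrite -(@smap_cst E _ _ k x) => /smap_eqP mk.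
  have := (sset_and _ _ _).2 (conj Qm mk).
  by apply: sset_imply => a [/= + <-].
have infm : nonstd (smap E m x) by move=> k mk; apply: nm; exists k.
have := Qinf _ (nonstd_pred infm).
rewrite -smap_comp -{2}(smap_id x) => /srelE h.
have := nonstd_ge 1 infm => /sset_smap h1.
have := (sset_and _ _ _).2 (conj h h1); move=> h2; exfalso.
suff : sset E set0 x by move/sset_not : (@sset_all _ (~` set0) x (fun=> id)).
apply: sset_imply h2 => a [/= Qa m0]; apply: (mP a).2 Qa => /=.
by rewrite prednK.
Qed.

End transfer.

(** * Smooth functions on R^n *)

Lemma natr_above (R : realType) (x : R) : exists m : nat, x <= m%:R.
Proof.
exists (Num.bound `|x|); apply: le_trans (ler_norm x) _.
by apply/ltW; rewrite archi_boundP.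
Qed.

Section smooth.
Variables (R : realType) (n : nat).
Implicit Types (u v : 'rV[R]_n -> R) (U : set 'rV[R]_n) (x y : 'rV[R]_n).
Notation e_ i := (@basis_vec R n i).

Definition rpart (i : 'I_n) u : 'rV[R]_n -> R := fun x => 'D_(e_ i) u x.

Definition rparts (s : seq 'I_n) u : 'rV[R]_n -> R := foldr rpart u s.

(** Continuity is required at every order because the existence of partial
derivatives alone does not give it. The derivatives are unfolded from the
inside, which makes the stability of the class under algebraic operations a
plain induction on [k]. *)
Fixpoint Ck (k : nat) U u : Prop :=
  (forall x, U x -> {for x, continuous u}) /\
  if k is k'.+1 then
    (forall x i, U x -> derivable u x (e_ i)) /\
    forall i, Ck k' U (rpart i u)
  else True.

Definition smooth U u := forall k, Ck k U u.

Lemma CkS k U u : Ck k.+1 U u -> Ck k U u.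
Proof.
elim: k u => [|k IH] u [cu [du pu]]; split => //.
by split => // i; exact: IH.
Qed.

Lemma smooth_cont U u x : smooth U u -> U x -> {for x, continuous u}.
Proof. by move=> /(_ 0%N)[+ _]; exact. Qed.

Lemma smooth_derivable U u x i : smooth U u -> U x -> derivable u x (e_ i).
Proof. by move=> /(_ 1%N)[_ [+ _]] Ux; apply. Qed.

Lemma smooth_rpart U u i : smooth U u -> smooth U (rpart i u).
Proof. by move=> su k; have [_ [_]] := su k.+1; exact. Qed.

Lemma smooth_rparts U u s : smooth U u -> smooth U (rparts s u).
Proof. by move=> su; elim: s => //= i s; exact: smooth_rpart. Qed.

Lemma rparts_rcons s i u : rparts (rcons s i) u = rparts s (rpart i u).
Proof. by rewrite /rparts foldr_rcons. Qed.

(** The form in which smoothness is required of the real and imaginary parts of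
the elements of [Cinfty]. *)
Lemma smoothP U u : smooth U u <->
  forall s x, U x -> {for x, continuous (rparts s u)} /\
    forall i, derivable (rparts s u) x (e_ i).
Proof.
split=> [su s x Ux|h k].
  split=> [|i]; first by apply: smooth_cont Ux; exact: smooth_rparts.
  by apply: smooth_derivable Ux; exact: smooth_rparts.
elim: k u h => [|k IH] u h; split=> //; try by move=> x /(h [::])[].
split; first by move=> x i /(h [::])[_]; exact.
by move=> i; apply: IH => s; rewrite -rparts_rcons; exact: h.
Qed.

Lemma is_derive_rpart U u x i : smooth U u -> U x ->
  is_derive x (e_ i) u (rpart i u x).
Proof. by move=> su Ux; apply: DeriveDef => //; exact: smooth_derivable Ux. Qed.

Lemma rpart_eq U u v i : open U -> (forall x, U x -> u x = v x) ->
  forall x, U x -> rpart i u x = rpart i v x.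
Proof.
move=> Uo uv x Ux; apply: near_eq_derive.
by apply: filterS (open_nbhs_nbhs (conj Uo Ux)) => y; exact: uv.
Qed.

Lemma rparts_eq U u v s : open U -> (forall x, U x -> u x = v x) ->
  forall x, U x -> rparts s u x = rparts s v x.
Proof.
move=> Uo uv; elim: s => //= i s IH; exact: rpart_eq.
Qed.

Lemma cont_eq U u v x : open U -> (forall x, U x -> u x = v x) -> U x ->
  {for x, continuous u} -> {for x, continuous v}.
Proof.
move=> Uo uv Ux; rewrite /prop_for /continuous_at -(uv x Ux) => cu.
apply: cvg_trans cu; apply: (@near_eq_cvg _ _ (nbhs x)).
by apply: filterS (open_nbhs_nbhs (conj Uo Ux)) => y /uv.
Qed.

Lemma Ck_eq k U u v : open U -> (forall x, U x -> u x = v x) ->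
  Ck k U u -> Ck k U v.
Proof.
elim: k u v => [|k IH] u v Uo uv /= [cu].
  by split=> // x Ux; exact: (cont_eq Uo uv Ux (cu x Ux)).
move=> [du pu]; split; first by move=> x Ux; exact: (cont_eq Uo uv Ux (cu x Ux)).
split.
  move=> x i Ux; apply: near_eq_derivable (du x i Ux).
  by apply: filterS (open_nbhs_nbhs (conj Uo Ux)) => y; exact: uv.
by move=> i; apply: IH (pu i) => //; exact: rpart_eq.
Qed.

Lemma smooth_eq U u v : open U -> (forall x, U x -> u x = v x) ->
  smooth U u -> smooth U v.
Proof. by move=> Uo uv su k; exact: Ck_eq (su k). Qed.

Lemma Ck_setU k U V u : Ck k U u -> Ck k V u -> Ck k (U `|` V) u.
Proof.
elim: k u => [|k IH] u /= [cU dU] [cV dV]; split=> //.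
- by move=> x [/cU|/cV].
- by move=> x [/cU|/cV].
split; first by move=> x i [Ux|Vx]; [exact: dU.1|exact: dV.1].
by move=> i; apply: IH; [exact: dU.2|exact: dV.2].
Qed.

Lemma Ck_sub k U V u : U `<=` V -> Ck k V u -> Ck k U u.
Proof.
move=> UV; elim: k u => [|k IH] u /= [cV dV]; split=> //.
- by move=> x /UV/cV.
- by move=> x /UV/cV.
split; first by move=> x i /UV; exact: dV.1.
by move=> i; apply: IH; exact: dV.2.
Qed.

Lemma smooth_sub U V u : U `<=` V -> smooth V u -> smooth U u.
Proof. by move=> UV sV k; exact: Ck_sub UV (sV k). Qed.

Lemma rpartD u v i x : derivable u x (e_ i) -> derivable v x (e_ i) ->
  rpart i (fun x => u x + v x) x = rpart i u x + rpart i v x.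
Proof. by move=> du dv; rewrite /rpart -(deriveD du dv). Qed.

Lemma rpartM u v i x : derivable u x (e_ i) -> derivable v x (e_ i) ->
  rpart i (fun x => u x * v x) x = u x * rpart i v x + rpart i u x * v x.
Proof.
move=> du dv; rewrite /rpart -[RHS]/(u x *: _ + _) [X in _ + X]mulrC.
by rewrite -[X in _ + X]/(v x *: _) -(deriveM du dv).
Qed.

Lemma rpart_cst (c : R) i x : rpart i (fun=> c) x = 0.
Proof. by rewrite /rpart derive_cst. Qed.

Lemma Ck_cst k U (c : R) : open U -> Ck k U (fun=> c).
Proof.
move=> Uo; elim: k c => [|k IH] c /=.
  by split=> // x _; exact: cst_continuous.
split; first by move=> x _; exact: cst_continuous.
split=> [x i _|i]; first exact: derivable_cst.
by apply: Ck_eq (IH 0) => // x _; rewrite rpart_cst.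
Qed.

Lemma CkD k U u v : open U -> Ck k U u -> Ck k U v -> Ck k U (fun x => u x + v x).
Proof.
move=> Uo; elim: k u v => [|k IH] u v /= [cu du] [cv dv]; split=> //.
- by move=> x Ux; exact: (continuousD (cu x Ux) (cv x Ux)).
- by move=> x Ux; exact: (continuousD (cu x Ux) (cv x Ux)).
split=> [x i Ux|i]; first by apply: derivableD; [exact: du.1|exact: dv.1].
apply: Ck_eq (IH _ _ (du.2 i) (dv.2 i)) => // x Ux.
by rewrite rpartD//; [exact: du.1|exact: dv.1].
Qed.

Lemma CkM k U u v : open U -> Ck k U u -> Ck k U v -> Ck k U (fun x => u x * v x).
Proof.
move=> Uo; elim: k u v => [|k IH] u v.
  move=> /= [cu du] [cv dv]; split=> //.
  by move=> x Ux; exact: (continuousM (cu x Ux) (cv x Ux)).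
move=> uk vk; have uk' := CkS uk; have vk' := CkS vk.
move: uk vk => /= [cu du] [cv dv]; split.
  by move=> x Ux; exact: (continuousM (cu x Ux) (cv x Ux)).
split=> [x i Ux|i]; first by apply: derivableM; [exact: du.1|exact: dv.1].
apply: (@Ck_eq k U (fun x => u x * rpart i v x + rpart i u x * v x)) => //.
  by move=> x Ux; rewrite rpartM//; [exact: du.1|exact: dv.1].
by apply: CkD => //; apply: IH => //; [exact: dv.2|exact: du.2].
Qed.

Lemma smooth_cst U (c : R) : open U -> smooth U (fun=> c).
Proof. by move=> Uo k; exact: Ck_cst. Qed.

Lemma smoothD U u v : open U -> smooth U u -> smooth U v ->
  smooth U (fun x => u x + v x).
Proof. by move=> Uo su sv k; exact: CkD. Qed.

Lemma smoothM U u v : open U -> smooth U u -> smooth U v ->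
  smooth U (fun x => u x * v x).
Proof. by move=> Uo su sv k; exact: CkM. Qed.

Lemma smoothZ U c u : open U -> smooth U u -> smooth U (fun x => c * u x).
Proof. by move=> Uo; apply: smoothM => //; exact: smooth_cst. Qed.

Lemma smoothN U u : open U -> smooth U u -> smooth U (fun x => - u x).
Proof.
move=> Uo su; apply: smooth_eq (smoothZ (-1) Uo su) => // x _.
by rewrite mulN1r.
Qed.

Lemma smoothB U u v : open U -> smooth U u -> smooth U v ->
  smooth U (fun x => u x - v x).
Proof. by move=> Uo su sv; apply: smoothD => //; exact: smoothN. Qed.

Lemma smooth_prod U (I : Type) (r : seq I) (u : I -> 'rV[R]_n -> R) :
  open U -> (forall i, smooth U (u i)) -> smooth U (fun x => \prod_(i <- r) u i x).
Proof.
move=> Uo su; elim: r => [|i r IH].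
  by apply: smooth_eq (smooth_cst 1 Uo) => // x _; rewrite big_nil.
by apply: smooth_eq (smoothM Uo (su i) IH) => // x _; rewrite big_cons.
Qed.

Lemma is_derive_line u x i (t : R) :
  derivable u (t *: e_ i + x) (e_ i) ->
  is_derive t 1 (fun h => u (h *: e_ i + x)) (rpart i u (t *: e_ i + x)).
Proof.
set w := fun h : R => u _.
have E : (fun h : R => h^-1 *: ((w \o shift t) (h *: 1) - w t)) =
    (fun h : R => h^-1 *: ((u \o shift (t *: e_ i + x)) (h *: e_ i)
       - u (t *: e_ i + x))).
  by apply/funext => h /=; rewrite /w /= [h *: 1]mulr1 scalerDl addrA.
by move=> du; apply: DeriveDef; rewrite ?/rpart /derivable /derive E.
Qed.

Lemma rpart_lin u x i (d : R) :
  is_derive (0 : R) 1 (fun h => u (h *: e_ i + x)) d ->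
  derivable u x (e_ i) /\ rpart i u x = d.
Proof.
set w := fun h : R => u _.
have E : (fun h : R => h^-1 *: ((w \o shift 0) (h *: 1) - w 0)) =
    (fun h : R => h^-1 *: ((u \o shift x) (h *: e_ i) - u x)).
  by apply/funext => h /=; rewrite /w /= [h *: 1]mulr1 addr0 scale0r add0r.
by case; rewrite /rpart /derivable /derive E.
Qed.

(** Only the derivative along the segment matters, so the bound is asked for on
the segment alone. *)
Lemma MVT_line u x i (M : R) (h : R) : (forall z, derivable u z (e_ i)) ->
  (forall t : R, `|t| <= `|h| -> `|rpart i u (t *: e_ i + x)| <= M) ->
  `|u (h *: e_ i + x) - u x| <= `|h| * M.
Proof.
move=> du bu.
pose w (t : R) := u (t *: e_ i + x).
have dw (t : R) : is_derive t (1 : R) w (rpart i u (t *: e_ i + x)).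
  exact: is_derive_line.
have cw A : {within A, continuous w}.
  apply: continuous_subspaceT => t.
  apply/differentiable_continuous; rewrite -derivable1_diffP.
  by have [] := dw t.
have u0 : u x = w 0 by rewrite /w scale0r add0r.
rewrite u0 -[u _]/(w h).
have [h0|h0] := leP 0 h.
  have [c] := MVT_segment h0 (fun t _ => dw t) (@cw _).
  rewrite in_itv /= => /andP[c0 ch] ->; rewrite subr0 normrM mulrC.
  by rewrite ler_wpM2l// bu// !ger0_norm.
have [c] := MVT_segment (ltW h0) (fun t _ => dw t) (@cw _).
rewrite in_itv /= => /andP[ch c0] ; rewrite distrC => ->.
rewrite sub0r normrM normrN mulrC.
by rewrite ler_wpM2l// bu// !ler0_norm// ?lerN2// ltW.
Qed.

End smooth.

Section coordinates_and_bounds.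
Variables (R : realType) (n : nat).
Implicit Types (u v : 'rV[R]_n -> R) (U B : set 'rV[R]_n) (x y : 'rV[R]_n).
Notation e_ i := (@basis_vec R n i).

Lemma basis_vecE (i j : 'I_n) : e_ i 0 j = (i == j)%:R.
Proof. by rewrite mxE eqxx eq_sym. Qed.

Lemma coord_le_norm x (i : 'I_n) : `|x 0 i| <= `|x|.
Proof.
rewrite [leRHS]/Num.norm /= mx_normrE.
exact: (le_bigmax _ (fun ij : 'I_1 * 'I_n => `|x ij.1 ij.2|) (0, i)).
Qed.

Lemma norm_le_coord x (r : R) : 0 <= r -> (forall i, `|x 0 i| <= r) -> `|x| <= r.
Proof.
move=> r0 xr; rewrite [leLHS]/Num.norm /= mx_normrE; apply/bigmax_leP; split => //.
by move=> [i j] _ /=; rewrite (ord1 i).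
Qed.

Lemma rpart_coord (h : R -> R) (dh a b : R) (i j : 'I_n) x :
  is_derive (a * x 0 i + b) (1 : R) h dh ->
  derivable (fun x => h (a * x 0 i + b)) x (e_ j) /\
  rpart j (fun x => h (a * x 0 i + b)) x = a * (i == j)%:R * dh.
Proof.
move=> dhx; apply: rpart_lin.
pose g (t : R) := a * (i == j)%:R * t + (a * x 0 i + b).
have -> : (fun t : R => h (a * (t *: e_ j + x) 0 i + b)) = h \o g.
  apply/funext => t /=; congr h.
  by rewrite !mxE eqxx /g /=; ring.
have dg : is_derive (0 : R) 1 g (a * (i == j)%:R).
  rewrite -[X in is_derive _ _ _ X]addr0 /g.
  apply: is_deriveD.
  rewrite -[X in is_derive _ _ _ X]mulr1.
  exact: is_deriveZ.
have dhg : is_derive (g 0) 1 h dh by rewrite /g mulr0 add0r.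
by rewrite mulrC; apply: is_derive1_comp.
Qed.

Lemma Ck_coord k U (hs : nat -> R -> R) (a b c : R) (i : 'I_n) : open U ->
  (forall j (t : R), is_derive t (1 : R) (hs j) (hs j.+1 t)) ->
  Ck k U (fun x => c * hs 0%N (a * x 0 i + b)).
Proof.
move=> Uo; elim: k hs c => [|k IH] hs c dhs.
  split=> // x Ux; apply: (continuousM (@cst_continuous _ _ c x)).
  apply: (@continuous_comp _ _ _ (fun x => a * x 0 i + b)).
    apply: (continuousD _ (@cst_continuous _ _ b x)).
    by apply: (continuousM (@cst_continuous _ _ a x)); exact: coord_continuous.
  apply/differentiable_continuous; rewrite -derivable1_diffP.
  by have [] := dhs 0%N (a * x 0 i + b).
have dx x j := rpart_coord j (dhs 0%N (a * x 0 i + b)).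
split.
  move=> x Ux; apply: (continuousM (@cst_continuous _ _ c x)).
  apply: (@continuous_comp _ _ _ (fun x => a * x 0 i + b)).
    apply: (continuousD _ (@cst_continuous _ _ b x)).
    by apply: (continuousM (@cst_continuous _ _ a x)); exact: coord_continuous.
  apply/differentiable_continuous; rewrite -derivable1_diffP.
  by have [] := dhs 0%N (a * x 0 i + b).
split=> [x j Ux|j].
  by apply: derivableM; [exact: derivable_cst|exact: (dx x j).1].
apply: (Ck_eq Uo _ (IH (fun k => hs k.+1) (c * (a * (i == j)%:R)) _)) => //.
move=> x Ux; rewrite rpartM; [|exact: derivable_cst|exact: (dx x j).1].
by rewrite (dx x j).2 rpart_cst mul0r addr0 !mulrA.
Qed.

Lemma smooth_coord U (hs : nat -> R -> R) (a b : R) (i : 'I_n) : open U ->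
  (forall j (t : R), is_derive t (1 : R) (hs j) (hs j.+1 t)) ->
  smooth U (fun x => hs 0%N (a * x 0 i + b)).
Proof.
move=> Uo dhs k; apply: (Ck_eq Uo _ (Ck_coord k a b 1 i Uo dhs)) => x _.
by rewrite mul1r.
Qed.

Lemma smoothT_derivable u x i : smooth setT u -> derivable u x (e_ i).
Proof. by move=> su; apply: smooth_derivable su _. Qed.

Lemma rpartZ (c : R) u i x : derivable u x (basis_vec R i) ->
  rpart i (fun x => c * u x) x = c * rpart i u x.
Proof.
move=> du; rewrite (rpartM (@derivable_cst _ _ _ c x _) du).
by rewrite rpart_cst mul0r addr0.
Qed.

Lemma rpartsZ (c : R) s u : smooth setT u ->
  rparts s (fun x => c * u x) = fun x => c * rparts s u x.
Proof.
move=> su; elim: s => //= i s ->; apply/funext => x; apply: rpartZ.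
by apply: smoothT_derivable; exact: smooth_rparts.
Qed.

(** A bound on the C^m norm over [B]. The set [B] is arbitrary because the
derivatives are those of a function defined on the whole space. *)
Fixpoint Cm_bnd (m : nat) B (C : R) u : Prop :=
  (forall x, B x -> `|u x| <= C) /\
  if m is m'.+1 then forall i, Cm_bnd m' B C (rpart i u) else True.

Lemma Cm_bndS m B C u : Cm_bnd m.+1 B C u -> Cm_bnd m B C u.
Proof.
by elim: m u => [|m IH] u /= [bu pu]; split=> // i; apply: IH; exact: pu.
Qed.

Lemma Cm_bnd_le m B C D u : C <= D -> Cm_bnd m B C u -> Cm_bnd m B D u.
Proof.
move=> CD; elim: m u => [|m IH] u /= [bu pu]; split=> //.
- by move=> x /bu /le_trans; exact.
- by move=> x /bu /le_trans; exact.
- by move=> i; apply: IH; exact: pu.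
Qed.

Lemma Cm_bnd_rparts m B C u s : Cm_bnd m B C u -> (size s <= m)%N ->
  forall x, B x -> `|rparts s u x| <= C.
Proof.
elim/last_ind: s m u => [|s i IH] m u; first by case: m => [|m] [].
rewrite size_rcons rparts_rcons; case: m => // m [_ pu] sm.
exact: IH (pu i) sm.
Qed.

Lemma Cm_bndD m B C D u v : smooth setT u -> smooth setT v ->
  Cm_bnd m B C u -> Cm_bnd m B D v -> Cm_bnd m B (C + D) (fun x => u x + v x).
Proof.
elim: m u v => [|m IH] u v su sv /= [bu pu] [bv pv]; split=> //.
- by move=> x Bx; rewrite (le_trans (ler_normD _ _))// lerD ?bu ?bv.
- by move=> x Bx; rewrite (le_trans (ler_normD _ _))// lerD ?bu ?bv.
move=> i; have -> : rpart i (fun x => u x + v x) =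
    fun x => rpart i u x + rpart i v x.
  by apply/funext => x; rewrite rpartD//; exact: smoothT_derivable.
by apply: IH => //; exact: smooth_rpart.
Qed.

(** By the Leibniz rule each derivation at most doubles the number of terms. *)
Lemma Cm_bndM m B C D u v : 0 <= C -> 0 <= D -> smooth setT u -> smooth setT v ->
  Cm_bnd m B C u -> Cm_bnd m B D v -> Cm_bnd m B (2 ^+ m * (C * D)) (fun x => u x * v x).
Proof.
move=> C0 D0; elim: m u v => [|m IH] u v su sv.
  move=> [bu _] [bv _]; split=> // x Bx.
  by rewrite mul1r normrM ler_pM// ?bu ?bv.
move=> bu bv; have bu' := Cm_bndS bu; have bv' := Cm_bndS bv.
move: bu bv => /= [bu pu] [bv pv]; split.
  move=> x Bx; apply: (@le_trans _ _ (1 * (C * D))).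
    by rewrite mul1r normrM ler_pM// ?bu ?bv.
  by rewrite ler_wpM2r ?mulr_ge0// exprn_ege1// ler1n.
move=> i; have -> : rpart i (fun x => u x * v x) =
    fun x => u x * rpart i v x + rpart i u x * v x.
  by apply/funext => x; rewrite rpartM//; exact: smoothT_derivable.
rewrite exprS (_ : 2 * 2 ^+ m * (C * D) = 2 ^+ m * (C * D) + 2 ^+ m * (C * D)).
  apply: Cm_bndD; [apply: smoothM|apply: smoothM|apply: IH|apply: IH];
    rewrite //; try exact: smooth_rpart; exact: openT.
by ring.
Qed.

Lemma Cm_bnd_cst m B (c C : R) : `|c| <= C -> Cm_bnd m B C (fun=> c).
Proof.
elim: m c => [|m IH] c cC /=; split=> // i.
rewrite (_ : rpart i _ = fun=> 0); last by apply/funext => x; rewrite rpart_cst.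
by apply: IH; rewrite normr0 (le_trans _ cC).
Qed.

Lemma Cm_bnd_coord m B C (hs : nat -> R -> R) (a b c : R) (i : 'I_n) :
  (forall j (t : R), is_derive t (1 : R) (hs j) (hs j.+1 t)) ->
  `|a| <= 1 -> `|c| <= 1 ->
  (forall j x, (j <= m)%N -> B x -> `|hs j (a * x 0 i + b)| <= C) ->
  Cm_bnd m B C (fun x => c * hs 0%N (a * x 0 i + b)).
Proof.
move=> dhs a1; elim: m hs c dhs => [|m IH] hs c dhs c1 bh.
  split=> // x Bx; rewrite normrM -[C]mul1r ler_pM//; exact: bh.
split=> [x Bx|j].
  by rewrite normrM -[C]mul1r ler_pM//; exact: bh.
have dx x := rpart_coord j (dhs 0%N (a * x 0 i + b)).
have -> : rpart j (fun x => c * hs 0%N (a * x 0 i + b)) =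
    fun x => (c * (a * (i == j)%:R)) * hs 1%N (a * x 0 i + b).
  apply/funext => x; rewrite rpartM; [|exact: derivable_cst|exact: (dx x).1].
  by rewrite (dx x).2 rpart_cst mul0r addr0 !mulrA.
apply: (IH (fun k => hs k.+1)) => //; last by move=> k x km; exact: bh.
rewrite !normrM mulr_ile1// mulr_ile1//.
by case: eqP => _; rewrite ?normr1 ?normr0.
Qed.

(** Telescoping. What matters is the order of the quantifiers: [K] depends on
neither the factors nor [d]. *)
Lemma Cm_bnd_prod_diff (I : eqType) m B (A : R) (r : seq I) : 0 <= A ->
  exists K : R, 0 <= K /\ forall (a b : I -> 'rV[R]_n -> R) (d : R), 0 <= d ->
    (forall i, smooth setT (a i)) -> (forall i, smooth setT (b i)) ->
    (forall i, Cm_bnd m B A (a i)) -> (forall i, Cm_bnd m B A (b i)) ->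
    (forall i, Cm_bnd m B d (fun x => a i x - b i x)) ->
    Cm_bnd m B K (fun x => \prod_(i <- r) b i x) /\
    Cm_bnd m B (K * d) (fun x => \prod_(i <- r) a i x - \prod_(i <- r) b i x).
Proof.
move=> A0; elim: r => [|i r [K [K0 IH]]].
  exists 1; split=> // a b d d0 sa sb ba bb bab; split.
    rewrite (_ : (fun x => _) = fun=> 1).
      by apply: Cm_bnd_cst; rewrite normr1.
    by apply/funext => x; rewrite big_nil.
  rewrite (_ : (fun x => _) = fun=> 0).
    by apply: Cm_bnd_cst; rewrite normr0 mul1r.
  by apply/funext => x; rewrite !big_nil subrr.
exists (2 ^+ m * (A * K) + 2 ^+ m * K).
have p0 : 0 <= (2 : R) ^+ m by rewrite exprn_ge0.
split; first by rewrite addr_ge0// !mulr_ge0.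
move=> a b d d0 sa sb ba bb bab.
have [bP dP] := IH a b d d0 sa sb ba bb bab.
have sPa : smooth setT (fun x => \prod_(i <- r) a i x).
  by apply: smooth_prod => //; exact: openT.
have sPb : smooth setT (fun x => \prod_(i <- r) b i x).
  by apply: smooth_prod => //; exact: openT.
split.
  rewrite (_ : (fun x => _) = fun x => b i x * \prod_(i <- r) b i x).
    apply: (Cm_bnd_le _ (Cm_bndM A0 K0 (sb i) sPb (bb i) bP)).
    by rewrite lerDl mulr_ge0.
  by apply/funext => x; rewrite big_cons.
rewrite (_ : (fun x => _) = fun x =>
    a i x * (\prod_(i <- r) a i x - \prod_(i <- r) b i x) +
    (a i x - b i x) * \prod_(i <- r) b i x).
  rewrite mulrDl -!mulrA [K * d]mulrC ![A * (_ * _)]mulrA.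
  have sd := smoothB openT sPa sPb.
  have sdi := smoothB openT (sa i) (sb i).
  apply: Cm_bndD; [exact: smoothM openT _ _|exact: smoothM openT _ _| | ].
    rewrite -!mulrA [d * K]mulrC; apply: Cm_bndM => //; exact: mulr_ge0.
  by apply: Cm_bndM.
by apply/funext => x; rewrite !big_cons; ring.
Qed.

End coordinates_and_bounds.

(** * Symmetry of mixed derivatives and Lipschitz bounds *)

Section schwarz.
Variables (R : realType) (n : nat).
Implicit Types (u v : 'rV[R]_n -> R) (U B : set 'rV[R]_n) (x y : 'rV[R]_n).
Notation e_ i := (@basis_vec R n i).

(** The mean value theorem, applied first along [e_ i] and then along [e_ j],
expresses the mixed second difference by one of the two mixed derivatives. *)
Lemma second_difference u x (i j : 'I_n) (h : R) : smooth setT u -> 0 < h ->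
  exists c d : R, [/\ 0 <= c <= h, 0 <= d <= h &
    u (h *: e_ i + (h *: e_ j + x)) - u (h *: e_ i + x) -
      (u (h *: e_ j + x) - u x) =
    h * h * rpart j (rpart i u) (d *: e_ j + (c *: e_ i + x))].
Proof.
move=> su h0.
have D w y k (t : R) : smooth setT w ->
    is_derive t (1 : R) (fun t => w (t *: e_ k + y)) (rpart k w (t *: e_ k + y)).
  by move=> sw; apply: is_derive_line; exact: smoothT_derivable.
pose w (t : R) := u (t *: e_ i + (h *: e_ j + x)) - u (t *: e_ i + x).
pose w' (t : R) := rpart i u (t *: e_ i + (h *: e_ j + x)) -
                   rpart i u (t *: e_ i + x).
have dw (t : R) : is_derive t (1 : R) w (w' t).
  by apply: is_deriveB; exact: D.
have C (f f' : R -> R) A : (forall t : R, is_derive t (1 : R) f (f' t)) ->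
    {within A, continuous f}.
  move=> df; apply: continuous_subspaceT => t.
  by apply/differentiable_continuous; rewrite -derivable1_diffP; have [] := df t.
have [c] := MVT_segment (ltW h0) (fun t _ => dw t) (C _ _ _ dw).
rewrite in_itv /= subr0 => ch wE.
pose z (t : R) := rpart i u (t *: e_ j + (c *: e_ i + x)).
pose z' (t : R) := rpart j (rpart i u) (t *: e_ j + (c *: e_ i + x)).
have dz (t : R) : is_derive t (1 : R) z (z' t).
  by apply: D; exact: smooth_rpart.
have [d] := MVT_segment (ltW h0) (fun t _ => dz t) (C _ _ _ dz).
rewrite in_itv /= subr0 => dh zE.
exists c, d; split => //.
have -> : h * h * rpart j (rpart i u) (d *: e_ j + (c *: e_ i + x)) = w' c * h.
  rewrite -[rpart j _ _]/(z' d) (_ : w' c = z h - z 0); first by rewrite zE; ring.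
  by rewrite /w' /z scale0r add0r addrCA.
by rewrite -wE /w scale0r !add0r.
Qed.

(** The second difference is symmetric in the two directions, so both mixed
derivatives take a common value at points arbitrarily close to [x]. *)
Lemma schwarz u (i j : 'I_n) : smooth setT u ->
  rpart i (rpart j u) = rpart j (rpart i u).
Proof.
move=> su; apply/funext => x; apply/eqP; rewrite -subr_eq0 -normr_le0.
apply/ler_addgt0Pl => e e0; rewrite addr0.
have e20 : 0 < e / 2 by rewrite divr_gt0.
have near_x w : smooth setT w -> exists2 r : R, 0 < r &
    forall y, `|y - x| < r -> `|w y - w x| < e / 2.
  move=> sw; have cw := smooth_cont sw (I : setT x).
  move/cvgrPdist_lt : cw => /(_ _ e20)/nbhs_ballP[r r0 rP].
  exists r => // y yx; rewrite distrC; apply: rP.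
  by rewrite /= -ball_normE /= distrC.
have [r1 r10 r1P] := near_x _ (smooth_rpart i (smooth_rpart j su)).
have [r2 r20 r2P] := near_x _ (smooth_rpart j (smooth_rpart i su)).
pose N := `|e_ i| + `|e_ j| + 1.
have N0 : 0 < N by rewrite ltr_wpDl// addr_ge0.
pose h := Num.min r1 r2 / N.
have m0 : 0 < Num.min r1 r2 by rewrite lt_min r10.
have h0 : 0 < h by rewrite divr_gt0.
have close k l (c d : R) : `|e_ k| + `|e_ l| < N -> 0 <= c <= h -> 0 <= d <= h ->
    `|(d *: e_ l + (c *: e_ k + x)) - x| < Num.min r1 r2.
  move=> klN /andP[c0 ch] /andP[d0 dh].
  rewrite addrA addrK (le_lt_trans (ler_normD _ _))// !normrZ !ger0_norm//.
  apply: (@le_lt_trans _ _ (h * (`|e_ k| + `|e_ l|))).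
    by rewrite mulrDr addrC lerD// ler_wpM2r.
  apply: (@lt_le_trans _ _ (h * N)); first by rewrite ltr_pM2l.
  by rewrite divfK// gt_eqF.
have [c [d [ch dh E1]]] := second_difference x i j su h0.
have [c' [d' [ch' dh' E2]]] := second_difference x j i su h0.
have ij : `|e_ i| + `|e_ j| < N by rewrite ltrDl.
have ji : `|e_ j| + `|e_ i| < N by rewrite addrC.
have E : rpart j (rpart i u) (d *: e_ j + (c *: e_ i + x)) =
         rpart i (rpart j u) (d' *: e_ i + (c' *: e_ j + x)).
  apply: (@mulfI _ (h * h)); first by rewrite mulf_neq0// gt_eqF.
  apply: (etrans (esym E1)); apply: (etrans _ E2).
  rewrite [h *: e_ i + (h *: e_ j + x)]addrCA.
  move: (u (h *: e_ j + (h *: e_ i + x))) (u (h *: e_ i + x))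
    (u (h *: e_ j + x)) (u x) => p q r s.
  by clear; ring.
have := close _ _ _ _ ij ch dh; rewrite lt_min => /andP[_ /r2P H2].
have := close _ _ _ _ ji ch' dh'; rewrite lt_min => /andP[/r1P H1 _].
rewrite [e]splitr; apply/ltW; move: H1 H2; rewrite E.
set p := rpart i _ (_ + _); set a := rpart i _ x; set b := rpart j _ x.
clearbody p a b => H1 H2; rewrite (_ : a - b = (a - p) + (p - b)); last by rewrite addrA subrK.
apply: (le_lt_trans (ler_normD _ _)).
rewrite distrC in H1; exact: ltrD H1 H2.
Qed.

Lemma rparts_rpart s (i : 'I_n) u : smooth setT u ->
  rparts s (rpart i u) = rpart i (rparts s u).
Proof.
move=> su; elim: s => //= j s ->; rewrite schwarz//; exact: smooth_rparts.
Qed.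

(** One coordinate is changed at a time, each at the cost of one mean value estimate. *)
Lemma lipschitz_rpart u (M : R) x y : smooth setT u -> 0 <= M ->
  (forall i z, `|rpart i u z| <= M) -> `|u x - u y| <= n%:R * M * `|x - y|.
Proof.
move=> su M0 uM.
have H (s : seq 'I_n) z : `|u (\sum_(i <- s) (x - y) 0 i *: e_ i + z) - u z| <=
    (size s)%:R * M * `|x - y|.
  elim: s z => [|i s IH] z; first by rewrite big_nil add0r subrr normr0 !mul0r.
  have -> : (size (i :: s))%:R * M * `|x - y| =
      M * `|x - y| + (size s)%:R * M * `|x - y|.
    by rewrite /= -natr1; ring.
  rewrite big_cons -addrA.
  set w := \sum_(i <- s) _ + z.
  rewrite (_ : _ - u z = (u ((x - y) 0 i *: e_ i + w) - u w) + (u w - u z)).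
    apply: (le_trans (ler_normD _ _)); apply: lerD; last exact: IH.
    apply: (le_trans (@MVT_line _ _ u w i M ((x - y) 0 i) _ _)).
    - by move=> v; exact: smoothT_derivable.
    - by move=> t _.
    - by rewrite mulrC ler_wpM2l// coord_le_norm.
  by clear; clearbody w; move: (u _) (u _) => p q; rewrite addrA subrK.
have := H (enum 'I_n) y; rewrite size_enum_ord big_enum /=.
have -> : \sum_(i in 'I_n) (x - y) 0 i *: e_ i = x - y.
  by rewrite [RHS]row_sum_delta; apply: eq_bigl.
by rewrite subrK.
Qed.

End schwarz.

(** * Supports; real and imaginary parts *)

Section support.
Variables (R : realType) (n : nat).
Implicit Types (u v : 'rV[R]_n -> R) (U B : set 'rV[R]_n) (x y : 'rV[R]_n).

Definition supported (r : R) u := forall x, r < `|x| -> u x = 0.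

Lemma open_norm_gt (r : R) : open [set x : 'rV[R]_n | r < `|x|].
Proof.
apply: (open_comp (f := fun x : 'rV[R]_n => `|x|) (D := [set t | r < t])).
  by move=> x _; exact: norm_continuous.
exact: open_gt.
Qed.

Lemma supported_rpart r u i : supported r u -> supported r (rpart i u).
Proof.
move=> ur x rx.
by rewrite (rpart_eq (v := fun=> 0) i (@open_norm_gt r) _ rx) ?rpart_cst.
Qed.

Lemma supported_rparts r u s : supported r u -> supported r (rparts s u).
Proof. by move=> ur; elim: s => //= i s; exact: supported_rpart. Qed.

Lemma closed_ball_compact (r : R) : compact [set x : 'rV[R]_n | `|x| <= r].
Proof.
apply: bounded_closed_compact.
  exists r; split; first exact: num_real.
  by move=> M rM x xr; exact: le_trans xr (ltW rM).
apply: (closed_comp (f := fun x : 'rV[R]_n => `|x|) (D := [set t | t <= r])).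
  by move=> x _; exact: norm_continuous.
exact: closed_le.
Qed.

Lemma continuous_bounded_on u (K : set 'rV[R]_n) : compact K -> continuous u ->
  exists2 M : R, 0 <= M & forall x, K x -> `|u x| <= M.
Proof.
move=> Kco cu.
have : compact (u @` K).
  by apply: continuous_compact => //; exact: continuous_subspaceT.
move=> /compact_bounded[M [Mr MP]]; exists (`|M| + 1); first by rewrite addr_ge0.
move=> x Kx; apply: (MP (`|M| + 1)); last by exists x.
by rewrite (le_lt_trans (ler_norm M))// ltrDl.
Qed.

Lemma supported_bounded r u : continuous u -> supported r u ->
  exists2 M : R, 0 <= M & forall x, `|u x| <= M.
Proof.
move=> cu ur; have [M M0 MP] := continuous_bounded_on (@closed_ball_compact r) cu.
exists M => // x; have [xr|/ur ->] := leP `|x| r; first exact: MP.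
by rewrite normr0.
Qed.

Lemma smoothT_continuous u : smooth setT u -> continuous u.
Proof. by move=> su x; exact: smooth_cont su I. Qed.

End support.

Section complex_real.
Variables (R : realType) (n : nat).
Implicit Types (f : 'rV[R]_n -> R[i]) (U : set 'rV[R]_n).
Notation Ref f := (fun x => complex.Re (f x)).
Notation Imf f := (fun x => complex.Im (f x)).

Lemma Re_partials s f x : complex.Re (partials s f x) = rparts s (Ref f) x.
Proof.
suff -> : rparts s (Ref f) = Ref (partials s f) by [].
by elim: s => //= i s ->.
Qed.

Lemma Im_partials s f x : complex.Im (partials s f x) = rparts s (Imf f) x.
Proof.
suff -> : rparts s (Imf f) = Imf (partials s f) by [].
by elim: s => //= i s ->.
Qed.

Lemma partialsE s f x :
  partials s f x = Complex (rparts s (Ref f) x) (rparts s (Imf f) x).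
Proof. by rewrite -Re_partials -Im_partials; case: (partials s f x). Qed.

Lemma smooth_onP U f : smooth_on U f <-> smooth U (Ref f) /\ smooth U (Imf f).
Proof.
have ReE s : (fun y => complex.Re (partials s f y)) = rparts s (Ref f).
  by apply/funext => y; rewrite Re_partials.
have ImE s : (fun y => complex.Im (partials s f y)) = rparts s (Imf f).
  by apply/funext => y; rewrite Im_partials.
split=> [sf|[/smoothP sr /smoothP si] s x Ux].
  by split; apply/smoothP => s x Ux; have [] := sf s x Ux;
    rewrite /continuousC /derivableC ReE ImE => -[? ?] d; split => // i;
    have [] := d i.
rewrite /continuousC /derivableC ReE ImE.
by have [? ?] := sr s x Ux; have [? ?] := si s x Ux.
Qed.

(** The order of derivation prescribed by [dpow], first entry outermost. *)
Definition index_seq (alpha : multi_index n) : seq 'I_n :=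
  flatten [seq nseq (alpha i) i | i <- enum 'I_n].

Lemma dpowE alpha f : dpow alpha f = partials (index_seq alpha) f.
Proof.
rewrite /dpow /index_seq; elim: (enum 'I_n) => //= i r ->.
by rewrite /partials foldr_cat; elim: (alpha i) => //= k ->.
Qed.

Lemma normc_ge (z : R[i]) : `|complex.Re z| <= normc z /\ `|complex.Im z| <= normc z.
Proof.
case: z => a b /=; split.
  by rewrite -sqrtr_sqr ler_sqrt ?lerDl ?addr_ge0 ?sqr_ge0.
by rewrite -sqrtr_sqr ler_sqrt ?lerDr ?addr_ge0 ?sqr_ge0.
Qed.

Lemma normc_le (z : R[i]) : normc z <= `|complex.Re z| + `|complex.Im z|.
Proof.
case: z => a b /=; rewrite -[leRHS]ger0_norm ?addr_ge0// -sqrtr_sqr.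
rewrite ler_sqrt ?sqr_ge0// -(real_normK (num_real a)) -(real_normK (num_real b)).
by rewrite sqrrD -addrA [_ *+ 2 + _]addrC addrA lerDl mulrn_wge0// mulr_ge0.
Qed.

End complex_real.

(** * Flat functions and regularised truncated powers *)

Section flat_functions.
Variable R : realType.
Implicit Types (Q : {poly R}) (d t r : R).

(** The rate [a] is split in two, one half for the leading factor [r] and one
half for the induction. *)
Lemma poly_expRN_bounded Q (a : R) : 0 < a ->
  exists2 C : R, 0 <= C & forall r, 0 <= r -> `|Q.[r] * expR (- (a * r))| <= C.
Proof.
elim/poly_ind: Q a => [|Q c IH] a a0.
  by exists 0 => // r _; rewrite horner0 mul0r normr0.
have a20 : 0 < a / 2 by rewrite divr_gt0.
have [C C0 CP] := IH _ a20.
exists (C * (2 / a) + `|c|); first by rewrite addr_ge0// mulr_ge0// divr_ge0// ltW.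
move=> r r0; rewrite hornerMXaddC mulrDl (le_trans (ler_normD _ _))//.
apply: lerD.
  have -> : expR (- (a * r)) = expR (- (a / 2 * r)) * expR (- (a / 2 * r)).
    by rewrite -expRD; congr expR; field.
  rewrite mulrACA normrM ler_pM//; first exact: CP.
  rewrite normrM !ger0_norm ?expR_ge0//.
  rewrite expRN ler_pdivrMr ?expR_gt0//.
  have := expR_ge1Dx (a / 2 * r) => h.
  have {1}-> : r = 2 / a * (a / 2 * r) by field; lra.
  rewrite ler_wpM2l ?divr_ge0// 1?ltW//.
  by apply: lt_le_trans h; rewrite ltrDr.
rewrite normrM (ger0_norm (expR_ge0 _)) -[leRHS]mulr1 ler_wpM2l//.
by rewrite -[leRHS]expR0 ler_expR oppr_le0 mulr_ge0// ltW.
Qed.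

Lemma poly_expRN_near0 Q :
  exists2 C : R, 0 <= C & forall r, 0 <= r ->
    `|Q.[r] * expR (- r) - Q.[0]| <= C * r.
Proof.
elim/poly_ind: Q => [|Q c _].
  by exists 0 => // r _; rewrite !horner0 mul0r subrr normr0 mul0r.
have [C C0 CP] := poly_expRN_bounded Q ltr01.
exists (C + `|c|); first by rewrite addr_ge0.
move=> r r0; rewrite !hornerMXaddC mulr0 add0r.
rewrite (_ : _ - c = Q.[r] * expR (- (1 * r)) * r + c * (expR (- r) - 1)); last first.
  by rewrite mul1r; ring.
rewrite (le_trans (ler_normD _ _))// mulrDl lerD//.
  by rewrite normrM (ger0_norm r0) ler_wpM2r// CP.
rewrite normrM ler_wpM2l// ler_norml; apply/andP; split.
  by rewrite lerBrDr addrC (le_trans _ (expR_ge1Dx _)).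
rewrite lerBlDr (@le_trans _ _ 1)//; last by rewrite lerDr.
by rewrite -[leRHS]expR0 ler_expR oppr_le0.
Qed.

(** The functions t_+^M Q(d/t) exp(-d/t), with Q a polynomial, are stable under
derivation, so that all derivatives of t_+^N exp(-d/t) are explicit. *)
Definition flat_fun (M : nat) Q d t : R :=
  if 0 < t then t ^+ M * (Q.[d / t] * expR (- (d / t))) else 0.

(** When [M] = 0 no power of t is left to absorb the factor 1/t that derivation
produces, and it is written as (d/t)/d; the result then depends on [d]. *)
Definition flat_deriv (M : nat) d Q : {poly R} :=
  if M is _.+1 then M%:R *: Q + 'X * (Q - Q^`())
  else d^-1 *: ('X^2 * (Q - Q^`())).

(** A quadratic bound at 0 makes the derivative there vanish. *)
Lemma flat_fun_small M Q d : 0 < d -> exists2 C : R, 0 <= C &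
  forall t, t <= 1 -> `|flat_fun M Q d t| <= C * t ^+ 2.
Proof.
move=> d0; have [C C0 CP] := poly_expRN_bounded ('X^2 * Q) ltr01.
exists (C / d ^+ 2); first by rewrite divr_ge0// sqr_ge0.
move=> t t1; rewrite /flat_fun; case: ifPn => t0; last first.
  by rewrite normr0 mulr_ge0 ?divr_ge0 ?sqr_ge0.
have := CP (d / t); rewrite mul1r hornerM hornerXn => h.
rewrite normrM -[leRHS]mul1r ler_pM//.
  by rewrite ger0_norm ?exprn_ge0 ?exprn_ile1// ltW.
rewrite (_ : Q.[_] * _ = ((d / t) ^+ 2 * Q.[d / t] * expR (- (d / t))) * (t ^+ 2 / d ^+ 2)).
  rewrite [leRHS]mulrAC -[leRHS]mulrA normrM ler_pM//; first by apply: h; rewrite divr_ge0// ltW.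
  by rewrite ger0_norm// divr_ge0// sqr_ge0.
by field; rewrite !gt_eqF.
Qed.

Lemma is_derive_flat_fun M Q d t : 0 < d ->
  is_derive t (1 : R) (flat_fun M Q d) (flat_fun M.-1 (flat_deriv M d Q) d t).
Proof.
move=> d0; have [t0|t0|->] := ltrgtP t 0.
- rewrite [X in is_derive _ _ _ X]/flat_fun ltNge (ltW t0) /=.
  apply: (near_eq_is_derive (f := cst (0 : R))).
  apply: filterS (lt_nbhsl t0) => s s0.
  by rewrite /flat_fun ltNge (ltW s0).
- apply: (near_eq_is_derive
    (f := (fun t => t ^+ M) * ((fun r => Q.[r] * expR (- r)) \o (fun t => d * t^-1)))).
    by apply: filterS (lt_nbhsr t0) => s s0; rewrite /flat_fun s0.
  have tn0 : t != 0 by rewrite gt_eqF.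
  have dr : is_derive t (1 : R) (fun t : R => d * t^-1) (- (d / t ^+ 2)).
    have dV : is_derive t (1 : R) (fun t : R => t^-1) (- (t ^- 2) *: 1).
      apply: DeriveDef; first by apply: derivableV => //; exact: derivable_id.
      by rewrite (@deriveV _ _ id) ?derive_id//; exact: derivable_id.
    have := is_deriveZ d dV.
    by rewrite [X in is_derive _ _ _ X -> _](_ : _ = - (d / t ^+ 2))//= /GRing.scale /= mulr1 mulrN.
  have dE (r : R) : is_derive r (1 : R) (fun r => expR (- r)) (- expR (- r)).
    have := @is_derive1_comp _ expR (fun r : R => - r) r (expR (- r)) (-1) _ _.
    by rewrite mulrN1; apply; exact: is_deriveNid.
  have dQ (r : R) : is_derive r (1 : R) (fun r => Q.[r] * expR (- r))
      (Q.[r] * - expR (- r) + expR (- r) * Q^`().[r]).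
    have := is_deriveM (is_derive_poly Q r) (dE r); exact.
  have dC := @is_derive1_comp _ _ _ t _ _ (dQ (d * t^-1)) dr.
  have dX : is_derive t (1 : R) (fun t : R => t ^+ M) (M%:R * t ^+ M.-1).
    apply: DeriveDef; first exact: exprn_derivable.
    by rewrite exp_derive /GRing.scale /= mulr1.
  have [H1 H2] := is_deriveM dX dC.
  apply: DeriveDef => //; rewrite H2 /flat_fun t0 /GRing.scale /= /flat_deriv.
  move: (expR _) => e; case: M {dX H1 H2} => [|M] /=.
    rewrite !hornerE /=; field; rewrite ?tn0 ?gt_eqF//.
  rewrite !hornerE /= exprS; field; rewrite ?tn0 ?gt_eqF//.
- rewrite [X in is_derive _ _ _ X]/flat_fun ltxx.
  have [C C0 CP] := flat_fun_small M Q d0.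
  have k0 : flat_fun M Q d 0 = 0 by rewrite /flat_fun ltxx.
  suff H : h^-1 *: ((flat_fun M Q d \o shift 0) (h *: 1) - flat_fun M Q d 0)
      @[h --> 0^'] --> (0 : R).
    by apply: DeriveDef; [apply/cvg_ex; exists 0|exact: cvg_lim H].
  apply/cvgrPdist_le => e e0.
  have : \forall h \near (0 : R)^', h != 0 /\ `|h| <= Num.min 1 (e / (C + 1)).
    have m0 : 0 < Num.min 1 (e / (C + 1)) by rewrite lt_min ltr01 divr_gt0// ltr_wpDl.
    near=> h; split; first by near: h; exact: nbhs_dnbhs_neq.
    near: h; exists (Num.min 1 (e / (C + 1))) => //= h.
    by rewrite /ball_ /= sub0r normrN => /ltW.
  apply: filterS => h [hn0]; rewrite le_min => /andP[h1 he].
  rewrite sub0r normrN /= addr0 k0 subr0 [h *: 1]mulr1.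
  rewrite /GRing.scale /= normrM normfV.
  have nh0 : 0 < `|h| by rewrite normr_gt0.
  rewrite ler_pdivrMl// (le_trans (CP h _))//; first exact: le_trans (ler_norm h) h1.
  rewrite -real_normK ?num_real// expr2 mulrCA ler_wpM2l//.
  rewrite (@le_trans _ _ (C * (e / (C + 1))))// ?ler_wpM2l//. 
  rewrite mulrCA -[leRHS]mulr1 ler_wpM2l ?(ltW e0)// ler_pdivrMr ?ltr_wpDl//.
  by rewrite mul1r lerDl.
Unshelve. all: by end_near. Qed.

End flat_functions.

Section regularised_powers.
Variable R : realType.
Implicit Types (Q : {poly R}) (d t r c : R).

Fixpoint reg_power_poly (N : nat) c d (j : nat) : {poly R} :=
  if j is j'.+1 then flat_deriv (N - j') d (reg_power_poly N c d j') else c%:P.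

(** The derivatives of order [j] of the regularisation c t_+^N exp(-d/t) of c t_+^N. *)
Definition reg_power (N : nat) c d (j : nat) : R -> R :=
  flat_fun (N - j) (reg_power_poly N c d j) d.

Definition trunc_power (N : nat) c t : R := if 0 < t then t ^+ N * c else 0.

Lemma is_derive_reg_power N c d j t : 0 < d ->
  is_derive t (1 : R) (reg_power N c d j) (reg_power N c d j.+1 t).
Proof. by move=> d0; rewrite /reg_power subnS; exact: is_derive_flat_fun. Qed.

(** Up to order [N] the exponent of t is still positive at each derivation. This is
what makes the estimates of orders below [N] uniform in [d]. *)
Lemma reg_power_poly_indep N c d d' j : (j <= N)%N ->
  reg_power_poly N c d j = reg_power_poly N c d' j.
Proof.
elim: j => //= j IH jN; rewrite (IH (ltnW jN)).
by rewrite /flat_deriv; case: (N - j)%N (subn_gt0 j N) => //; rewrite jN.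
Qed.

(** The error Q(d/t) exp(-d/t) - Q(0) is O(d/t), and one factor t pays for the
denominator. *)
Lemma flat_fun_near_power (M : nat) Q (L : R) : exists2 C : R, 0 <= C &
  forall d t, 0 < d -> t <= L ->
    `|flat_fun M.+1 Q d t - (if 0 < t then t ^+ M.+1 * Q.[0] else 0)| <= C * d.
Proof.
have [C C0 CP] := poly_expRN_near0 Q.
exists (`|L| ^+ M * C); first by rewrite mulr_ge0// exprn_ge0.
move=> d t d0 tL; rewrite /flat_fun; case: ifPn => t0; last first.
  by rewrite subrr normr0 !mulr_ge0// ?exprn_ge0// ltW.
rewrite -mulrBr normrM (ger0_norm (exprn_ge0 _ (ltW t0))).
apply: (@le_trans _ _ (t ^+ M.+1 * (C * (d / t)))).
  by rewrite ler_wpM2l ?exprn_ge0 ?(ltW t0)// CP// divr_ge0// ltW.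
rewrite (_ : _ * _ = t ^+ M * C * d); last first.
  by rewrite exprSr; field; rewrite gt_eqF.
rewrite ler_wpM2r ?(ltW d0)// ler_wpM2r//.
by rewrite lerXn2r ?nnegrE// ?(ltW t0)// (le_trans tL) ?ler_norm.
Qed.

Lemma fin_bound (N : nat) (P : nat -> R -> Prop) :
  (forall j C D, C <= D -> P j C -> P j D) ->
  (forall j, (j < N)%N -> exists2 C, 0 <= C & P j C) ->
  exists2 C, 0 <= C & forall j, (j < N)%N -> P j C.
Proof.
move=> mono; elim: N => [|N IH] ex; first by exists 0.
have [|C C0 CP] := IH; first by move=> j /ltnW jN; exact: ex.
have [D D0 DP] := ex N (ltnSn N).
exists (C + D); first exact: addr_ge0.
move=> j; rewrite ltnS leq_eqVlt => /predU1P[->|jN].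
  by apply: mono DP; rewrite lerDr.
by apply: mono (CP j jN); rewrite lerDl.
Qed.

(** Both functions are compared with their common limit as the parameter tends to 0. *)
Lemma reg_power_close (N : nat) c (L : R) : exists2 C : R, 0 <= C &
  forall j, (j < N)%N -> forall d d' t, 0 < d -> 0 < d' -> t <= L ->
    `|reg_power N c d j t - reg_power N c d' j t| <= C * (d + d').
Proof.
apply: fin_bound => [j C D CD h d d' t d0 d'0 tL|j jN].
  by apply: le_trans (h d d' t d0 d'0 tL) _; rewrite ler_wpM2r// ltW// addr_gt0.
rewrite /reg_power; case E : (N - j)%N (subn_gt0 j N) => [|M]; first by rewrite jN.
move=> _; have [C C0 CP] := flat_fun_near_power M (reg_power_poly N c 1 j) L.
exists C => // d d' t d0 d'0 tL.
rewrite (reg_power_poly_indep c d 1 (ltnW jN)) (reg_power_poly_indep c d' 1 (ltnW jN)).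
set l := if 0 < t then t ^+ M.+1 * (reg_power_poly N c 1 j).[0] else 0.
rewrite -(subrKA l) mulrDr (le_trans (ler_normD _ _))// lerD//; first exact: CP.
by rewrite distrC; exact: CP.
Qed.

Lemma reg_power_bounded_unif (N : nat) c (L : R) : exists2 C : R, 0 <= C &
  forall j, (j < N)%N -> forall d t, 0 < d < 1 -> t <= L ->
    `|reg_power N c d j t| <= C.
Proof.
apply: fin_bound => [j C D CD h d t d0 tL|j jN].
  by apply: le_trans (h d t d0 tL) _.
rewrite /reg_power; case E : (N - j)%N (subn_gt0 j N) => [|M]; first by rewrite jN.
move=> _; have [C C0 CP] := flat_fun_near_power M (reg_power_poly N c 1 j) L.
exists (C + `|L| ^+ M.+1 * `|(reg_power_poly N c 1 j).[0]|).
  by rewrite addr_ge0// mulr_ge0// exprn_ge0.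
move=> d t /andP[d0 d1] tL.
rewrite (reg_power_poly_indep c d 1 (ltnW jN)).
have := CP d t d0 tL; set l := if _ then _ else _ => h.
have lb : `|l| <= `|L| ^+ M.+1 * `|(reg_power_poly N c 1 j).[0]|.
  rewrite /l; case: ifPn => t0; last by rewrite normr0 mulr_ge0// exprn_ge0.
  rewrite normrM ler_wpM2r// normrX lerXn2r ?nnegrE//.
  by rewrite gtr0_norm// (le_trans tL) ?ler_norm.
rewrite -[flat_fun _ _ _ _](subrK l) (le_trans (ler_normD _ _))// lerD//.
by rewrite (le_trans h)// ler_piMr// ltW.
Qed.

Lemma reg_power_close_trunc (N : nat) c (L : R) : (0 < N)%N -> exists2 C : R, 0 <= C &
  forall d t, 0 < d -> t <= L -> `|reg_power N c d 0 t - trunc_power N c t| <= C * d.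
Proof.
case: N => // N _; have [C C0 CP] := flat_fun_near_power N c%:P L.
exists C => // d t d0 tL; have := CP d t d0 tL.
by rewrite hornerC /reg_power /= subn0.
Qed.

Lemma reg_power_bounded (d : R) (N : nat) c j (L : R) : 0 < d ->
  exists2 C : R, 0 <= C & forall t, `|t| <= L -> `|reg_power N c d j t| <= C.
Proof.
move=> d0; have [C C0 CP] := poly_expRN_bounded (reg_power_poly N c d j) ltr01.
exists (`|L| ^+ (N - j) * C); first by rewrite mulr_ge0// exprn_ge0.
move=> t tL; rewrite /reg_power /flat_fun; case: ifPn => t0; last first.
  by rewrite normr0 mulr_ge0// exprn_ge0.
rewrite normrM ler_pM// ?normrX ?lerXn2r ?nnegrE//.
  exact: le_trans tL (ler_norm L).
by have := CP (d / t); rewrite mul1r; apply; rewrite divr_ge0// ltW.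
Qed.

Lemma continuous_trunc_power (N : nat) c : (0 < N)%N -> continuous (trunc_power N c).
Proof.
move=> N0.
have -> : trunc_power N c = fun t => Num.max 0 t ^+ N * c.
  apply/funext => t; rewrite /trunc_power; case: ifPn => t0.
    by rewrite max_r// ltW.
  by rewrite max_l ?leNgt// expr0n gtn_eqF// mul0r.
move=> t; apply: cvgM; last exact: cvg_cst.
apply: (@continuous_comp _ _ _ (fun t : R => Num.max 0 t) (fun t => t ^+ N)).
  by apply: continuous_max; [exact: cst_continuous|exact: cvg_id].
exact: exprn_continuous.
Qed.

End regularised_powers.

(** * Smooth cutoffs *)

Section cutoff.
Variables (R : realType) (n : nat).
Implicit Types (u v : 'rV[R]_n -> R) (U B K : set 'rV[R]_n) (x y : 'rV[R]_n).

Lemma CkV k U u : open U -> (forall x, U x -> u x != 0) -> Ck k U u ->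
  Ck k U (fun x => (u x)^-1).
Proof.
move=> Uo u0; elim: k => [|k IH].
  move=> /= [cu _]; split=> // x Ux; exact: (continuousV (u0 x Ux) (cu x Ux)).
move=> uk; have uk' := IH (CkS uk); move: uk => [cu [du pu]]; split.
  by move=> x Ux; exact: (continuousV (u0 x Ux) (cu x Ux)).
split=> [x i Ux|i]; first by apply: derivableV; [exact: u0|exact: du].
apply: (@Ck_eq _ _ k U (fun x => (-1) * ((u x)^-1 * (u x)^-1 * rpart i u x))) => //.
  move=> x Ux; rewrite /rpart deriveV; [|exact: u0|exact: du].
  by rewrite /GRing.scale /= mulN1r mulNr expr2 invfM.
apply: CkM => //; first exact: Ck_cst.
by apply: CkM => //; [exact: CkM|exact: pu].
Qed.

(** The function exp(-1/t) on t > 0, extended by 0. *)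
Definition exp_step (t : R) : R := flat_fun 0 1 1 t.

Lemma exp_step_ge0 t : 0 <= exp_step t.
Proof.
by rewrite /exp_step /flat_fun; case: ifP => //; rewrite expr0 mul1r hornerC mul1r expR_ge0.
Qed.

Lemma exp_step_gt0 t : 0 < t -> 0 < exp_step t.
Proof.
by move=> t0; rewrite /exp_step /flat_fun t0 expr0 mul1r hornerC mul1r expR_gt0.
Qed.

Lemma exp_step_le0 t : t <= 0 -> exp_step t = 0.
Proof. by move=> t0; rewrite /exp_step /flat_fun ltNge t0. Qed.

Lemma smooth_exp_step (a b : R) (i : 'I_n) : smooth setT (fun x => exp_step (a * x 0 i + b)).
Proof.
apply: (smooth_coord (hs := reg_power 0 1 1) a b i openT).
by move=> j t; exact: is_derive_reg_power.
Qed.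

Definition smooth_step (t : R) : R := exp_step t / (exp_step t + exp_step (1 - t)).

Lemma exp_step_sum_neq0 t : exp_step t + exp_step (1 - t) != 0.
Proof.
rewrite gt_eqF//; have [t0|t0] := ltP 0 t.
  by rewrite ltr_wpDr ?exp_step_ge0// exp_step_gt0.
by rewrite ltr_wpDl ?exp_step_ge0// exp_step_gt0// subr_gt0 (le_lt_trans t0).
Qed.

Lemma smooth_step_le0 t : t <= 0 -> smooth_step t = 0.
Proof. by move=> t0; rewrite /smooth_step exp_step_le0// mul0r. Qed.

Lemma smooth_step_ge1 t : 1 <= t -> smooth_step t = 1.
Proof.
move=> t1; have := exp_step_sum_neq0 t.
by rewrite /smooth_step [exp_step (1 - t)]exp_step_le0 ?subr_le0// addr0 => /divff.
Qed.

Lemma smooth_smooth_step (a b : R) (i : 'I_n) : smooth setT (fun x => smooth_step (a * x 0 i + b)).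
Proof.
apply: smoothM; [exact: openT|exact: smooth_exp_step|] => k.
apply: CkV; [exact: openT|by move=> x _; exact: exp_step_sum_neq0|].
apply: CkD; [exact: openT|exact: smooth_exp_step|].
apply: (@Ck_eq _ _ k setT (fun x => exp_step (- a * x 0 i + (1 - b)))) => //.
- exact: openT.
- by move=> x _; congr exp_step; ring.
- exact: smooth_exp_step.
Qed.

Definition bump (p : 'rV[R]_n) (r : R) x : R :=
  \prod_(i <- enum 'I_n)
    (smooth_step (r^-1 * x 0 i + (2 - r^-1 * p 0 i)) *
     smooth_step (- r^-1 * x 0 i + (2 + r^-1 * p 0 i))).

Lemma smooth_bump p r : smooth setT (bump p r).
Proof.
apply: smooth_prod => [|i]; first exact: openT.
by apply: smoothM; [exact: openT|exact: smooth_smooth_step|exact: smooth_smooth_step].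
Qed.

Lemma bump1 p r x : 0 < r -> `|x - p| <= r -> bump p r x = 1.
Proof.
move=> r0 xp; rewrite /bump big1// => i _.
have := le_trans (coord_le_norm (x - p) i) xp.
rewrite !mxE ler_norml => /andP[h1 h2].
rewrite !smooth_step_ge1 ?mulr1//.
  rewrite (_ : _ + _ = 2 - (x 0 i - p 0 i) / r); last by field; rewrite gt_eqF.
  have : (x 0 i - p 0 i) / r <= 1 by rewrite ler_pdivrMr// mul1r.
  lra.
rewrite (_ : _ + _ = 2 + (x 0 i - p 0 i) / r); last by field; rewrite gt_eqF.
have : -1 <= (x 0 i - p 0 i) / r by rewrite ler_pdivlMr// mulN1r.
lra.
Qed.

Lemma bump0 p r x : 0 < r -> 2 * r < `|x - p| -> bump p r x = 0.
Proof.
move=> r0 xp; have : exists i, 2 * r < `|(x - p) 0 i|.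
  apply: contrapT => nex; move: xp; rewrite ltNge => /negP; apply.
  apply: norm_le_coord => [|i]; first by rewrite mulr_ge0// ltW.
  by rewrite leNgt; apply/negP => h; apply: nex; exists i.
move=> [i xi]; apply/eqP; rewrite /bump prodf_seq_eq0; apply/hasP; exists i.
  exact: mem_enum.
rewrite /= mulf_eq0; move: xi; rewrite !mxE ltr_normr => /orP[h|h].
  apply/orP; right; rewrite smooth_step_le0//.
  rewrite (_ : _ + _ = 2 - (x 0 i - p 0 i) / r); last by field; rewrite gt_eqF.
  have : 2 <= (x 0 i - p 0 i) / r by rewrite ler_pdivlMr//; lra.
  lra.
apply/orP; left; rewrite smooth_step_le0//.
rewrite (_ : _ + _ = 2 + (x 0 i - p 0 i) / r); last by field; rewrite gt_eqF.
have : (x 0 i - p 0 i) / r <= - 2 by rewrite ler_pdivrMr//; lra.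
lra.
Qed.

(** The compact set is covered by finitely many boxes on which a bump is 1, and
1 - prod (1 - bump) is 1 as soon as one of the bumps is. *)
Lemma cutoff K U : open U -> compact K -> K `<=` U ->
  exists (K' V : set 'rV[R]_n) (chi : 'rV[R]_n -> R),
    [/\ compact K' /\ K' `<=` U, smooth setT chi,
        forall x, ~ K' x -> chi x = 0,
        open V & K `<=` V /\ forall x, V x -> chi x = 1].
Proof.
move=> Uo Kco KU.
have rad (p : 'rV[R]_n) : exists r : R, 0 < r /\
    (K p -> forall x, `|x - p| <= 2 * r -> U x).
  have [Kp|] := pselect (K p); last by exists 1.
  have /nbhs_ballP[e /= e0 eU] : nbhs p U by apply: open_nbhs_nbhs; split=> //; exact: KU.
  exists (e / 4); split; first by rewrite divr_gt0.
  move=> _ x xp; apply: eU; rewrite -ball_normE /= distrC.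
  by apply: (le_lt_trans xp); lra.
have [r rP] := choice rad.
have cK : cover_compact K by rewrite -compact_cover.
have [] := cK _ K (fun y => ball y (r y)).
- by move=> y _; apply: ball_open; exact: (rP y).1.
- by move=> y Ky; exists y => //; exact: ballxx (rP y).1.
move=> D DK Kcov.
pose s := enum_fset D.
have sK p : p \in s -> K p by move=> ps; have /DK := ps; move/set_mem.
exists (\big[setU/set0]_(p <- s) [set x | `|x - p| <= 2 * r p]).
exists (\bigcup_(p in [set p | p \in s]) ball p (r p)).
exists (fun x => 1 - \prod_(p <- s) (1 - bump p (r p) x)).
split.
- split.
    elim: s {sK} => [|p s IH]; first by rewrite big_nil; exact: compact0.
    rewrite big_cons; apply: compactU => //.
    have -> : [set x | `|x - p| <= 2 * r p] =
        (fun x => x + p) @` [set x : 'rV[R]_n | `|x| <= 2 * r p].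
      apply/seteqP; split=> [x xp|_ [x xp <-]] /=; last by rewrite addrK.
      by exists (x - p) => //; rewrite subrK.
    apply: continuous_compact; last exact: closed_ball_compact.
    apply: continuous_subspaceT => x.
    exact: (continuousD (f := id) (g := fun=> p) cvg_id (@cst_continuous _ _ p x)).
  move=> x; elim: s sK => [|p s IH] sK; first by rewrite big_nil.
  rewrite big_cons => -[xp|]; first by apply: (rP p).2 xp; apply: sK; exact: mem_head.
  by apply: IH => q qs; apply: sK; rewrite in_cons qs orbT.
- apply: smoothB; [exact: openT|exact/smooth_cst/openT|].
  apply: smooth_prod => [|p]; first exact: openT.
  by apply: smoothB; [exact: openT|exact/smooth_cst/openT|exact: smooth_bump].
- move=> x nx; rewrite big1_seq ?subrr// => p /= ps; rewrite bump0 ?subr0//.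
    exact: (rP p).1.
  rewrite ltNge; apply/negP => xp; apply: nx.
  by rewrite -bigcup_seq; exists p.
- by apply: bigcup_open => p _; apply: ball_open; exact: (rP p).1.
split; first by move=> x /Kcov[p /= pD xp]; exists p.
move=> x [p /= ps]; rewrite -ball_normE /= distrC => xp.
rewrite (_ : \prod_(_ <- _) _ = 0) ?subr0//; apply/eqP.
rewrite prodf_seq_eq0; apply/hasP; exists p => //=.
by rewrite bump1 ?subrr ?eqxx ?(ltW xp)//; exact: (rP p).1.
Qed.

End cutoff.

(** * Integration of compactly supported functions on R^n *)

Section vcons.
Variable R : realType.

Definition vcons (n : nat) (t : R) (y : 'rV[R]_n) : 'rV[R]_n.+1 :=
  row_mx t%:M y.

Lemma vcons0 n t (y : 'rV[R]_n) : vcons t y 0 ord0 = t.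
Proof.
have E := row_mxEl (t%:M : 'M[R]_1) y 0 (ord0 : 'I_1).
rewrite [RHS](_ : t = (t%:M : 'M[R]_1) 0 0); last by rewrite mxE eqxx.
by rewrite -E /vcons; congr (row_mx _ _ _ _); exact: val_inj.
Qed.

Lemma vconsS n t (y : 'rV[R]_n) i : vcons t y 0 (lift ord0 i) = y 0 i.
Proof.
rewrite -(row_mxEr (t%:M : 'M[R]_1) y 0 i) /vcons.
by congr (row_mx _ _ _ _); exact: val_inj.
Qed.

Lemma vcons_ext n (x y : 'rV[R]_n.+1) : x 0 ord0 = y 0 ord0 ->
  (forall i, x 0 (lift ord0 i) = y 0 (lift ord0 i)) -> x = y.
Proof.
move=> h0 hS; apply/rowP => i; case: (unliftP ord0 i) => [j ->|->] //.
Qed.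

Lemma rVBE n (x y : 'rV[R]_n) i : (x - y) 0 i = x 0 i - y 0 i.
Proof. by rewrite !mxE. Qed.

Lemma vconsB n s t (x y : 'rV[R]_n) : vcons s x - vcons t y = vcons (s - t) (x - y).
Proof.
by apply: vcons_ext => [|i]; rewrite rVBE ?vcons0 ?vconsS// rVBE.
Qed.

Lemma vcons_le n t (y : 'rV[R]_n) r : `|t| <= r -> `|y| <= r -> `|vcons t y| <= r.
Proof.
move=> tr yr; apply: norm_le_coord => [|i]; first exact: le_trans tr.
case: (unliftP ord0 i) => [j ->|->]; rewrite ?vcons0 ?vconsS//.
exact: le_trans (coord_le_norm y j) yr.
Qed.

Lemma vcons_ge_head n t (y : 'rV[R]_n) : `|t| <= `|vcons t y|.
Proof. by have := coord_le_norm (vcons t y) ord0; rewrite vcons0. Qed.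

Lemma vcons_ge_tail n t (y : 'rV[R]_n) : `|y| <= `|vcons t y|.
Proof.
apply: norm_le_coord => // i.
by have := coord_le_norm (vcons t y) (lift ord0 i); rewrite vconsS.
Qed.

Lemma continuous_nonexpanding (V W : normedModType R) (f : V -> W) :
  (forall x y, `|f x - f y| <= `|x - y|) -> continuous f.
Proof.
move=> fle x; apply/cvgrPdist_lt => e e0.
apply: filterS (nbhsx_ballx x e e0) => z; rewrite -ball_normE /= => xz.
exact: le_lt_trans xz.
Qed.

Lemma continuous_vcons_tail n t : continuous (@vcons n t).
Proof.
apply: continuous_nonexpanding => x y; rewrite vconsB subrr.
by apply: vcons_le => //; rewrite normr0.
Qed.

Lemma continuous_vcons_head n (y : 'rV[R]_n) : continuous (fun t => vcons t y).
Proof.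
apply: (@continuous_nonexpanding R) => s t; rewrite vconsB subrr.
by apply: vcons_le => //; rewrite normr0.
Qed.

End vcons.

Section measurability.
Variable R : realType.

Lemma measurable_coord n (i : 'I_n) :
  measurable_fun setT (fun y : Rn R n => coords y 0 i : measurableTypeR R).
Proof.
elim: n i => [[]//|n IH i].
case: (unliftP ord0 i) => [j ->|->].
  rewrite (_ : (fun y => _) = (fun y : Rn R n => coords y 0 j) \o snd).
    by apply: measurableT_comp => //; exact: IH.
  by apply/funext => -[t y] /=; rewrite -/(vcons t (coords y)) vconsS.
rewrite (_ : (fun y => _) = fst); first exact: measurable_fst.
by apply/funext => -[t y] /=; rewrite -/(vcons t (coords y)) vcons0.
Qed.

Lemma measurable_coords_box n (p : 'rV[R]_n) (r : R) : 0 <= r ->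
  measurable [set y : Rn R n | `|coords y - p| <= r].
Proof.
move=> r0.
have -> : [set y : Rn R n | `|coords y - p| <= r] =
    \bigcap_(i in [set: 'I_n])
      [set y : Rn R n | coords y 0 i \in `[p 0 i - r, p 0 i + r]].
  apply/seteqP; split=> y /=.
    move=> yp i _ /=; have := le_trans (coord_le_norm (coords y - p) i) yp.
    by rewrite !mxE ler_distl in_itv.
  move=> yp; apply: norm_le_coord => // i.
  by have := yp i I; rewrite /= in_itv !mxE ler_distl.
apply: fin_bigcap_measurable; first exact: finite_finset.
move=> i _; rewrite -[X in measurable X]setTI.
exact: (measurable_coord i measurableT (measurable_itv `[p 0 i - r, p 0 i + r])).
Qed.

(** An open set is the union of the countably many boxes with rational data that
it contains. *)
Lemma measurable_coords_open n (U : set 'rV[R]_n) : open U ->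
  measurable (@coords R n @^-1` U).
Proof.
move=> Uo.
pose q (a : {ffun 'I_n -> rat}) : 'rV[R]_n := \row_i ratr (a i).
pose F (ak : {ffun 'I_n -> rat} * nat) : set (Rn R n) :=
  if `[< forall x, `|x - q ak.1| <= ak.2.+1%:R^-1 -> U x >]
  then [set y : Rn R n | `|coords y - q ak.1| <= ak.2.+1%:R^-1] else set0.
have -> : @coords R n @^-1` U = \bigcup_ak F ak.
  apply/seteqP; split=> y /=; last first.
    move=> [ak _]; rewrite /F; case: asboolP => // h; exact: h.
  move=> Uy; have /nbhs_ballP[e /= e0 eU] : nbhs (coords y) U.
    exact: open_nbhs_nbhs.
  have [k] := natr_above (3 / e); move=> ke.
  pose r : R := k.+1%:R^-1.
  have r0 : 0 < r by rewrite invr_gt0 ltr0n.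
  have re : 2 * r < e.
    have : 3 / e <= k.+1%:R by rewrite (le_trans ke)// ler_nat.
    rewrite ler_pdivrMr// -ler_pdivrMl ?ltr0n// -/r => h.
    have : 0 < r by []. lra.
  have ex i : exists a : rat, `|coords y 0 i - ratr a| <= r.
    have lt : coords y 0 i - r < coords y 0 i + r by rewrite ltrD2l gtrN.
    have [a] := rat_in_itvoo lt; rewrite in_itv /= => /andP[h1 h2].
    by exists a; rewrite ler_distlC ltW//= ltW.
  have [a aP] := choice ex.
  have ya : `|coords y - q [ffun i => a i]| <= r.
    apply: norm_le_coord => [|i]; first exact: ltW.
    by rewrite !mxE ffunE.
  exists ([ffun i => a i], k) => //; rewrite /F; case: asboolP => //= nU.
  exfalso; apply: nU => x xa; apply: eU; rewrite -ball_normE /=.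
  rewrite (_ : coords y - x = (coords y - q [ffun i => a i]) - (x - q [ffun i => a i])).
    rewrite (le_lt_trans (ler_normB _ _))// (le_lt_trans (lerD ya xa))//.
    by rewrite -/r -mulr2n -mulr_natl.
  by rewrite opprB addrA subrK.
apply: countable_bigcupT_measurable; first exact: countableP.
move=> ak; rewrite /F; case: asboolP => // _.
by apply: measurable_coords_box; rewrite invr_ge0.
Qed.

Lemma measurable_coords_fun n (h : 'rV[R]_n -> R) : continuous h ->
  measurable_fun setT (fun y : Rn R n => h (coords y) : measurableTypeR R).
Proof.
move=> ch; apply: (measurability _ (measurable_realfun.RGenOpens.measurableE R)).
move=> _ [_ [a [b ->] <-]]; rewrite setTI.
rewrite (_ : _ @^-1` _ = @coords R n @^-1` (h @^-1` `]a, b[)) //.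
apply: measurable_coords_open; move/continuousP: ch; apply.
exact: interval_open.
Qed.

Lemma box_measure n (r : R) : 0 <= r ->
  lebesgue_Rn R n [set y : Rn R n | `|coords y| <= r] = ((2 * r) ^+ n)%:E.
Proof.
move=> r0; elim: n => [|n IH].
  rewrite (_ : mkset _ = setT) /=; first by rewrite diracT expr0.
  by apply/seteqP; split=> // y _ /=; apply: norm_le_coord => // -[].
have -> : [set y : Rn R n.+1 | `|coords y| <= r] =
    `[- r, r] `*` [set y : Rn R n | `|coords y| <= r].
  apply/seteqP; split=> [[t y]|[t y]] /=; rewrite -/(vcons t (coords y)).
    move=> h; rewrite in_itv /= -ler_norml.
    by rewrite (le_trans (vcons_ge_head t (coords y)) h) (le_trans (vcons_ge_tail t (coords y)) h).
  by move=> [h1 h2]; apply: vcons_le => //; rewrite ler_norml; move: h1; rewrite in_itv.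
rewrite /= /sfprod product_measure1E//=; last first.
  have := @measurable_coords_box n 0 r r0.
  by under eq_set do rewrite subr0.
rewrite IH lebesgue_measure_itv /= lte_fin.
case: ltP => [rr|]; first by rewrite -EFinB -EFinM exprS; congr (_ * _)%:E; ring.
move=> rr; have -> : r = 0 by lra.
by rewrite mul0e mulr0 exprS mul0r.
Qed.

End measurability.

Section integral.
Variable R : realType.
Notation mu := (@lebesgue_measure R).

(** Real functions on row vectors are integrated through their coordinates, as
in [integralC]. *)
Definition intR n (h : 'rV[R]_n -> R) : R :=
  \int[lebesgue_Rn R n]_y h (coords y).

Definition int1 (w : R -> R) : R := \int[mu]_t w t.

Lemma box_lty n (r : R) : 0 <= r ->
  (lebesgue_Rn R n [set y : Rn R n | (`|coords y| <= r)%R] < +oo)%E.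
Proof. by move=> r0; rewrite box_measure// ltry. Qed.

Lemma integrable_supported n (h : 'rV[R]_n -> R) r : continuous h -> supported r h ->
  (lebesgue_Rn R n).-integrable setT (EFin \o (fun y => h (coords y))).
Proof.
move=> ch hr.
pose B := [set y : Rn R n | `|coords y| <= `|r|].
have mB : measurable B.
  have := @measurable_coords_box R n 0 `|r| (normr_ge0 r).
  by under eq_set do rewrite subr0.
have [M M0 hM] := supported_bounded ch hr.
have iB : (lebesgue_Rn R n).-integrable B (EFin \o (fun y => h (coords y))).
  apply: measurable_bounded_integrable => //.
  - exact: box_lty.
  - apply: measurable_funTS; exact: measurable_coords_fun.
  - exists M; split; first exact: num_real.
    by move=> N MN y _ /=; exact: le_trans (hM _) (ltW MN).
move/(integrable_mkcond _ mB) : iB.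
congr (integrable _ _ _); apply/funext => y; rewrite /patch.
case: ifPn => // yB; rewrite /= hr//.
have : ~ B y by move=> By; move/negP : yB; apply; exact/mem_set.
by rewrite /B /= => /negP; rewrite -ltNge; exact: le_lt_trans (ler_norm r).
Qed.

Lemma integrable_supported1 (w : R -> R) (a b : R) : continuous w ->
  (forall t, ~ (a <= t <= b) -> w t = 0) ->
  mu.-integrable setT (EFin \o w).
Proof.
move=> cw w0.
have iB : mu.-integrable `[a, b] (EFin \o w).
  apply: continuous_compact_integrable; first exact: segment_compact.
  exact: continuous_subspaceT.
move/integrable_mkcond : iB => /(_ (measurable_itv _)).
congr (integrable _ _ _); apply/funext => t; rewrite /patch.
case: ifPn => // tB; rewrite /= w0// => tab.
by move/negP : tB; apply; apply/mem_set; rewrite /= in_itv.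
Qed.

Section linear.
Variables (n : nat) (h k : 'rV[R]_n -> R) (r s : R).
Hypotheses (ch : continuous h) (hr : supported r h).
Hypotheses (ck : continuous k) (ks : supported s k).

Lemma intRD : intR (fun x => h x + k x) = intR h + intR k.
Proof.
by rewrite /intR RintegralD//;
  [exact: integrable_supported ch hr|exact: integrable_supported ck ks].
Qed.

Lemma intRB : intR (fun x => h x - k x) = intR h - intR k.
Proof.
by rewrite /intR RintegralB//;
  [exact: integrable_supported ch hr|exact: integrable_supported ck ks].
Qed.

Lemma intRZ c : intR (fun x => c * h x) = c * intR h.
Proof. by rewrite /intR RintegralZl//; exact: integrable_supported ch hr. Qed.

Lemma intR_bound M : 0 <= M -> (forall x, `|h x| <= M) -> 0 <= r ->
  `|intR h| <= M * (2 * r) ^+ n.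
Proof.
move=> M0 hM r0; rewrite /intR.
have ih := integrable_supported ch hr.
apply: (le_trans (le_normr_Rintegral _ ih)) => //.
pose B := [set y : Rn R n | `|coords y| <= r].
have mB : measurable B.
  have := @measurable_coords_box R n 0 r r0.
  by under eq_set do rewrite subr0.
have -> : \int[lebesgue_Rn R n]_t `|h (coords t)| =
    \int[lebesgue_Rn R n]_(t in B) `|h (coords t)|.
  rewrite [RHS]Rintegral_mkcond; apply: eq_Rintegral => y _; rewrite /patch.
  case: ifPn => // yB; rewrite hr ?normr0//.
  have : ~ B y by move=> By; move/negP : yB; apply; exact/mem_set.
  by rewrite /B /= => /negP; rewrite -ltNge.
have boxE : fine (lebesgue_Rn R n B) = (2 * r) ^+ n by rewrite box_measure.
rewrite -boxE -Rintegral_cst//.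
apply: le_Rintegral => //.
- apply: (@integrableS _ _ _ _ setT) => //.
  exact: (integrable_norm ih).
- apply: measurable_bounded_integrable => //; first exact: box_lty.
  exists M; split; first exact: num_real.
  by move=> N MN y _ /=; rewrite ger0_norm// ltW.
Qed.

End linear.

Lemma eq_intR n (h k : 'rV[R]_n -> R) : h =1 k -> intR h = intR k.
Proof. by move=> hk; apply: eq_Rintegral => y _; exact: hk. Qed.

Lemma eq_int1 (h k : R -> R) : h =1 k -> int1 h = int1 k.
Proof. by move=> hk; apply: eq_Rintegral => y _; exact: hk. Qed.

Lemma intR_dim0 (h : 'rV[R]_0 -> R) : intR h = h 0.
Proof.
rewrite /intR /Rintegral /= integral_dirac//=.
by rewrite indicT mul1r.
Qed.

Section fubini.
Variables (n : nat) (h : 'rV[R]_n.+1 -> R) (r : R).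
Hypotheses (ch : continuous h) (hr : supported r h).

Lemma continuous_slice_tail t : continuous (fun y => h (vcons t y)).
Proof.
move=> y; apply: (@continuous_comp _ _ _ (vcons t) h); last exact: ch.
exact: continuous_vcons_tail.
Qed.

Lemma supported_slice_tail t : supported r (fun y => h (vcons t y)).
Proof. by move=> y ry; apply: hr; exact: lt_le_trans ry (vcons_ge_tail t y). Qed.

Lemma continuous_slice_head (y : 'rV[R]_n) : continuous (fun t => h (vcons t y)).
Proof.
move=> t; apply: (@continuous_comp _ _ _ (fun t => vcons t y) h); last exact: ch.
exact: continuous_vcons_head.
Qed.

Lemma slice_head0 (y : 'rV[R]_n) t : ~ (- r <= t <= r) -> h (vcons t y) = 0.
Proof.
rewrite -ler_norml => /negP; rewrite -ltNge => rt; apply: hr.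
exact: lt_le_trans rt (vcons_ge_head t y).
Qed.

Let ih := integrable_supported ch hr.

(** With both orders of integration at hand, proofs by induction on the dimension
only meet slices of continuous functions, and never have to show that a
partially integrated function is continuous. *)
Lemma intR_fubini1 : intR h = int1 (fun t => intR (fun y => h (vcons t y))).
Proof.
rewrite /intR /int1 /Rintegral; congr fine.
have := integral12_prod_meas1 (m1 := mu) (m2 := lebesgue_Rn R n) ih.
rewrite /= => <-; apply: eq_integral => t _; rewrite /fubini_F /=.
rewrite fineK//; apply: integrable_fin_num => //.
exact: integrable_supported (@continuous_slice_tail t) (@supported_slice_tail t).
Qed.

Lemma intR_fubini2 : intR h = intR (fun y => int1 (fun t => h (vcons t y))).
Proof.
rewrite /intR /int1 /Rintegral; congr fine.
have := integral21_prod_meas1 (m1 := mu) (m2 := lebesgue_Rn R n) ih.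
rewrite /= => <-; apply: eq_integral => y _; rewrite /fubini_G /=.
rewrite fineK//; apply: integrable_fin_num => //.
exact: integrable_supported1 (@continuous_slice_head (coords y)) (@slice_head0 (coords y)).
Qed.

End fubini.

Lemma int1_FTC (a b : R) (w v W : R -> R) : a < b ->
  (forall t, ~ (a <= t <= b) -> w t = 0) ->
  (forall t, a <= t <= b -> w t = v t) -> continuous v ->
  (forall t : R, is_derive t (1 : R) W (v t)) -> int1 w = W b - W a.
Proof.
move=> ab w0 wv cv dW; rewrite /int1.
have -> : \int[mu]_t w t = \int[mu]_(t in `[a, b]) v t.
  rewrite [RHS]Rintegral_mkcond; apply: eq_Rintegral => t _; rewrite /patch.
  case: ifPn => [/set_mem|tB]; first by rewrite /= in_itv => /wv.
  apply: w0 => tab; move/negP : tB; apply; apply/mem_set.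
  by rewrite /= in_itv.
have cW : continuous W.
  move=> t; apply/differentiable_continuous; rewrite -derivable1_diffP.
  by have [] := dW t.
rewrite /Rintegral (continuous_FTC2 (F := W) ab)//.
- exact: continuous_subspaceT.
- split.
  + by move=> t _; have [] := dW t.
  + by apply: cvg_at_right_filter; exact: cW.
  + by apply: cvg_at_left_filter; exact: cW.
- by move=> t _; rewrite derive1E; have [_] := dW t.
Qed.

Lemma int1_antiderivative (w : R -> R) (a b : R) : continuous w ->
  (forall t, ~ (a <= t <= b) -> w t = 0) ->
  exists W : R -> R, forall t : R, is_derive t (1 : R) W (w t).
Proof.
move=> cw w0; have iw := integrable_supported1 cw w0.
exists (fun x => \int[mu]_(t in `]-oo, x]) w t) => t.
have := @continuous_FTC1 R w (BInfty R true) t (t + 1).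
rewrite ltrDl ltr01 => /(_ isT) [].
- by apply: (@integrableS _ _ _ _ setT).
- by rewrite ltNyr.
- exact: cw.
- by move=> dW W'; apply: DeriveDef; [exact: dW|rewrite -derive1E; exact: W'].
Qed.

(** An antiderivative [W] of [w] gives the antiderivative - W (c - t) of the
reflected function. *)
Lemma int1_reflect (w : R -> R) (a b c : R) : continuous w ->
  (forall t, ~ (a <= t <= b) -> w t = 0) ->
  int1 (fun t => w (c - t)) = int1 w.
Proof.
move=> cw w0; have [W dW] := int1_antiderivative cw w0.
pose M := `|a| + `|b| + 1.
have M0 : 0 < M by rewrite ltr_wpDl// addr_ge0.
have MM : - M < M by rewrite gtrN.
have aM : - M <= a.
  rewrite lerNl; have := ler_norm (- a); rewrite normrN => h.
  by rewrite (le_trans h)// /M -addrA lerDl addr_ge0.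
have bM : b <= M.
  by rewrite (le_trans (ler_norm b))// /M [_ + `|b|]addrC -addrA lerDl addr_ge0.
rewrite (@int1_FTC (- M) M w w W)//; last first.
  by move=> t nt; apply: w0 => /andP[h1 h2]; apply: nt; rewrite (le_trans aM)// (le_trans h2).
have dV (t : R) : is_derive t (1 : R) (fun t => - W (c - t)) (w (c - t)).
  have dl : is_derive t (1 : R) (fun t => c - t) (-1).
    by rewrite -[X in is_derive _ _ _ X]add0r; apply: is_deriveD; exact: is_deriveNid.
  have := is_deriveN (@is_derive1_comp _ W (fun t => c - t) t _ _ (dW _) dl).
  by rewrite mulrN1 opprK.
rewrite (@int1_FTC (c - M) (c + M) (fun t => w (c - t)) (fun t => w (c - t))
  (fun t => - W (c - t))) //.
- by rewrite opprK opprD addNKr subKr addrC.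
- by rewrite ltrD2l.
- move=> t nt; apply: w0 => /andP[h1 h2]; apply: nt.
  by move: h1 h2 aM bM => h1 h2 aM bM; apply/andP; split; lra.
- move=> t; apply: (@continuous_comp _ _ _ (fun t => c - t) w); last exact: cw.
  by apply: continuousB; [exact: cst_continuous|exact: cvg_id].
Qed.

End integral.

(** * Integration by parts and reflection *)

Section slices.
Variables (R : realType) (n : nat).
Implicit Types (u : 'rV[R]_n.+1 -> R).

Lemma vcons_lineS (h t : R) (y : 'rV[R]_n) i :
  vcons t (h *: basis_vec R i + y) = h *: basis_vec R (lift ord0 i) + vcons t y.
Proof.
have rVDE m (a : R) (x z : 'rV[R]_m) j : (a *: x + z) 0 j = a * x 0 j + z 0 j.
  by rewrite !mxE.
apply: vcons_ext => [|j]; rewrite rVDE ?vcons0 ?vconsS basis_vecE.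
  by rewrite mulr0 add0r.
by rewrite rVDE basis_vecE (inj_eq lift_inj).
Qed.

Lemma vcons_line0 (h t : R) (y : 'rV[R]_n) :
  vcons (h + t) y = h *: basis_vec R ord0 + vcons t y.
Proof.
have rVDE m (a : R) (x z : 'rV[R]_m) j : (a *: x + z) 0 j = a * x 0 j + z 0 j.
  by rewrite !mxE.
apply: vcons_ext => [|j]; rewrite rVDE ?vcons0 ?vconsS basis_vecE.
  by rewrite eqxx mulr1.
by rewrite mulr0 add0r.
Qed.

Lemma slice_rpart u t y i : smooth setT u ->
  derivable (fun y => u (vcons t y)) y (basis_vec R i) /\
  rpart i (fun y => u (vcons t y)) y = rpart (lift ord0 i) u (vcons t y).
Proof.
move=> su; apply: rpart_lin.
have -> : (fun h : R => u (vcons t (h *: basis_vec R i + y))) =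
    (fun h => u (h *: basis_vec R (lift ord0 i) + vcons t y)).
  by apply/funext => h; rewrite vcons_lineS.
have := @is_derive_line R n.+1 u (vcons t y) (lift ord0 i) 0.
by rewrite scale0r add0r; apply; exact: smoothT_derivable.
Qed.

Lemma slice_rpartE u t i : smooth setT u ->
  rpart i (fun y => u (vcons t y)) = fun y => rpart (lift ord0 i) u (vcons t y).
Proof. by move=> su; apply/funext => y; exact: (slice_rpart t y i su).2. Qed.

Lemma smooth_slice u t : smooth setT u -> smooth setT (fun y => u (vcons t y)).
Proof.
move=> su k; elim: k u su => [|k IH] u su.
  by split=> // y _; apply: continuous_slice_tail; exact: smoothT_continuous.
split; first by move=> y _; apply: continuous_slice_tail; exact: smoothT_continuous.
split=> [y i _|i]; first exact: (slice_rpart t y i su).1.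
by rewrite slice_rpartE//; apply: IH; exact: smooth_rpart.
Qed.

Lemma slice_rparts u t s : smooth setT u ->
  rparts s (fun y => u (vcons t y)) =
  fun y => rparts (map (lift ord0) s) u (vcons t y).
Proof.
move=> su; elim: s => //= i s ->; rewrite slice_rpartE//.
exact: smooth_rparts.
Qed.

Lemma is_derive_head u (t : R) (y : 'rV[R]_n) : smooth setT u ->
  is_derive t (1 : R) (fun t => u (vcons t y)) (rpart ord0 u (vcons t y)).
Proof.
move=> su.
have -> : (fun t => u (vcons t y)) = fun t => u (t *: basis_vec R ord0 + vcons 0 y).
  by apply/funext => h; rewrite -vcons_line0 addr0.
rewrite (_ : vcons t y = t *: basis_vec R ord0 + vcons 0 y).
  apply: (@is_derive_line R n.+1 u (vcons 0 y) ord0 t).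
  exact: smoothT_derivable.
by rewrite -vcons_line0 addr0.
Qed.

End slices.

Section parts.
Variable R : realType.

Lemma continuous_mul n (u v : 'rV[R]_n -> R) : continuous u -> continuous v ->
  continuous (fun x => u x * v x).
Proof. by move=> cu cv x; exact: (continuousM (cu x) (cv x)). Qed.

Lemma supportedMl n r (u v : 'rV[R]_n -> R) : supported r u ->
  supported r (fun x => u x * v x).
Proof. by move=> ur x /ur ->; rewrite mul0r. Qed.

Lemma supportedMr n r (u v : 'rV[R]_n -> R) : supported r v ->
  supported r (fun x => u x * v x).
Proof. by move=> vr x /vr ->; rewrite mulr0. Qed.

Lemma int1_cst0 : int1 (fun=> 0 : R) = 0.
Proof. by rewrite /int1 /Rintegral integral0. Qed.

Lemma intR_cst0 n : intR (fun _ : 'rV[R]_n => 0 : R) = 0.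
Proof. by rewrite /intR /Rintegral integral0. Qed.

(** The variable of derivation is integrated first if it is the first one, and
otherwise the derivative passes to the slices. *)
Lemma intR_rpart n (u : 'rV[R]_n -> R) r i : smooth setT u -> supported r u ->
  intR (rpart i u) = 0.
Proof.
elim: n u i => [u []//|n IH] u i su ur.
have cu := smoothT_continuous (smooth_rpart i su).
have sr := supported_rpart i ur.
case: (unliftP ord0 i) => [j ij|ij].
  rewrite (intR_fubini1 cu sr) -[RHS]int1_cst0; apply: eq_int1 => t.
  rewrite ij -slice_rpartE//; apply: IH; first exact: smooth_slice.
  exact: supported_slice_tail.
rewrite (intR_fubini2 cu sr) -[RHS](intR_cst0 n); apply: eq_intR => y.
pose b := `|r| + 1.
have rb : r < b by rewrite (le_lt_trans (ler_norm r))// ltrDl.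
have b0 : 0 < b by rewrite ltr_wpDl.
have vb t : `|t| = b -> u (vcons t y) = 0.
  by move=> tb; apply: ur; apply: (lt_le_trans _ (vcons_ge_head t y)); rewrite tb.
rewrite -[RHS](subrr 0) -{1}(vb b) ?gtr0_norm// -(vb (- b)) ?normrN ?gtr0_norm//.
apply: (@int1_FTC R (- b) b _ (fun t => rpart i u (vcons t y))
  (fun t => u (vcons t y))) => //.
- by rewrite gtrN.
- move=> t tb; apply: (slice_head0 sr) => /andP[h1 h2]; apply: tb.
  by rewrite (le_trans h2 (ltW rb)) andbT (le_trans _ h1)// lerN2 ltW.
- exact: continuous_slice_head.
- by move=> t; rewrite ij; exact: is_derive_head.
Qed.

Lemma intR_parts n (u v : 'rV[R]_n -> R) r i : smooth setT u -> supported r u ->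
  smooth setT v -> intR (fun x => rpart i u x * v x) =
  - intR (fun x => u x * rpart i v x).
Proof.
move=> su ur sv.
have := intR_rpart i (smoothM openT su sv) (supportedMl v ur).
have -> : rpart i (fun x => u x * v x) =
    fun x => u x * rpart i v x + rpart i u x * v x.
  by apply/funext => x; rewrite rpartM//; exact: smoothT_derivable.
have ci (w z : 'rV[R]_n -> R) : smooth setT w -> smooth setT z -> continuous (fun x => w x * z x).
  move=> sw sz.
  exact: (continuous_mul (smoothT_continuous sw) (smoothT_continuous sz)).
rewrite (intRD (ci _ _ su (smooth_rpart i sv)) (supportedMl _ ur)
  (ci _ _ (smooth_rpart i su) sv) (supportedMl _ (supported_rpart i ur))).
by move/eqP; rewrite addrC addr_eq0 => /eqP.
Qed.

(** The derivatives reach [v] in reverse order; they are put back in the given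
order by the symmetry of mixed derivatives. *)
Lemma intR_parts_seq n (u v : 'rV[R]_n -> R) r s : smooth setT u ->
  supported r u -> smooth setT v ->
  intR (fun x => rparts s u x * v x) =
  (-1) ^+ size s * intR (fun x => u x * rparts s v x).
Proof.
move=> su ur; elim: s v => [|i s IH] v sv; first by rewrite mul1r.
rewrite (intR_parts i (smooth_rparts s su) (supported_rparts s ur) sv).
rewrite IH; last exact: smooth_rpart.
by rewrite rparts_rpart// exprS mulN1r mulNr.
Qed.

Lemma continuous_comp_nonexpanding (V W : normedModType R) (f : V -> W)
    (w : W -> R) : (forall x y, `|f x - f y| <= `|x - y|) -> continuous w ->
  continuous (fun z => w (f z)).
Proof.
move=> fle cw z; apply: (@continuous_comp V W R f w z); last exact: cw.
exact: continuous_nonexpanding.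
Qed.

Lemma continuous_reflect n (w : 'rV[R]_n -> R) (a : 'rV[R]_n) : continuous w ->
  continuous (fun z : 'rV[R]_n => w (a - z)).
Proof.
apply: (@continuous_comp_nonexpanding 'rV[R]_n 'rV[R]_n (fun z => a - z)) => s t.
by rewrite opprD addrACA subrr add0r opprK addrC distrC.
Qed.

Lemma supported_reflect n (w : 'rV[R]_n -> R) (a : 'rV[R]_n) q :
  supported q w -> supported (q + `|a|) (fun z : 'rV[R]_n => w (a - z)).
Proof.
move=> wq z qz; apply: wq; rewrite distrC -(ltrD2r `|a|).
by apply: (lt_le_trans qz); rewrite -{1}(subrK a z) ler_normD.
Qed.

(** The first variable is reflected inside, the others by induction, with the two
orders of integration exchanged in between. *)
Lemma intR_reflect n (h : 'rV[R]_n -> R) r (x : 'rV[R]_n) : continuous h -> supported r h ->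
  intR (fun z => h (x - z)) = intR h.
Proof.
elim: n h x => [|n IH] h x ch hr; first by rewrite !intR_dim0; congr h; apply/rowP => -[].
pose tl (z : 'rV[R]_n.+1) : 'rV[R]_n := \row_j z 0 (lift ord0 j).
have xE : x = vcons (x 0 ord0) (tl x).
  by apply: vcons_ext => [|i]; rewrite ?vcons0 ?vconsS ?mxE.
have tlv t y : tl (vcons t y) = y by apply/rowP => j; rewrite mxE vconsS.
move: (x 0 ord0) (tl x) xE => x0 x' ->.
rewrite (intR_fubini2 (@continuous_reflect _ h (vcons x0 x') ch)
  (@supported_reflect _ h (vcons x0 x') r hr)).
rewrite (@eq_intR _ _ _ (fun y => int1 (fun t => h (vcons t (x' - y))))); last first.
  move=> y; rewrite -(int1_reflect x0 (@continuous_slice_head R n h ch (x' - y))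
    (@slice_head0 R n h r hr (x' - y))).
  by apply: eq_int1 => t; rewrite vconsB.
pose A (z : 'rV[R]_n.+1) := vcons (z 0 ord0) (x' - tl z).
have Ale z : `|z| <= `|A z| + `|x'|.
  apply: norm_le_coord => [|i]; first exact: addr_ge0.
  case: (unliftP ord0 i) => [j ->|->].
    have := coord_le_norm (A z) (lift ord0 j).
    rewrite vconsS rVBE mxE => hj; rewrite -lerBlDr (le_trans _ hj)//.
    rewrite distrC; apply: le_trans (lerB_dist _ _); rewrite lerD2l lerN2.
    exact: coord_le_norm.
  have := coord_le_norm (A z) ord0; rewrite vcons0 => /le_trans; apply.
  by rewrite lerDl.
have cA : continuous (fun z => h (A z)).
  apply: (@continuous_comp_nonexpanding 'rV[R]_n.+1 'rV[R]_n.+1 A h) => // s t.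
  rewrite /A vconsB.
  apply: vcons_le; first by rewrite -rVBE coord_le_norm.
  apply: norm_le_coord => // j; rewrite rVBE !rVBE [tl s 0 j]mxE [tl t 0 j]mxE.
  have := coord_le_norm (s - t) (lift ord0 j); rewrite rVBE distrC.
  by congr (`|_| <= _); ring.
have sA : supported (r + `|x'|) (fun z => h (A z)).
  by move=> z rz; apply: hr; rewrite -(ltrD2r `|x'|); exact: lt_le_trans rz (Ale z).
have AE t y : A (vcons t y) = vcons t (x' - y) by rewrite /A vcons0 tlv.
rewrite (@eq_intR _ _ _ (fun y => int1 (fun t => h (A (vcons t y))))); last first.
  by move=> y; apply: eq_int1 => t; rewrite AE.
rewrite -(intR_fubini2 cA sA) (intR_fubini1 cA sA) (intR_fubini1 ch hr).
apply: eq_int1 => t.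
rewrite -(IH _ x' (@continuous_slice_tail R n h ch t)
  (@supported_slice_tail R n h r hr t)).
by apply: eq_intR => y; rewrite AE.
Qed.

End parts.

(** * Convolution *)

Section convolution.
Variables (R : realType) (n : nat).
Implicit Types (u v F w E : 'rV[R]_n -> R) (x y : 'rV[R]_n) (r : R).
Notation e_ i := (@basis_vec R n i).

(** The argument of [F] carries the translation, so that derivatives fall on [F]
and continuity of [E] is enough. *)
Definition convol F E : 'rV[R]_n -> R := fun x => intR (fun z : 'rV[R]_n => F (x - z) * E z).

Lemma convol_integrand_continuous F E x : continuous F -> continuous E ->
  continuous (fun z : 'rV[R]_n => F (x - z) * E z).
Proof.
move=> cF cE; apply: continuous_mul => //; exact: (@continuous_reflect R n F x cF).
Qed.

Lemma convol_integrand_supported F E x r : supported r F ->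
  supported (r + `|x|) (fun z : 'rV[R]_n => F (x - z) * E z).
Proof. by move=> Fr; apply: supportedMl; exact: (@supported_reflect R n F x r Fr). Qed.

Lemma convolB F w E r s x : continuous F -> supported r F -> continuous w ->
  supported s w -> continuous E ->
  convol (fun y => F y - w y) E x = convol F E x - convol w E x.
Proof.
move=> cF Fr cw ws cE; rewrite /convol.
rewrite -(intRB (convol_integrand_continuous cF cE (x := x))
  (convol_integrand_supported E (x := x) Fr)
  (convol_integrand_continuous cw cE (x := x))
  (convol_integrand_supported E (x := x) ws)).
by apply: eq_intR => z; rewrite mulrBl.
Qed.

Lemma convolZ F E r c x : continuous F -> supported r F -> continuous E ->
  convol (fun y => c * F y) E x = c * convol F E x.
Proof.
move=> cF Fr cE; rewrite /convol.
rewrite -(intRZ (convol_integrand_continuous cF cE (x := x))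
  (convol_integrand_supported E (x := x) Fr)).
by apply: eq_intR => z; rewrite mulrA.
Qed.

(** For fixed support, convolution with [E] is locally uniformly bounded by the sup
norm. Continuity and differentiation under the integral sign thereby reduce to
uniform estimates on translates. *)
Lemma convol_bound E r q : continuous E -> 0 <= r -> 0 <= q ->
  exists2 B : R, 0 <= B & forall v M (x : 'rV[R]_n), continuous v -> supported r v ->
    0 <= M -> (forall y, `|v y| <= M) -> `|x| <= q -> `|convol v E x| <= M * B.
Proof.
move=> cE r0 q0; have rq0 : 0 <= r + q by rewrite addr_ge0.
have [C C0 CP] := continuous_bounded_on (@closed_ball_compact R n (r + q)) cE.
exists (C * (2 * (r + q)) ^+ n).
  by rewrite mulr_ge0// exprn_ge0// mulr_ge0.
move=> v M x cv vr M0 vM xq; rewrite mulrA.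
have sz : supported (r + q) (fun z : 'rV[R]_n => v (x - z) * E z).
  move=> z rz; apply: (@convol_integrand_supported v E x r vr).
  by apply: le_lt_trans rz; rewrite lerD2l.
apply: (intR_bound (convol_integrand_continuous cv cE (x := x)) sz) => //.
  exact: mulr_ge0.
move=> z; have [zr|/sz ->] := leP `|z| (r + q); last first.
  by rewrite normr0 mulr_ge0.
by rewrite normrM ler_pM// CP.
Qed.

Lemma convol_shift F E (a x : 'rV[R]_n) :
  convol F E (a + x) = convol (fun y : 'rV[R]_n => F (a + y)) E x.
Proof. by apply: eq_intR => z; rewrite addrA. Qed.

Lemma continuous_shift F (a : 'rV[R]_n) : continuous F ->
  continuous (fun y : 'rV[R]_n => F (a + y)).
Proof.
apply: (@continuous_comp_nonexpanding R 'rV[R]_n 'rV[R]_n (fun y : 'rV[R]_n => a + y)) => s t.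
by rewrite opprD addrACA subrr add0r.
Qed.

Lemma supported_shift F (a : 'rV[R]_n) r : supported r F ->
  supported (r + `|a|) (fun y : 'rV[R]_n => F (a + y)).
Proof.
move=> Fr y ry; apply: Fr; rewrite -(ltrD2r `|a|) (lt_le_trans ry)//.
by rewrite -{1}(addKr a y) addrC (le_trans (ler_normD _ _))// normrN.
Qed.

Lemma supported_le F r s : r <= s -> supported r F -> supported s F.
Proof. by move=> rs Fr x sx; apply: Fr; exact: le_lt_trans sx. Qed.

Lemma supportedB F w r : supported r F -> supported r w ->
  supported r (fun x => F x - w x).
Proof. by move=> Fr wr x rx; rewrite Fr// wr// subrr. Qed.

Lemma continuous_sub F w : continuous F -> continuous w ->
  continuous (fun x => F x - w x).
Proof. by move=> cF cw x; exact: (continuousB (cF x) (cw x)). Qed.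

Lemma continuous_scale F c : continuous F -> continuous (fun x => c * F x).
Proof.
by move=> cF; apply: continuous_mul => // x; exact: cst_continuous.
Qed.

Lemma convol_continuous F E r : smooth setT F -> supported r F -> continuous E ->
  continuous (convol F E).
Proof.
move=> sF Fr cE x.
have r0 : 0 <= `|r| + 1 by rewrite addr_ge0.
have [B B0 BP] := convol_bound cE r0 (normr_ge0 x).
have exM (s : seq 'I_n) : exists2 M : R, 0 <= M &
    forall i, i \in s -> forall z, `|rpart i F z| <= M.
  elim: s => [|i s [M M0 MP]]; first by exists 0.
  have [N N0 NP] := supported_bounded (smoothT_continuous (smooth_rpart i sF))
    (supported_rpart i Fr).
  exists (M + N); first exact: addr_ge0.
  move=> j; rewrite in_cons => /predU1P[->|js] z.
    by rewrite (le_trans (NP z))// lerDr.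
  by rewrite (le_trans (MP _ js z))// lerDl.
have [M M0 MP] := exM (enum 'I_n).
have {}MP i z : `|rpart i F z| <= M by apply: MP; rewrite mem_enum.
have cF := smoothT_continuous sF.
have lip y : `|y - x| <= 1 -> `|convol F E x - convol F E y| <= `|x - y| * (n%:R * M * B).
  move=> yx.
  rewrite distrC -{1}(subrK x y) convol_shift.
  have yr : supported (`|r| + 1) (fun z => F (y - x + z)).
    apply: supported_le (@supported_shift _ (y - x) _ Fr).
    by rewrite lerD// ler_norm.
  have xr : supported (`|r| + 1) F.
    by apply: supported_le Fr; rewrite (le_trans (ler_norm r))// lerDl.
  rewrite -(convolB (s := `|r| + 1) x (@continuous_shift F (y - x) cF) yr cF xr cE).
  rewrite (_ : _ * (n%:R * M * B) = n%:R * M * `|x - y| * B); last by ring.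
  apply: BP; rewrite ?mulr_ge0//.
  - by apply: continuous_sub => //; exact: continuous_shift.
  - exact: supportedB.
  - move=> z; rewrite [X in _ * X]distrC.
    by have := lipschitz_rpart (y - x + z) z sF M0 MP; rewrite addrK.
have K0 : 0 < n%:R * M * B + 1 by rewrite ltr_wpDl// !mulr_ge0.
apply/(@cvgrPdist_lt _ _ _ (nbhs x)) => e e0.
apply/nbhs_ballP; exists (Num.min 1 (e / (n%:R * M * B + 1))).
  by rewrite /= lt_min ltr01 divr_gt0.
move=> y; rewrite -ball_normE /= lt_min => /andP[h1 h2].
apply: le_lt_trans (lip y _) _; first by rewrite distrC ltW.
apply: (@le_lt_trans _ _ (`|x - y| * (n%:R * M * B + 1))).
  by rewrite ler_wpM2l// lerDl.
by rewrite -ltr_pdivlMr.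
Qed.

(** The error of the difference quotient of [F] along [e_ i] is uniformly O(h),
because the second derivative is bounded, and it keeps a fixed compact
support. *)
Lemma convol_derive F E r x i : smooth setT F -> supported r F -> continuous E ->
  derivable (convol F E) x (e_ i) /\
  rpart i (convol F E) x = convol (rpart i F) E x.
Proof.
move=> sF Fr cE.
have s1 := smooth_rpart i sF; have s2 := smooth_rpart i s1.
have cF := smoothT_continuous sF; have c1 := smoothT_continuous s1.
have r1 := supported_rpart i Fr.
have [M M0 MP] := supported_bounded (smoothT_continuous s2) (supported_rpart i r1).
have r0 : 0 <= `|r| + `|e_ i| by rewrite addr_ge0.
have [B B0 BP] := convol_bound cE r0 (normr_ge0 x).
have bound h : h != 0 -> `|h| <= 1 ->
    `|h^-1 * (convol F E (h *: e_ i + x) - convol F E x) - convol (rpart i F) E x| <=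
    `|h| * (M * B).
  move=> hn0 h1.
  have Fs : supported (`|r| + `|e_ i|) (fun z => F (h *: e_ i + z)).
    apply: supported_le (@supported_shift _ (h *: e_ i) _ Fr).
    by rewrite lerD ?ler_norm// normrZ ler_piMl.
  have F's : supported (`|r| + `|e_ i|) F.
    by apply: supported_le Fr; rewrite (le_trans (ler_norm r))// lerDl.
  have F1s : supported (`|r| + `|e_ i|) (rpart i F) by exact: supported_rpart.
  have cs := @continuous_shift F (h *: e_ i) cF.
  rewrite convol_shift -(convolB x cs Fs cF F's cE).
  rewrite -(@convolZ _ E _ h^-1 x (continuous_sub cs cF) (supportedB Fs F's) cE).
  rewrite -(convolB x (@continuous_scale _ h^-1 (continuous_sub cs cF))
    (@supportedMr _ _ _ (fun=> h^-1) _ (supportedB Fs F's)) c1 F1s cE).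
  rewrite mulrA; apply: BP.
  - by apply: continuous_sub => //; apply: continuous_scale; exact: continuous_sub.
  - by apply: supportedB => //; apply: supportedMr; exact: supportedB.
  - exact: mulr_ge0.
  - move=> y.
    (* [G] is the remainder of the expansion of order one of [F] at [y], along [e_ i] *)
    pose c := rpart i F y.
    pose G (z : 'rV[R]_n) := F z - c * (1 * z 0 i + 0).
    have dG z : is_derive z (e_ i) G (rpart i F z - c).
      have [d1 d2] := @rpart_coord R n id 1 1 0 i i z (is_derive_id _ _).
      have dl : is_derive z (e_ i) (fun z : 'rV[R]_n => 1 * z 0 i + 0) 1.
        by apply: DeriveDef => //; rewrite -[LHS]/(rpart i _ z) d2 eqxx !mulr1.
      have := is_deriveB (is_derive_rpart i sF (I : setT z)) (is_deriveZ c dl).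
      by rewrite /GRing.scale /= mulr1.
    have dGd z : derivable G z (e_ i) by have [] := dG z.
    have rG z : rpart i G z = rpart i F z - c by have [_] := dG z.
    have GE : G (h *: e_ i + y) - G y = F (h *: e_ i + y) - F y - h * c.
      rewrite /G (_ : (h *: e_ i + y) 0 i = h + y 0 i); last first.
        by rewrite !mxE !eqxx mulr1.
      by move: (F _) (F y) (y 0 i) => p q s; ring.
    have Gh : `|G (h *: e_ i + y) - G y| <= `|h| * (`|h| * M).
      apply: MVT_line => // t th; rewrite rG /c.
      have tM : `|rpart i F (t *: e_ i + y) - rpart i F y| <= `|t| * M.
        apply: MVT_line => [z|t' _]; last exact: MP.
        exact: smoothT_derivable.
      by apply: le_trans tM _; rewrite ler_wpM2r.
    rewrite (_ : _ - _ = h^-1 * (G (h *: e_ i + y) - G y)); last first.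
      by rewrite GE [RHS]mulrBr [h^-1 * (h * c)]mulrA mulVf// mul1r.
    by rewrite normrM normfV ler_pdivrMl ?normr_gt0.
  - by [].
apply: rpart_lin.
suff H : h^-1 *: (((fun h : R => convol F E (h *: e_ i + x)) \o shift 0) (h *: 1) -
    convol F E (0 *: e_ i + x)) @[h --> 0^'] --> convol (rpart i F) E x.
  apply: DeriveDef; first by apply/cvg_ex; exists (convol (rpart i F) E x).
  exact: cvg_lim H.
apply/cvgrPdist_le => e e0.
have K0 : 0 < M * B + 1 by rewrite ltr_wpDl// mulr_ge0.
have : \forall h \near (0 : R)^', h != 0 /\ `|h| <= Num.min 1 (e / (M * B + 1)).
  have m0 : 0 < Num.min 1 (e / (M * B + 1)) by rewrite lt_min ltr01 divr_gt0.
  near=> h; split; first by near: h; exact: nbhs_dnbhs_neq.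
  near: h; exists (Num.min 1 (e / (M * B + 1))) => //= h.
  by rewrite /ball_ /= sub0r normrN => /ltW.
apply: filterS => h [hn0]; rewrite le_min => /andP[h1 he].
rewrite /= addr0 scale0r add0r [h *: 1]mulr1 distrC.
apply: (le_trans (bound h hn0 h1)).
apply: (@le_trans _ _ (`|h| * (M * B + 1))); first by rewrite ler_wpM2l// lerDl.
by rewrite -ler_pdivlMr.
Unshelve. all: by end_near. Qed.

Lemma convol_rpart F E r i : smooth setT F -> supported r F -> continuous E ->
  rpart i (convol F E) = convol (rpart i F) E.
Proof.
by move=> sF Fr cE; apply/funext => x; exact: (convol_derive x i sF Fr cE).2.
Qed.

Lemma convol_smooth F E r : smooth setT F -> supported r F -> continuous E ->
  smooth setT (convol F E).
Proof.
move=> sF Fr cE k; elim: k F sF Fr => [|k IH] F sF Fr.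
  by split=> // x _; exact: (convol_continuous sF Fr cE).
split; first by move=> x _; exact: (convol_continuous sF Fr cE).
split=> [x i _|i]; first exact: (convol_derive x i sF Fr cE).1.
rewrite (convol_rpart i sF Fr cE); apply: IH; first exact: smooth_rpart.
exact: supported_rpart.
Qed.

Lemma convol_rparts F E r s : smooth setT F -> supported r F -> continuous E ->
  rparts s (convol F E) = convol (rparts s F) E.
Proof.
move=> sF Fr cE; elim: s => //= i s ->.
by rewrite (convol_rpart i (smooth_rparts s sF) (supported_rparts s Fr) cE).
Qed.

Lemma convolC F E r x : continuous F ->
  supported r F -> continuous E ->
  convol F E x = intR (fun y : 'rV[R]_n => F y * E (x - y)).
Proof.
move=> cF Fr cE.
have cG : continuous (fun y : 'rV[R]_n => F y * E (x - y)).
  by apply: continuous_mul => //; exact: (@continuous_reflect R n E x cE).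
rewrite -(intR_reflect x cG (supportedMl _ Fr)).
by apply: eq_intR => z; rewrite subKr.
Qed.

End convolution.

(** * A fundamental solution *)

Section fundamental.
Variable R : realType.

Lemma continuous_of_derive (f df : R -> R) :
  (forall t : R, is_derive t (1 : R) f (df t)) -> continuous f.
Proof.
move=> dF t; apply/differentiable_continuous; rewrite -derivable1_diffP.
by have [] := dF t.
Qed.

(** The antiderivative of h^(N+1)(x - t) t^N / N! obtained by repeated integration
by parts. *)
Definition taylor_prim (hs : nat -> R -> R) (x : R) (N : nat) (t : R) : R :=
  - \sum_(j < N.+1) hs j (x - t) * (t ^+ j * (j`!%:R)^-1).

Lemma is_derive_taylor_prim hs x N t :
  (forall j (t : R), is_derive t (1 : R) (hs j) (hs j.+1 t)) ->
  is_derive t (1 : R) (taylor_prim hs x N)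
    (hs N.+1 (x - t) * (t ^+ N * (N`!%:R)^-1)).
Proof.
move=> dhs.
have dl : is_derive t (1 : R) (fun t => x - t) (-1).
  by rewrite -[X in is_derive _ _ _ X]add0r; apply: is_deriveD; exact: is_deriveNid.
have dj j : is_derive t (1 : R) (fun t => hs j (x - t)) (hs j.+1 (x - t) * -1).
  exact: (@is_derive1_comp _ (hs j) (fun t => x - t) t _ _ (dhs j _) dl).
elim: N => [|N IH].
  rewrite (_ : taylor_prim hs x 0 = fun t => - hs 0%N (x - t)); last first.
    by apply/funext => s; rewrite /taylor_prim big_ord1 fact0 invr1 expr0 !mulr1.
  have := is_deriveN (dj 0%N); congr (is_derive _ _ _ _).
  by rewrite mulrN1 opprK fact0 invr1 expr0 !mulr1.
pose c : R := (N.+1`!%:R)^-1.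
rewrite (_ : taylor_prim hs x N.+1 =
    fun t => taylor_prim hs x N t - hs N.+1 (x - t) * (t ^+ N.+1 * c)); last first.
  by apply/funext => s; rewrite /taylor_prim big_ord_recr /= opprD.
have dX : is_derive t (1 : R) (fun t : R => t ^+ N.+1 * c) (t ^+ N * (N`!%:R)^-1).
  have dX0 : is_derive t (1 : R) (fun t : R => t ^+ N.+1) (N.+1%:R * t ^+ N).
    apply: DeriveDef; first exact: exprn_derivable.
    by rewrite exp_derive /GRing.scale /= mulr1.
  have := is_deriveM dX0 (is_derive_cst c t 1).
  congr (is_derive _ _ _ _); rewrite /GRing.scale /= mulr0 add0r /c factS natrM.
  rewrite invfM; have : (N.+1%:R : R) != 0 by rewrite pnatr_eq0.
  by move=> n0; rewrite [LHS]mulrC mulrA [N.+1%:R * _]mulrC mulfK.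
have := is_deriveB IH (is_deriveM (dj N.+1) dX).
congr (is_derive _ _ _ _); rewrite /GRing.scale /= -/c.
by move: (hs _ _) (hs _ _) => p q; ring.
Qed.

(** Convolution with t_+^N / N! inverts the derivation of order N + 1 of compactly
supported functions. *)
Lemma taylor_identity (hs : nat -> R -> R) (r x : R) N : (0 < N)%N ->
  (forall j (t : R), is_derive t (1 : R) (hs j) (hs j.+1 t)) ->
  (forall j t, ~ (- r <= t <= r) -> hs j t = 0) ->
  int1 (fun t => hs N.+1 (x - t) * trunc_power N (N`!%:R)^-1 t) = hs 0%N x.
Proof.
move=> N0 dhs hs0.
pose L := `|x| + `|r| + 1.
have L0 : 0 < L by rewrite ltr_wpDl// addr_ge0.
have Lz j t : L <= t -> hs j (x - t) = 0.
  move=> Lt; apply: hs0 => /andP[h1 h2].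
  have := ler_norm x; have := ler_norm r; move: Lt; rewrite /L; lra.
have cl : continuous (fun t : R => x - t).
  by move=> t; apply: continuousB; [exact: cst_continuous|exact: cvg_id].
have chs j : continuous (hs j) by apply: continuous_of_derive; exact: dhs.
have -> : hs 0%N x = taylor_prim hs x N L - taylor_prim hs x N 0.
  rewrite /taylor_prim big1 ?oppr0 ?sub0r ?opprK; last first.
    by move=> j _; rewrite Lz// mul0r.
  rewrite big_ord_recl big1 ?addr0 ?subr0 ?fact0 ?invr1 ?expr0 ?mulr1//.
  by move=> j _; rewrite expr0n /= mul0r mulr0.
apply: (int1_FTC L0 (v := fun t => hs N.+1 (x - t) * (t ^+ N * (N`!%:R)^-1))).
- move=> t tL; have [t0|t0] := leP t 0.
    by rewrite /trunc_power ltNge t0 mulr0.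
  rewrite Lz ?mul0r// leNgt; apply/negP => tl; apply: tL.
  by rewrite !ltW.
- move=> t /andP[t0 tL]; rewrite /trunc_power.
  case: ifPn => // /negPf; rewrite lt_neqAle t0 andbT => /negbFE/eqP <-.
  by rewrite expr0n gtn_eqF// mul0r.
- move=> t; apply: cvgM.
    apply: (@continuous_comp _ _ _ (fun t => x - t) (hs N.+1)); first exact: cl.
    exact: chs.
  apply: cvgM; [exact: exprn_continuous|exact: cvg_cst].
- by move=> t; exact: is_derive_taylor_prim.
Qed.

Definition fundamental n (N : nat) (z : 'rV[R]_n) : R :=
  \prod_(i <- enum 'I_n) trunc_power N (N`!%:R)^-1 (z 0 i).

Lemma continuous_prod n (I : Type) (s : seq I) (u : I -> 'rV[R]_n -> R) :
  (forall i, continuous (u i)) -> continuous (fun x => \prod_(i <- s) u i x).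
Proof.
move=> cu; elim: s => [|i s IH].
  rewrite (_ : (fun x => _) = fun=> 1); first by move=> x; exact: cst_continuous.
  by apply/funext => x; rewrite big_nil.
rewrite (_ : (fun x => _) = fun x => u i x * \prod_(j <- s) u j x).
  exact: (continuous_mul (cu i) IH).
by apply/funext => x; rewrite big_cons.
Qed.

Lemma continuous_fundamental n N : (0 < N)%N -> continuous (@fundamental n N).
Proof.
move=> N0; apply: continuous_prod => i x.
apply: (@continuous_comp _ _ _ (fun z : 'rV[R]_n => z 0 i)
  (trunc_power N (N`!%:R)^-1)); first exact: coord_continuous.
exact: continuous_trunc_power.
Qed.

Lemma fundamental_vcons n N t (y : 'rV[R]_n) :
  fundamental N (vcons t y) = trunc_power N (N`!%:R)^-1 t * fundamental N y.
Proof.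
rewrite /fundamental enum_ordSl big_cons vcons0 big_map.
by congr (_ * _); apply: eq_bigr => i _; rewrite vconsS.
Qed.

Definition const_index (n k : nat) : multi_index n := [ffun=> k].

Lemma index_seq_constS n k :
  index_seq (const_index n.+1 k) = nseq k ord0 ++ map (lift ord0) (index_seq (const_index n k)).
Proof.
rewrite /index_seq enum_ordSl /= ffunE; congr (_ ++ _).
rewrite map_flatten -!map_comp; congr flatten; apply: eq_map => i /=.
by rewrite !ffunE map_nseq.
Qed.

(** The derivatives and the kernel are both tensor products: the first variable is
treated by [taylor_identity], with the others frozen, and the remaining ones by
induction. *)
Lemma fundamental_identity n N (F : 'rV[R]_n -> R) r x : (0 < N)%N ->
  smooth setT F -> supported r F ->
  convol (rparts (index_seq (const_index n N.+1)) F) (fundamental N) x = F x.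
Proof.
move=> N0; elim: n F x => [|n IH] F x sF Fr.
  rewrite /convol intR_dim0 subr0 /fundamental /index_seq.
  by rewrite (_ : enum 'I_0 = [::]) ?big_nil ?mulr1//; apply: size0nil; rewrite size_enum_ord.
rewrite index_seq_constS /rparts foldr_cat -/(rparts _ _) -/(rparts _ _).
set H := rparts (map _ _) F.
have sH : smooth setT H by exact: smooth_rparts.
have Hr : supported r H by exact: supported_rparts.
have sk j : smooth setT (rparts (nseq j ord0) H) by exact: smooth_rparts.
have kr j : supported r (rparts (nseq j ord0) H) by exact: supported_rparts.
pose tl (z : 'rV[R]_n.+1) : 'rV[R]_n := \row_j z 0 (lift ord0 j).
have xE : x = vcons (x 0 ord0) (tl x).
  by apply: vcons_ext => [|i]; rewrite ?vcons0 ?vconsS ?mxE.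
move: (x 0 ord0) (tl x) xE => x0 x' ->.
rewrite /convol (intR_fubini2
  (convol_integrand_continuous (smoothT_continuous (sk N.+1))
    (@continuous_fundamental n.+1 N N0) (x := vcons x0 x'))
  (convol_integrand_supported (fundamental N) (x := vcons x0 x') (kr N.+1))).
rewrite -(IH (fun y => F (vcons x0 y)) x'); last 2 first.
- exact: smooth_slice.
- exact: supported_slice_tail.
apply: eq_intR => y.
rewrite slice_rparts//.
pose hs j (s : R) := fundamental N y * rparts (nseq j ord0) H (vcons s (x' - y)).
rewrite (@eq_int1 _ _ (fun t => hs N.+1 (x0 - t) * trunc_power N (N`!%:R)^-1 t)); last first.
  by move=> t; rewrite vconsB fundamental_vcons /hs; ring.
have -> : int1 (fun t => hs N.+1 (x0 - t) * trunc_power N (N`!%:R)^-1 t) = hs 0%N x0.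
  apply: (@taylor_identity hs r) => // [j t|j t tr].
    by apply: is_deriveZ; exact: is_derive_head.
  by rewrite /hs (@slice_head0 R n _ r (kr j) (x' - y) t tr) mulr0.
by rewrite /hs /= mulrC.
Qed.

End fundamental.

(** * Multi-indices, compactness and nearstandard points *)

Lemma dpow_partials (R : realType) (n : nat) (alpha : multi_index n) :
  exists s, forall f : 'rV[R]_n -> R[i], dpow alpha f = partials s f.
Proof.
rewrite /dpow; elim: (enum 'I_n) => [|i r [s IH]]; first by exists [::].
exists (nseq (alpha i) i ++ s) => f /=; rewrite IH.
by elim: (alpha i) => //= k ->.
Qed.

Section compactness.
Variables (E : nonstandard_extension) (R : realType) (n : nat).

(** If [x] were far from every point of [K], the balls witnessing this would cover
[K]; finitely many of them would do, and finite covers transfer. *)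
Lemma compact_nearstandard (K : set 'rV[R]_n) (x : star E 'rV[R]_n) :
  compact K -> sset E K x -> exists2 y, K y & Defs.approx x (std E y).
Proof.
move=> Kco Kx; apply: contrapT => nns.
have far (y : 'rV[R]_n) : exists e : R, 0 < e /\
    (K y -> ~ sset E [set u | `|u - y| < e] x).
  have [Ky|] := pselect (K y); last by exists 1; split.
  apply: contrapT => nfar; apply: nns; exists y => // e e0.
  rewrite -(@smap_cst E _ _ y x) -{1}(smap_id x) srelE.
  by apply: contrapT => nx; apply: nfar; exists e.
have [e eP] := choice far.
move: Kco; rewrite compact_cover => /(_ _ K (fun y => ball y (e y))) [].
- by move=> y _; apply: ball_open; exact: (eP y).1.
- by move=> y Ky; exists y => //; exact: ballxx (eP y).1.
- move=> D DK Kcov.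
  have /sset_has[y yD] : sset E
      [set u | exists2 y, y \in enum_fset D & `|u - y| < e y] x.
    apply: sset_imply Kx => u /Kcov[y /= yD]; rewrite -ball_normE /= => ?.
    by exists y => //; rewrite distrC.
  move=> yx; apply: (eP y).2 yx.
  by have /DK := yD; move/set_mem.
Qed.

End compactness.

(** * Reduction to two statements about standard functions *)

Section reduction.
Variables (E : nonstandard_extension) (R : realType) (n : nat).
Variable Omega : set 'rV[R]_n.
Hypothesis Omega_open : open Omega.
Notation X := (Cinfty Omega).
Notation T := (testfun Omega).

Definition pairing (f : X) (phi : T) : R[i] :=
  integralC Omega (fun y => f y * phi y).

(** Continuity of the functional defined by [f] in the C^m norm on functions
supported in [K], with constant 1. *)
Definition controlled (m : nat) (K : set 'rV[R]_n) (f : X) : Prop :=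
  forall phi : T, supp phi `<=` K ->
    (forall s, (size s <= m)%N -> forall x, Omega x ->
       normc (partials s phi x) <= 1) ->
    normc (pairing f phi) <= 1.

(** The points at distance at least 1/(m+1) from the complement of [Omega], in a
ball of radius [m]. *)
Definition exhaustion (m : nat) : set 'rV[R]_n :=
  [set x | `|x| <= m%:R /\ forall y, `|x - y| < m.+1%:R^-1 -> Omega y].

Lemma exhaustion_compact m : compact (exhaustion m).
Proof.
apply: bounded_closed_compact.
  exists m%:R; split; first exact: num_real.
  by move=> M mM x [xm _]; exact: le_trans xm (ltW mM).
have -> : exhaustion m = [set x : 'rV[R]_n | `|x| <= m%:R] `&`
    \bigcap_(y in ~` Omega) [set x : 'rV[R]_n | m.+1%:R^-1 <= `|x - y|].
  apply/seteqP; split=> x.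
    move=> [xm xO]; split => // y nOy /=; rewrite leNgt; apply/negP => /xO.
    exact: nOy.
  move=> [xm xO]; split => // y; apply: contraPP => /xO /=.
  by rewrite leNgt => /negP.
apply: closedI.
  apply: (closed_comp (f := fun x : 'rV[R]_n => `|x|) (D := [set r | r <= m%:R])).
    by move=> x _; exact: norm_continuous.
  exact: closed_le.
apply: closed_bigI => y _.
have -> : [set x : 'rV[R]_n | m.+1%:R^-1 <= `|x - y|] = ~` ball y m.+1%:R^-1.
  apply/seteqP; split=> x; rewrite -ball_normE /= distrC leNgt; last by move/negP.
  by move/negP.
by rewrite closedC; apply: ball_open; rewrite invr_gt0 ltr0n.
Qed.

Lemma exhaustion_sub m : exhaustion m `<=` Omega.
Proof. by move=> x [_]; apply; rewrite subrr normr0 invr_gt0 ltr0n. Qed.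

Lemma exhaustion_le m k : (m <= k)%N -> exhaustion m `<=` exhaustion k.
Proof.
move=> mk x [xm xO]; split; first by rewrite (le_trans xm)// ler_nat.
move=> y xy; apply: xO; apply: lt_le_trans xy _.
by rewrite lef_pV2 ?posrE ?ltr0n// ler_nat.
Qed.

Lemma exhaustion_nbhs y : Omega y -> exists m, exists2 e : R, 0 < e &
  forall x, `|x - y| < e -> exhaustion m x.
Proof.
move=> Oy; have /nbhs_ballP[e /= e0 eO] : nbhs y Omega by exact: open_nbhs_nbhs.
have e20 : 0 < e / 2 by rewrite divr_gt0.
have [m1 m1P] := natr_above (`|y| + e / 2).
have [m2 m2P] := natr_above (e / 2)^-1.
exists (maxn m1 m2), (e / 2) => // x xy; split.
  apply: (@le_trans _ _ (`|y| + e / 2)).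
    rewrite -[x in `|x|](subrK y) addrC (le_trans (ler_normD _ _))// lerD2l.
    exact: ltW.
  by rewrite (le_trans m1P)// ler_nat leq_maxl.
move=> z xz; apply: eO; rewrite -ball_normE /=.
rewrite [e]splitr (_ : y - z = (y - x) + (x - z)); last by rewrite addrA subrK.
apply: (le_lt_trans (ler_normD _ _)); rewrite ltrD//; first by rewrite distrC.
apply: (lt_le_trans xz).
rewrite -[leRHS]invrK lef_pV2 ?posrE ?ltr0n ?invr_gt0//.
by rewrite (le_trans m2P)// ler_nat leqW// leq_maxr.
Qed.

(** Every nearstandard point lies in a member of the exhaustion of standard index,
so all members of infinite index contain the support. *)
Lemma finite_test_supp (phi : star E T) : finite_test phi ->
  exists m, sset E [set u : T | supp u `<=` exhaustion m] phi.
Proof.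
move=> [ns _].
apply: (@underspill E T (fun m u => supp u `<=` exhaustion m)) => N infN.
rewrite -(smap_fst N phi) -{2}(smap_snd N phi); apply/srelE.
set p := spair E N phi.
have : forall x : star E 'rV[R]_n, srel (fun (p : nat * T) y =>
    supp p.2 y -> exhaustion p.1 y) p x.
  move=> x.
  have pE : p = smap E fst (spair E p x) by rewrite smap_fst.
  have xE : x = smap E snd (spair E p x) by rewrite smap_snd.
  set c := spair E p x in pE xE; rewrite pE [in X in srel _ _ X]xE; apply/srelE.
  have [sx|nsx] := pselect (in_supp phi x); last first.
    have : ~ sset E [set q : (nat * T) * 'rV[R]_n | supp q.1.2 q.2] c.
      move=> h; apply: nsx; rewrite /in_supp xE -(smap_snd N phi) -/p pE.
      by rewrite -smap_comp; apply/srelE.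
    by move/sset_not; apply: sset_imply => q /= nq /nq.
  have [_ [y [Oy xy]]] := ns _ sx.
  have [m [e e0 em]] := exhaustion_nbhs Oy.
  have Nm : sset E [set q : (nat * T) * 'rV[R]_n | (m <= q.1.1)%N] c.
    have := nonstd_ge m infN.
    by rewrite -(smap_fst N phi) -/p pE -smap_comp => /sset_smap.
  have := xy _ e0; rewrite xE -(@smap_cst E _ _ y c) srelE => h.
  have := (sset_and _ _ _).2 (conj Nm h).
  apply: sset_imply => q /= [mq qy] _.
  exact: exhaustion_le mq _ (em _ qy).
rewrite -(sset_forall (fun (p : nat * T) y => supp p.2 y -> exhaustion p.1 y)).
by apply: sset_imply => q /= h y; exact: h.
Qed.

Lemma finite_test_bound (phi : star E T) alpha : finite_test phi ->
  exists m : nat, sset E [set u : T | forall x, Omega x ->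
    normc (dpow alpha u x) <= m%:R] phi.
Proof.
move=> [_ lim].
apply: (@underspill E T (fun m u => forall x, Omega x ->
    normc (dpow alpha u x) <= m%:R)) => N infN.
rewrite -(smap_fst N phi) -{2}(smap_snd N phi); apply/srelE.
set p := spair E N phi.
have : forall x : star E 'rV[R]_n, srel (fun (p : nat * T) x => Omega x ->
    normc (dpow alpha p.2 x) <= p.1%:R) p x.
  move=> x.
  have pE : p = smap E fst (spair E p x) by rewrite smap_fst.
  have xE : x = smap E snd (spair E p x) by rewrite smap_snd.
  set c := spair E p x in pE xE; rewrite pE [in X in srel _ _ X]xE; apply/srelE.
  have [Ox|nOx] := pselect (sset E Omega x); last first.
    have : ~ sset E [set q : (nat * T) * 'rV[R]_n | Omega q.2] c.
      by move=> h; apply: nOx; rewrite xE; apply/sset_smap.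
    by move/sset_not; apply: sset_imply => q /= nq /nq.
  have [M] := lim alpha x Ox.
  rewrite /stest_dpow xE -(smap_snd N phi) -/p pE -smap_comp smap2E => /sset_smap h.
  have [m mP] := natr_above `|M|.
  have Nm : sset E [set q : (nat * T) * 'rV[R]_n | (m <= q.1.1)%N] c.
    have := nonstd_ge m infN.
    by rewrite -(smap_fst N phi) -/p pE -smap_comp => /sset_smap.
  have := (sset_and _ _ _).2 (conj Nm h).
  apply: sset_imply => q /= [mq qM] _.
  apply: (le_trans qM); apply: (le_trans (ler_norm M)).
  by rewrite (le_trans mP)// ler_nat.
rewrite -(sset_forall (fun (p : nat * T) x => Omega x ->
    normc (dpow alpha p.2 x) <= p.1%:R)).
by apply: sset_imply => q /= h y; exact: h.
Qed.

(** The standard content of sufficiency. The constant [c] depends on [alpha] and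
[K] only, so that [e] may be taken infinitesimal after transfer. *)
Definition weak_bound : Prop :=
  forall (alpha : multi_index n) (K : set 'rV[R]_n),
  compact K -> K `<=` Omega ->
  exists c : R, 0 <= c /\ forall (f : X) (g phi : T) (e C : R),
    0 <= e -> 0 <= C -> supp phi `<=` K ->
    (forall x, K x -> f x = dpow alpha g x) ->
    (forall x, Omega x -> normc (g x) <= e) ->
    (forall x, Omega x -> normc (dpow alpha phi x) <= C) ->
    normc (pairing f phi) <= c * e * C.

(** The standard content of necessity. [G f] is the primitive and [Phi d x] are the
test functions whose integrals against [f] approximate its value at [x]; the
bounds hold for all [x], hence also at nonstandard points after transfer. *)
Definition small_primitives : Prop :=
  forall K : set 'rV[R]_n, compact K -> K `<=` Omega ->
  exists K' : set 'rV[R]_n, compact K' /\ K' `<=` Omega /\ forall m : nat,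
  exists (alpha : multi_index n) (G : X -> T) (C : R)
    (Phi : R -> 'rV[R]_n -> T),
  [/\ 0 <= C,
      forall (f : X) x, K x -> f x = dpow alpha (G f) x,
      forall d x, 0 < d -> supp (Phi d x) `<=` K',
      forall d beta, 0 < d -> exists C', forall x y,
        normc (dpow beta (Phi d x) y) <= C' &
      forall f, controlled m K' f -> forall d x, 0 < d < 1 ->
        normc (G f x - pairing f (Phi d x)) <= C * d].

Lemma approxCP (A : Type) (h : A -> R[i]) (c : star E A) :
  approxC (smap E h c) (std E 0) <->
  forall e : R, 0 < e -> sset E [set a | normc (h a) < e] c.
Proof.
rewrite /approxC /Defs.approx -(@smap_cst E _ _ (0 : R[i]) c).
have H e : srel (fun u v : Rcomplex R => `|u - v| < e) (smap E h c)
    (smap E (fun=> 0 : Rcomplex R) c) <-> sset E [set a | normc (h a) < e] c.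
  rewrite (@srelE E _ _ _ _ (h : A -> Rcomplex R)).
  have -> // : [set a | `|(h a : Rcomplex R) - 0| < e] =
    [set a | normc (h a) < e].
  by apply/seteqP; split=> a /=; rewrite subr0.
by split => h' e /h' /H.
Qed.

(** For each standard [e] the statement is internal; the quantifier over [e] is the
only external one. *)
Lemma infinitesimal_on (U : set 'rV[R]_n) (g : star E T) :
  (forall x, sset E U x -> approxC (stest_eval g x) (std E 0)) <->
  forall e : R, 0 < e ->
    sset E [set u : T | forall x, U x -> normc (u x) < e] g.
Proof.
have H x : stest_eval g x =
    smap E (fun p : T * 'rV[R]_n => p.1 p.2) (spair E g x) by [].
split=> [gx e e0|gx x Ux].
  apply/(sset_forall_in U (fun (u : T) x => normc (u x) < e)) => x Ux.
  by have := gx x Ux; rewrite H approxCP; apply.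
rewrite H approxCP => e e0.
have /(sset_forall_in U (fun (u : T) x => normc (u x) < e)) := gx e e0.
exact.
Qed.

Lemma seval_stest_dpowP (U : set 'rV[R]_n) (alpha : multi_index n)
    (f : star E X) (g : star E T) :
  (forall x, sset E U x -> seval f x = stest_dpow alpha g x) <->
  srel (fun (u : X) (v : T) => forall x, U x -> u x = dpow alpha v x) f g.
Proof.
rewrite /srel (sset_forall_in U (fun (p : X * T) x => p.1 x = dpow alpha p.2 x)).
have H x : seval f x = stest_dpow alpha g x <->
    srel (fun (p : X * T) x => p.1 x = dpow alpha p.2 x) (spair E f g) x.
  rewrite /srel /seval /stest_dpow.
  have fE : f = smap E (fst \o fst) (spair E (spair E f g) x).
    by rewrite smap_comp !smap_fst.
  have gE : g = smap E (snd \o fst) (spair E (spair E f g) x).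
    by rewrite smap_comp smap_fst smap_snd.
  have xE : x = smap E snd (spair E (spair E f g) x) by rewrite smap_snd.
  move: fE gE xE; move: (spair E (spair E f g) x) => q -> -> ->.
  by rewrite !smap2E smap_eqP.
by split=> h x /h /H.
Qed.

Lemma approx0_of_primitive (f : star E X) : weak_bound ->
  (forall K : set 'rV[R]_n, compact K -> K `<=` Omega ->
    exists (alpha : multi_index n) (g : star E T),
      (forall x, sset E Omega x -> approxC (stest_eval g x) (std E 0)) /\
      (forall x, sset E K x -> seval f x = stest_dpow alpha g x)) ->
  approx0_distr f.
Proof.
move=> IB loc phi fphi.
have [m phiK] := finite_test_supp fphi.
have [alpha [g [/infinitesimal_on g0 /seval_stest_dpowP fg]]] :=
  loc _ (@exhaustion_compact m) (@exhaustion_sub m).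
have [c [c0 cP]] := IB alpha _ (@exhaustion_compact m) (@exhaustion_sub m).
have [M phiM] := finite_test_bound alpha fphi.
rewrite /spairing.
have fE : f = smap E (fst \o fst) (spair E (spair E f phi) g).
  by rewrite smap_comp !smap_fst.
have phiE : phi = smap E (snd \o fst) (spair E (spair E f phi) g).
  by rewrite smap_comp smap_fst smap_snd.
have gE : g = smap E snd (spair E (spair E f phi) g) by rewrite smap_snd.
move: phiK phiM g0 fg; move: fE phiE gE; move: (spair E (spair E f phi) g) => q.
move=> -> -> -> /sset_smap phiK /sset_smap phiM g0 /srelE fg.
rewrite smap2E approxCP => e e0.
pose e' := e / (c * M%:R + 1).
have cM0 : 0 <= c * M%:R by rewrite mulr_ge0.
have e'0 : 0 < e' by rewrite divr_gt0// ltr_wpDl.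
have /sset_smap ge := g0 _ e'0.
have := (sset_and _ _ _).2 (conj phiK ((sset_and _ _ _).2 (conj phiM
  ((sset_and _ _ _).2 (conj ge fg))))).
apply: sset_imply => -[[u v] w] /= [vK [vM [we uw]]].
apply: le_lt_trans (cP u w v e' M%:R _ _ _ _ _ _) _ => //.
- exact: ltW.
- by move=> x /we /ltW.
rewrite (_ : c * e' * M%:R = e * (c * M%:R) / (c * M%:R + 1)); last first.
  by rewrite /e'; ring.
by rewrite ltr_pdivrMr ?ltr_wpDl// ltr_pM2l// ltrDl.
Qed.

Lemma finite_test_intro (K : set 'rV[R]_n) (phi : star E T) :
  compact K -> K `<=` Omega -> sset E [set u : T | supp u `<=` K] phi ->
  (forall alpha, exists C, sset E [set u : T | forall x, Omega x ->
    normc (dpow alpha u x) <= C] phi) -> finite_test phi.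
Proof.
move=> Kco KO phiK phiC; split=> [x xphi|alpha x Ox].
  have Kx : sset E K x.
    move: phiK xphi; rewrite /in_supp.
    have -> : phi = smap E fst (spair E phi x) by rewrite smap_fst.
    have xE : x = smap E snd (spair E phi x) by rewrite smap_snd.
    move: xE; move: (spair E phi x) => q -> /sset_smap qK /srelE qx.
    apply/sset_smap; have := (sset_and _ _ _).2 (conj qK qx).
    by apply: sset_imply => p /= [+ pp]; apply.
  split; first by apply: sset_imply Kx.
  have [y Ky xy] := compact_nearstandard Kco Kx.
  by exists y; split => //; exact: KO.
have [C /(sset_forall_in Omega (fun (u : T) x => normc (dpow alpha u x) <= C))] :=
  phiC alpha.
by move=> /(_ x Ox) h; exists C; rewrite /stest_dpow /smap2; apply/sset_smap.
Qed.

(** For infinite [N] a test function bounded by 1 in the C^N norm is finite, because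
every standard order of derivation is below [N]. *)
Lemma approx0_controlled (K : set 'rV[R]_n) (f : star E X) :
  compact K -> K `<=` Omega -> approx0_distr f ->
  exists m, sset E [set u | controlled m K u] f.
Proof.
move=> Kco KO f0.
apply: (@underspill E X (fun m u => controlled m K u)) => N infN.
rewrite /srel /controlled.
apply/(sset_forall (fun (p : nat * X) (phi : T) => supp phi `<=` K ->
    (forall s, (size s <= p.1)%N -> forall x, Omega x ->
       normc (partials s phi x) <= 1) ->
    normc (pairing p.2 phi) <= 1)) => phi.
rewrite /srel.
have NE : N = smap E (fst \o fst) (spair E (spair E N f) phi).
  by rewrite smap_comp !smap_fst.
have fE : f = smap E (snd \o fst) (spair E (spair E N f) phi).
  by rewrite smap_comp smap_fst smap_snd.
have phiE : phi = smap E snd (spair E (spair E N f) phi) by rewrite smap_snd.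
move: NE fE phiE; move: (spair E (spair E N f) phi) => q NE fE phiE.
apply: contrapT => /sset_not nq.
have phifin : finite_test phi.
  apply: (finite_test_intro Kco KO).
    rewrite phiE; apply/sset_smap; apply: sset_imply nq => p /= np.
    by apply: contrapT => nK; apply: np.
  move=> alpha; exists 1; rewrite phiE; apply/sset_smap.
  have [s sE] := dpow_partials R alpha.
  have /sset_smap Nm : sset E [set j | (size s <= j)%N] (smap E (fst \o fst) q).
    by rewrite -NE; exact: nonstd_ge.
  have := (sset_and _ _ _).2 (conj Nm nq).
  apply: sset_imply => p /= [sp np] x Ox; rewrite sE.
  apply: contrapT => nle; apply: np => _ /(_ s sp x Ox) //.
have := f0 _ phifin; rewrite /spairing fE phiE smap2E approxCP => /(_ 1 ltr01) h.
have := (sset_and _ _ _).2 (conj h nq) => h2.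
suff : sset E set0 q by move/sset_not : (@sset_all E _ (~` set0) q (fun=> id)).
apply: sset_imply h2 => p /= [lt1 np]; apply: np => _ _.
exact: ltW.
Qed.

Lemma primitive_of_approx0 (f : star E X) : small_primitives -> approx0_distr f ->
  forall K : set 'rV[R]_n, compact K -> K `<=` Omega ->
    exists (alpha : multi_index n) (g : star E T),
      (forall x, sset E Omega x -> approxC (stest_eval g x) (std E 0)) /\
      (forall x, sset E K x -> seval f x = stest_dpow alpha g x).
Proof.
move=> prim f0 K Kco KO.
have [K' [K'co [K'O {}prim]]] := prim K Kco KO.
have [m fm] := approx0_controlled K'co K'O f0.
have [alpha [G [C [Phi [C0 GE PhiK PhiC Gsmall]]]]] := prim m.
exists alpha, (smap E G f); split; last first.
  apply/seval_stest_dpowP; rewrite -{1}(smap_id f); apply/srelE.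
  by apply: sset_all => u x; exact: GE.
move=> x Ox; rewrite /stest_eval.
have fE : f = smap E fst (spair E f x) by rewrite smap_fst.
have xE : x = smap E snd (spair E f x) by rewrite smap_snd.
move: fE xE; move: (spair E f x) => q fE xE.
rewrite [in smap2 _ _ _]fE xE -smap_comp smap2E approxCP => e e0.
pose d := Num.min 2^-1 (e / (2 * (C + 1))).
have C1 : 0 < C + 1 by rewrite ltr_wpDl.
have d0 : 0 < d by rewrite lt_min invr_gt0 ltr0n /= divr_gt0// mulr_gt0.
have d1 : d < 1 by rewrite gt_min invf_lt1 ?ltr1n ?ltr0n.
have dC : C * d <= e / 2.
  apply: (@le_trans _ _ ((C + 1) * (e / (2 * (C + 1))))).
    apply: ler_pM => //; [exact: ltW|by rewrite lerDl|by rewrite ge_min lexx orbT].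
  rewrite (_ : _ * _ = e / 2) //.
  by field; lra.
have e20 : 0 < e / 2 by rewrite divr_gt0.
pose phi := smap E (fun p : X * 'rV[R]_n => Phi d p.2) q.
have phifin : finite_test phi.
  apply: (finite_test_intro K'co K'O).
    by apply/sset_smap; apply: sset_all => p /=; exact: PhiK.
  move=> beta; have [C' C'P] := PhiC d beta d0; exists C'.
  by apply/sset_smap; apply: sset_all => p y _ /=.
have := f0 _ phifin; rewrite /spairing fE /phi smap2E approxCP => /(_ _ e20) h.
move: fm; rewrite fE => /sset_smap fm.
have := (sset_and _ _ _).2 (conj h fm); apply: sset_imply => -[u y] /= [uy um].
have := Gsmall u um d y; rewrite d0 d1 => /(_ isT) Guy.
rewrite -[G u y](subrK (pairing u (Phi d y))) [e]splitr.
apply: (le_lt_trans (le_normcD _ _)); apply: ler_ltD => //.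
exact: le_trans Guy dC.
Qed.

End reduction.

(** * Test functions and the weak bound *)

Section testfunctions.
Variables (R : realType) (n : nat) (Omega : set 'rV[R]_n).
Notation X := (Cinfty Omega).
Notation T := (testfun Omega).
Notation Ref f := (fun x => complex.Re (f x)).
Notation Imf f := (fun x => complex.Im (f x)).

Lemma suppP (f : 'rV[R]_n -> R[i]) x : ~ supp f x -> f x = 0.
Proof.
move=> nx; apply: contrapT => fx; apply: nx; exact: subset_closure.
Qed.

(** Every point lies in [U] or in the complement of [K], where the function
vanishes. *)
Lemma smooth_glue (K U : set 'rV[R]_n) (u : 'rV[R]_n -> R) : closed K ->
  K `<=` U -> smooth U u -> (forall x, ~ K x -> u x = 0) -> smooth setT u.
Proof.
move=> Kc KU su u0 k.
have -> : setT = U `|` ~` K.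
  apply/seteqP; split=> // x _; have [Kx|nKx] := pselect (K x); last by right.
  by left; exact: KU.
apply: Ck_setU; first exact: su.
apply: (@Ck_eq _ _ k (~` K) (fun=> 0)); first exact: closed_openC.
  by move=> x /u0.
by apply: Ck_cst; exact: closed_openC.
Qed.

Lemma rparts_outside (K : set 'rV[R]_n) (u : 'rV[R]_n -> R) s x : closed K ->
  (forall x, ~ K x -> u x = 0) -> ~ K x -> rparts s u x = 0.
Proof.
move=> Kc u0 nKx; rewrite (rparts_eq (v := fun=> 0) s (closed_openC Kc) u0 nKx).
elim: s x nKx => //= i s IH x nKx.
rewrite (rpart_eq (v := fun=> 0) i (closed_openC Kc) _ nKx) ?rpart_cst//.
Qed.

Lemma compact_closed_rV (K : set 'rV[R]_n) : compact K -> closed K.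
Proof. by apply: compact_closed; exact: norm_hausdorff. Qed.

Lemma compact_ball (K : set 'rV[R]_n) : compact K ->
  exists2 r : R, 0 <= r & forall x, K x -> `|x| <= r.
Proof.
move=> /compact_bounded[M [Mr MP]]; exists (`|M| + 1); first by rewrite addr_ge0.
by move=> x Kx; apply: MP => //; rewrite (le_lt_trans (ler_norm M))// ltrDl.
Qed.

Lemma supported_of_zero (K : set 'rV[R]_n) r (u : 'rV[R]_n -> R) :
  (forall x, K x -> `|x| <= r) -> (forall x, ~ K x -> u x = 0) -> supported r u.
Proof.
by move=> Kr u0 x rx; apply: u0 => /Kr; rewrite leNgt rx.
Qed.

Lemma Cinfty_smooth_real (f : X) : smooth Omega (Ref f) /\ smooth Omega (Imf f).
Proof. exact/smooth_onP/Cinfty_smooth. Qed.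

Lemma testfun_smooth (u : T) : smooth setT (Ref u) /\ smooth setT (Imf u).
Proof.
have [sr si] := Cinfty_smooth_real u.
have sc : closed (supp u) by apply: compact_closed_rV; exact: testfun_compact.
by split; apply: (smooth_glue sc (@testfun_supp _ _ _ u)) => // x /suppP ->.
Qed.

Lemma integralC_full (h : 'rV[R]_n -> R[i]) : (forall y, ~ Omega y -> h y = 0) ->
  integralC Omega h = Complex (intR (Ref h)) (intR (Imf h)).
Proof.
move=> h0; rewrite /integralC /intR; congr Complex.
  rewrite Rintegral_mkcond; apply: eq_Rintegral => y _; rewrite /patch.
  case: ifPn => // yO; rewrite h0// => Oy.
  by move/negP : yO; apply; apply/mem_set.
rewrite Rintegral_mkcond; apply: eq_Rintegral => y _; rewrite /patch.
case: ifPn => // yO; rewrite h0// => Oy.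
by move/negP : yO; apply; apply/mem_set.
Qed.

Lemma pairingE (f : X) (phi : T) : pairing f phi =
  Complex (intR (fun y => complex.Re (f y) * complex.Re (phi y)
                        - complex.Im (f y) * complex.Im (phi y)))
          (intR (fun y => complex.Re (f y) * complex.Im (phi y)
                        + complex.Im (f y) * complex.Re (phi y))).
Proof.
rewrite /pairing integralC_full; last first.
  by move=> y nO; rewrite (@Cinfty_out R n Omega phi) ?mulr0.
by congr Complex; apply: eq_intR => y; case: (f y) => a b; case: (phi y).
Qed.

(** All derivatives move to [v], after which only the sup norm of [u] matters. *)
Lemma parts_bound (u v : 'rV[R]_n -> R) s q r e C : smooth setT u ->
  supported q u -> smooth setT v -> supported r v -> 0 <= r -> 0 <= e -> 0 <= C ->
  (forall x, `|u x| <= e) -> (forall x, `|rparts s v x| <= C) ->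
  `|intR (fun x => rparts s u x * v x)| <= e * C * (2 * r) ^+ n.
Proof.
move=> su uq sv vr r0 e0 C0 ue vC.
rewrite (intR_parts_seq s su uq sv) normrM normrX normrN1 expr1n mul1r.
apply: (@intR_bound R n (fun x => u x * rparts s v x) r) => //.
- exact: (continuous_mul (smoothT_continuous su)
    (smoothT_continuous (smooth_rparts s sv))).
- by apply: supportedMr; exact: supported_rparts.
- exact: mulr_ge0.
- by move=> x; rewrite normrM ler_pM.
Qed.

(** The real bilinear estimate is applied to the four products of real and
imaginary parts. *)
Lemma weak_bound_holds : weak_bound Omega.
Proof.
move=> alpha K Kco KO; have [r r0 Kr] := compact_ball Kco.
exists (4 * (2 * r) ^+ n); split; first by rewrite mulr_ge0// exprn_ge0// mulr_ge0.
move=> f g phi e C e0 C0 phiK fg ge phiC.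
set s := index_seq alpha.
have fgE x : K x -> f x = partials s g x by move=> /fg ->; rewrite dpowE.
have phi0 x : ~ K x -> phi x = 0.
  by move=> nK; apply: suppP => /phiK.
have Kc := compact_closed_rV Kco.
have [sgr sgi] := testfun_smooth g; have [spr spi] := testfun_smooth phi.
have gco : compact (supp g) by exact: testfun_compact.
have [q q0 gq] := compact_ball gco.
have supr (h : R[i] -> R) : h 0 = 0 -> supported q (fun x => h (g x)).
  by move=> h0; apply: (supported_of_zero gq) => x /suppP ->.
have supp' (h : R[i] -> R) : h 0 = 0 -> supported r (fun x => h (phi x)).
  by move=> h0; apply: (supported_of_zero Kr) => x /phi0 ->.
have geR x : normc (g x) <= e.
  have [Ox|nO] := pselect (Omega x); first exact: ge.
  by rewrite (@Cinfty_out R n Omega g)// normc0.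
have phiCR x : normc (partials s phi x) <= C.
  have [Ox|nO] := pselect (Omega x); first by rewrite -dpowE; exact: phiC.
  have nK : ~ K x by move=> /KO.
  rewrite partialsE !(rparts_outside _ Kc)// ?normc0//.
  - by move=> y /phi0 ->.
  - by move=> y /phi0 ->.
have B (a b : R[i] -> R) : a = @complex.Re R \/ a = @complex.Im R ->
    b = @complex.Re R \/ b = @complex.Im R ->
    [/\ continuous (fun y => a (f y) * b (phi y)),
        supported r (fun y => a (f y) * b (phi y)) &
      `|intR (fun y => a (f y) * b (phi y))| <= e * C * (2 * r) ^+ n].
  move=> Ha Hb.
  have sa : smooth setT (fun x => a (g x)) by case: Ha => ->.
  have sb : smooth setT (fun x => b (phi x)) by case: Hb => ->.
  have a0 : a 0 = 0 by case: Ha => ->.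
  have b0 : b 0 = 0 by case: Hb => ->.
  have -> : (fun y => a (f y) * b (phi y)) =
      (fun y => rparts s (fun x => a (g x)) y * b (phi y)).
    apply/funext => y; have [Ky|nKy] := pselect (K y).
      by rewrite fgE// partialsE; case: Ha => ->.
    by rewrite phi0// b0 !mulr0.
  split.
  - exact: (continuous_mul (smoothT_continuous (smooth_rparts s sa))
      (smoothT_continuous sb)).
  - by apply: supportedMr; exact: supp'.
  apply: (parts_bound sa (supr a a0) sb (supp' b b0)) => // x.
    apply: le_trans (geR x); have [h1 h2] := normc_ge (g x).
    by case: Ha => ->.
  apply: le_trans (phiCR x); have [h1 h2] := normc_ge (partials s phi x).
  by case: Hb => ->; [rewrite -Re_partials|rewrite -Im_partials].
have [c1 s1 b1] := B _ _ (or_introl erefl) (or_introl erefl).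
have [c2 s2 b2] := B _ _ (or_intror erefl) (or_intror erefl).
have [c3 s3 b3] := B _ _ (or_introl erefl) (or_intror erefl).
have [c4 s4 b4] := B _ _ (or_intror erefl) (or_introl erefl).
rewrite pairingE (le_trans (normc_le _))//=.
rewrite (intRB c1 s1 c2 s2) (intRD c3 s3 c4 s4).
apply: (@le_trans _ _ ((e * C * (2 * r) ^+ n + e * C * (2 * r) ^+ n) +
                       (e * C * (2 * r) ^+ n + e * C * (2 * r) ^+ n))).
  apply: lerD.
    by rewrite (le_trans (ler_normB _ _))// lerD.
  by rewrite (le_trans (ler_normD _ _))// lerD.
by rewrite le_eqVlt; apply/orP; left; apply/eqP; ring.
Qed.

End testfunctions.

(** * Estimates on the regularised fundamental solution *)

Section regularised_kernel.
Variables (R : realType) (n : nat).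
Implicit Types (K : set 'rV[R]_n) (x y : 'rV[R]_n) (d e : R).

Lemma prod_diff_le (I : Type) (A : R) (s : seq I) : 0 <= A ->
  exists2 K : R, 0 <= K & forall (a b : I -> R) d, 0 <= d ->
    (forall i, `|a i| <= A) -> (forall i, `|b i| <= A) ->
    (forall i, `|a i - b i| <= d) ->
    `|\prod_(i <- s) a i - \prod_(i <- s) b i| <= K * d.
Proof.
move=> A0; elim: s => [|i s [K K0 IH]].
  by exists 0 => // a b d d0 _ _ _; rewrite !big_nil subrr normr0 mul0r.
exists (A * K + A ^+ size s); first by rewrite addr_ge0 ?mulr_ge0// exprn_ge0.
move=> a b d d0 aA bA ab; rewrite !big_cons.
rewrite (_ : _ - _ = a i * (\prod_(j <- s) a j - \prod_(j <- s) b j) +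
    (a i - b i) * \prod_(j <- s) b j); last by ring.
have bs : `|\prod_(j <- s) b j| <= A ^+ size s.
  elim: (s) => [|j t IHt]; first by rewrite big_nil normr1.
  by rewrite big_cons /= exprS normrM ler_pM.
rewrite (le_trans (ler_normD _ _))// [leRHS]mulrDl lerD//.
  by rewrite normrM -mulrA ler_pM// IH.
by rewrite normrM mulrC ler_pM.
Qed.

Lemma smooth_Cm_bnd (u : 'rV[R]_n -> R) r p : smooth setT u -> supported r u ->
  exists2 C : R, 0 <= C & Cm_bnd p setT C u.
Proof.
elim: p u => [|p IH] u su ur.
  have [C C0 CP] := supported_bounded (smoothT_continuous su) ur.
  by exists C => //; split.
have [C C0 CP] := supported_bounded (smoothT_continuous su) ur.
have H (s : seq 'I_n) : exists2 D : R, 0 <= D &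
    forall i, i \in s -> Cm_bnd p setT D (rpart i u).
  elim: s => [|i s [D D0 DP]]; first by exists 0.
  have [D' D'0 D'P] := IH _ (smooth_rpart i su) (supported_rpart i ur).
  exists (D + D'); first exact: addr_ge0.
  move=> j; rewrite in_cons => /predU1P[->|js].
    by apply: Cm_bnd_le D'P; rewrite lerDr.
  by apply: Cm_bnd_le (DP j js); rewrite lerDl.
have [D D0 DP] := H (enum 'I_n).
exists (C + D); first exact: addr_ge0.
split=> [x _|i]; first by rewrite (le_trans (CP x))// lerDl.
by apply: Cm_bnd_le (DP i _); rewrite ?lerDr// mem_enum.
Qed.

Lemma Cm_bnd_sub p (B B' : set 'rV[R]_n) C u : B' `<=` B -> Cm_bnd p B C u -> Cm_bnd p B' C u.
Proof.
move=> BB; elim: p u => [|p IH] u [bu pu]; split=> //.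
- by move=> x /BB; exact: bu.
- by move=> x /BB; exact: bu.
- by move=> i; apply: IH; exact: pu.
Qed.

Variables (N : nat).
Let c : R := (N`!%:R)^-1.

(** The regularisation of [fundamental] at [x - y], as a function of [y]; the
argument is written in the affine form to which [smooth_coord] applies. *)
Definition reg_fundamental d x y : R :=
  \prod_(i <- enum 'I_n) reg_power N c d 0 (-1 * y 0 i + x 0 i).

Lemma smooth_reg_factor d x (i : 'I_n) : 0 < d ->
  smooth setT (fun y : 'rV[R]_n => reg_power N c d 0 (-1 * y 0 i + x 0 i)).
Proof.
move=> d0; apply: (smooth_coord (hs := reg_power N c d)); first exact: openT.
by move=> j t; exact: is_derive_reg_power.
Qed.

Lemma smooth_reg_fundamental d x : 0 < d -> smooth setT (reg_fundamental d x).
Proof.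
move=> d0; apply: smooth_prod => [|i]; first exact: openT.
exact: smooth_reg_factor.
Qed.

Variables (K : set 'rV[R]_n) (q : R).
Hypothesis Kq : forall x, K x -> `|x| <= q.

Lemma reg_arg_le x y i : K x -> K y -> `|-1 * y 0 i + x 0 i| <= 2 * q.
Proof.
move=> /Kq xq /Kq yq; rewrite mulN1r (le_trans (ler_normD _ _))// normrN.
rewrite mulr_natl mulr2n lerD//; first exact: le_trans (coord_le_norm y i) yq.
exact: le_trans (coord_le_norm x i) xq.
Qed.

Lemma Cm_bnd_reflected_coord m B C (hs : nat -> R -> R) (b : R) (i : 'I_n) :
  (forall j (t : R), is_derive t (1 : R) (hs j) (hs j.+1 t)) ->
  (forall j x, (j <= m)%N -> B x -> `|hs j (-1 * x 0 i + b)| <= C) ->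
  Cm_bnd m B C (fun x : 'rV[R]_n => hs 0%N (-1 * x 0 i + b)).
Proof.
move=> dhs hC.
have := @Cm_bnd_coord R n m B C hs (-1) b 1 i dhs.
rewrite normrN normr1 lexx => /(_ isT isT hC).
by congr Cm_bnd; apply/funext => x; rewrite mul1r.
Qed.

Lemma reg_fundamental_bnd d p : 0 < d ->
  exists2 A : R, 0 <= A & forall x, K x -> Cm_bnd p K A (reg_fundamental d x).
Proof.
move=> d0.
have [C C0 CP] := @fin_bound R p.+1
  (fun j C => forall t, `|t| <= 2 * q -> `|reg_power N c d j t| <= C)
  (fun j C D CD h t tq => le_trans (h t tq) CD)
  (fun j _ => reg_power_bounded N c j (2 * q) d0).
have [A [A0 AP]] := @Cm_bnd_prod_diff R n 'I_n p K C (enum 'I_n) C0.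
exists A => // x Kx.
have bk i : Cm_bnd p K C (fun y => reg_power N c d 0 (-1 * y 0 i + x 0 i)).
  apply: (@Cm_bnd_reflected_coord p K C (reg_power N c d)) => [j t|j y jp Ky].
    exact: is_derive_reg_power.
  by apply: CP => //; exact: reg_arg_le.
have sk i := smooth_reg_factor x i d0.
have [] // := AP (fun i y => reg_power N c d 0 (-1 * y 0 i + x 0 i))
  (fun i y => reg_power N c d 0 (-1 * y 0 i + x 0 i)) 0 (lexx 0) sk sk bk bk.
move=> i; rewrite (_ : (fun y => _) = fun=> 0); last first.
  by apply/funext => y; rewrite subrr.
by apply: Cm_bnd_cst; rewrite normr0.
Qed.

(** The strict inequality [m < N] leaves one power of t in each of the first [m]
derivatives, as uniformity in [d] and [e] requires. *)
Lemma reg_fundamental_close m : (m < N)%N ->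
  exists2 A : R, 0 <= A & forall d e x, 0 < d < 1 -> 0 < e < 1 -> K x ->
    Cm_bnd m K (A * (d + e)) (fun y => reg_fundamental d x y - reg_fundamental e x y).
Proof.
move=> mN.
have [C C0 CP] := reg_power_bounded_unif N c (2 * q).
have [D D0 DP] := reg_power_close N c (2 * q).
have [A [A0 AP]] := @Cm_bnd_prod_diff R n 'I_n m K C (enum 'I_n) C0.
exists (A * D); first exact: mulr_ge0.
move=> d e x /andP[d0 d1] /andP[e0 e1] Kx.
have bk h i : 0 < h < 1 -> Cm_bnd m K C (fun y => reg_power N c h 0 (-1 * y 0 i + x 0 i)).
  move=> h01; have /andP[h0 _] := h01.
  apply: (@Cm_bnd_reflected_coord m K C (reg_power N c h)) => [j t|j y jp Ky].
    exact: is_derive_reg_power.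
  apply: CP => //; first exact: leq_ltn_trans mN.
  exact: le_trans (ler_norm _) (reg_arg_le i Kx Ky).
rewrite -mulrA.
have [] // := AP (fun i y => reg_power N c d 0 (-1 * y 0 i + x 0 i))
  (fun i y => reg_power N c e 0 (-1 * y 0 i + x 0 i)) (D * (d + e)).
- by rewrite mulr_ge0// ltW// addr_gt0.
- by move=> i; exact: smooth_reg_factor.
- by move=> i; exact: smooth_reg_factor.
- by move=> i; apply: bk; rewrite d0.
- by move=> i; apply: bk; rewrite e0.
move=> i; apply: (@Cm_bnd_reflected_coord m K _ (fun j t => reg_power N c d j t - reg_power N c e j t)).
  by move=> j t; apply: is_deriveB; exact: is_derive_reg_power.
move=> j y jp Ky; apply: DP => //; first exact: leq_ltn_trans mN.
exact: le_trans (ler_norm _) (reg_arg_le i Kx Ky).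
Qed.

Lemma reg_fundamental_close_fundamental : (0 < N)%N ->
  exists2 A : R, 0 <= A & forall d x y, 0 < d < 1 -> K x -> K y ->
    `|fundamental N (x - y) - reg_fundamental d x y| <= A * d.
Proof.
move=> N0.
have [C C0 CP] := reg_power_bounded_unif N c (2 * q).
have [D D0 DP] := reg_power_close_trunc c (2 * q) N0.
have [A A0 AP] := @prod_diff_le 'I_n (C + D) (enum 'I_n) (addr_ge0 C0 D0).
exists (A * D); first exact: mulr_ge0.
move=> d x y /andP[d0 d1] Kx Ky; rewrite -mulrA /fundamental /reg_fundamental -/c.
have le2q i := le_trans (ler_norm _) (reg_arg_le i Kx Ky).
have E i : (x - y) 0 i = -1 * y 0 i + x 0 i by rewrite !mxE mulN1r addrC.
have close i : `|trunc_power N c ((x - y) 0 i) - reg_power N c d 0 (-1 * y 0 i + x 0 i)| <= D * d.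
  by rewrite E distrC; exact: DP.
have kC i : `|reg_power N c d 0 (-1 * y 0 i + x 0 i)| <= C.
  by apply: CP => //; rewrite d0.
apply: AP => //.
- by rewrite mulr_ge0// ltW.
- move=> i; rewrite -[trunc_power _ _ _](subrK (reg_power N c d 0 (-1 * y 0 i + x 0 i))).
  rewrite (le_trans (ler_normD _ _))// addrC lerD//.
  by rewrite (le_trans (close i))// ler_piMr// ltW.
- by move=> i; rewrite (le_trans (kC i))// lerDl.
Qed.

End regularised_kernel.

(** * Existence of small primitives *)

Section primitives_proof.
Variables (R : realType) (n : nat) (Omega : set 'rV[R]_n).
Hypothesis Omega_open : open Omega.
Notation X := (Cinfty Omega).
Notation T := (testfun Omega).

Lemma testfun_exists (K : set 'rV[R]_n) (u v : 'rV[R]_n -> R) : compact K ->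
  K `<=` Omega -> smooth setT u -> smooth setT v ->
  (forall x, ~ K x -> u x = 0) -> (forall x, ~ K x -> v x = 0) ->
  exists phi : T, (forall x, phi x = Complex (u x) (v x)) /\ supp phi `<=` K.
Proof.
move=> Kco KO su sv u0 v0.
pose f x : R[i] := Complex (u x) (v x).
have fs : smooth_on Omega f.
  by apply/smooth_onP; split; exact: smooth_sub (@subsetT _ _) _.
have fo x : ~ Omega x -> f x = 0.
  move=> nO; have nK : ~ K x by move=> /KO.
  by rewrite /f u0// v0.
have sf : supp (MkCinfty fs fo) `<=` K.
  rewrite /supp [X in _ `<=` X](closure_id _).1; last exact: compact_closed_rV.
  apply: closure_subset => x /= fx; apply: contrapT => nK; apply: fx.
  by rewrite /f u0// v0.
have cf : compact (supp (MkCinfty fs fo)).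
  by apply: (subclosed_compact _ Kco sf); exact: closed_closure.
by exists (MkTestfun cf (subset_trans sf KO)).
Qed.

Variables (K' : set 'rV[R]_n) (chi : 'rV[R]_n -> R) (q : R).
Hypotheses (K'co : compact K') (K'O : K' `<=` Omega) (schi : smooth setT chi).
Hypotheses (chi0 : forall x, ~ K' x -> chi x = 0) (q0 : 0 <= q).
Hypothesis K'q : forall x, K' x -> `|x| <= q.
Variable m : nat.
Notation N := m.+1.

Let K'c : closed K' := compact_closed_rV K'co.

Lemma smooth_cut (u : 'rV[R]_n -> R) : smooth Omega u ->
  smooth setT (fun x => chi x * u x).
Proof.
move=> su; apply: (smooth_glue K'c K'O) => [|x /chi0 ->]; last by rewrite mul0r.
by apply: smoothM => //; exact: smooth_sub (@subsetT _ _) _.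
Qed.

Lemma supported_cut (u : 'rV[R]_n -> R) : supported q (fun x => chi x * u x).
Proof. by apply: (supported_of_zero K'q) => x /chi0 ->; rewrite mul0r. Qed.

(** The candidate for the infinitesimal primitive, before its final
multiplication by [chi]. *)
Definition primitive (u : 'rV[R]_n -> R) : 'rV[R]_n -> R :=
  convol (fun x => chi x * u x) (fundamental N).

Lemma smooth_primitive u : smooth Omega u -> smooth setT (primitive u).
Proof.
move=> su; apply: (convol_smooth (smooth_cut su) (supported_cut u)).
exact: continuous_fundamental.
Qed.

Lemma primitiveP (V : set 'rV[R]_n) u x : open V -> (forall x, V x -> chi x = 1) ->
  V x -> smooth Omega u ->
  rparts (index_seq (const_index n N.+1)) (fun x => chi x * primitive u x) x = u x.
Proof.
move=> Vo chi1 Vx su.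
rewrite (rparts_eq (v := primitive u) _ Vo _ Vx); last first.
  by move=> y /chi1 ->; rewrite mul1r.
rewrite /primitive (convol_rparts _ (smooth_cut su) (supported_cut u)); last first.
  exact: continuous_fundamental.
by rewrite (fundamental_identity _ _ (smooth_cut su) (supported_cut u))// chi1// mul1r.
Qed.

(** The factor [chi x] is constant in [y]; it makes the estimates hold for all
[x], trivially outside [K']. *)
Definition probe (d : R) (x y : 'rV[R]_n) : R := chi x * (chi y * reg_fundamental N d x y).

Lemma smooth_probe d x : 0 < d -> smooth setT (probe d x).
Proof.
move=> d0; apply: smoothZ; first exact: openT.
by apply: smoothM; [exact: openT|exact: schi|exact: smooth_reg_fundamental].
Qed.

Lemma probe_outside d x y : ~ K' y -> probe d x y = 0.
Proof. by move=> /chi0 nK; rewrite /probe nK mul0r mulr0. Qed.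

(** Choice packages the probes as one function with values in test functions, to
which transfer applies. *)
Lemma probes_exist : exists Phi : R -> 'rV[R]_n -> T, forall d x, 0 < d ->
  (forall y, Phi d x y = Complex (probe d x y) 0) /\ supp (Phi d x) `<=` K'.
Proof.
have ex (p : R * 'rV[R]_n) : exists phi : T, 0 < p.1 ->
    (forall y, phi y = Complex (probe p.1 p.2 y) 0) /\ supp phi `<=` K'.
  have [d0|nd] := ltP 0 p.1; last first.
    have [phi _] := @testfun_exists K' (fun=> 0) (fun=> 0) K'co K'O
      (smooth_cst 0 openT) (smooth_cst 0 openT) (fun _ _ => erefl) (fun _ _ => erefl).
    by exists phi.
  have [phi phiP] := @testfun_exists K' (probe p.1 p.2) (fun=> 0) K'co K'O
      (smooth_probe p.2 d0) (smooth_cst 0 openT) (@probe_outside p.1 p.2) (fun _ _ => erefl).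
  by exists phi.
have [Phi PhiP] := choice ex.
by exists (fun d x => Phi (d, x)) => d x d0; exact: (PhiP (d, x)).
Qed.

Lemma chi_bounded p : exists2 C : R, 0 <= C & Cm_bnd p setT C chi.
Proof.
apply: (@smooth_Cm_bnd R n chi q p schi).
exact: supported_of_zero K'q chi0.
Qed.

Lemma chi_le : exists2 C : R, 0 <= C & forall x, `|chi x| <= C.
Proof.
have [C C0 [CP _]] := chi_bounded 0; exists C => // x; exact: CP.
Qed.

(** Outside [K'], in either variable, the function vanishes; the constant
depends on [chi] and [p] only. *)
Lemma cut_Cm_bnd p : exists2 C : R, 0 <= C &
  forall (w : 'rV[R]_n -> 'rV[R]_n -> R) A, 0 <= A ->
    (forall x, smooth setT (w x)) -> (forall x, K' x -> Cm_bnd p K' A (w x)) ->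
    forall x s y, (size s <= p)%N ->
      `|rparts s (fun y => chi x * (chi y * w x y)) y| <= C * A.
Proof.
have [C C0 CP] := chi_bounded p; have [D D0 DP] := chi_le.
exists (2 ^+ p * (D * (2 ^+ p * C))).
  by rewrite !mulr_ge0// exprn_ge0.
move=> w A A0 sw wA x s y sp.
have CA0 : 0 <= 2 ^+ p * (D * (2 ^+ p * C)) * A.
  by rewrite !mulr_ge0// exprn_ge0.
have out z : ~ K' z -> chi x * (chi z * w x z) = 0.
  by move=> /chi0 ->; rewrite mul0r mulr0.
have [Ky|nKy] := pselect (K' y); last first.
  by rewrite (rparts_outside s K'c out nKy) normr0.
have [Kx|nKx] := pselect (K' x); last first.
  rewrite (rparts_eq (v := fun=> 0) s openT _ (I : setT y)); last first.
    by move=> z _; rewrite chi0// mul0r.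
  have b0 : Cm_bnd (size s) setT 0 (fun _ : 'rV[R]_n => 0 : R).
    by apply: Cm_bnd_cst; rewrite normr0.
  exact: le_trans (Cm_bnd_rparts b0 (leqnn _) (I : setT y)) CA0.
have bw : Cm_bnd p K' (2 ^+ p * (C * A)) (fun y => chi y * w x y).
  by apply: Cm_bndM => //; [exact: Cm_bnd_sub (@subsetT _ _) CP|exact: wA].
have sw' : smooth setT (fun y => chi y * w x y).
  by apply: smoothM => //; exact: openT.
have bcw : Cm_bnd p K' (2 ^+ p * (D * (2 ^+ p * (C * A)))) (fun y => chi x * (chi y * w x y)).
  apply: (Cm_bndM D0 _ (smooth_cst (chi x) openT) sw' (Cm_bnd_cst _ _ (DP x)) bw).
  by rewrite !mulr_ge0// exprn_ge0.
rewrite (_ : _ * A = 2 ^+ p * (D * (2 ^+ p * (C * A)))); last by ring.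
exact: (Cm_bnd_rparts bcw sp Ky).
Qed.

Lemma probe_bnd p d : 0 < d -> exists C : R, forall x s y, (size s <= p)%N ->
  `|rparts s (probe d x) y| <= C.
Proof.
move=> d0; have [C C0 CP] := cut_Cm_bnd p.
have [A A0 AP] := reg_fundamental_bnd N K'q p d0.
exists (C * A) => x s y sp.
apply: (CP (fun x => reg_fundamental N d x) A A0 _ AP) => // z.
exact: smooth_reg_fundamental.
Qed.

(** The rate d + e in the C^m norm is what [controlled] converts into a rate for
the integrals. *)
Lemma probe_close : exists2 A : R, 0 < A & forall d e, 0 < d < 1 -> 0 < e < 1 ->
  forall x s y, (size s <= m)%N ->
  `|rparts s (fun y => probe d x y - probe e x y) y| <= A * (d + e).
Proof.
have [C C0 CP] := cut_Cm_bnd m.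
have [A A0 AP] := reg_fundamental_close K'q (ltnSn m).
exists (C * A + 1); first by rewrite ltr_wpDl// mulr_ge0.
move=> d e d01 e01 x s y sm.
have /andP[d0 _] := d01; have /andP[e0 _] := e01.
have -> : (fun y => probe d x y - probe e x y) =
    (fun y => chi x * (chi y * (reg_fundamental N d x y - reg_fundamental N e x y))).
  by apply/funext => z; rewrite /probe; ring.
have de0 : 0 <= d + e by rewrite ltW// addr_gt0.
apply: (le_trans (CP (fun x y => reg_fundamental N d x y - reg_fundamental N e x y) (A * (d + e))
  (mulr_ge0 A0 de0) _ _ x s y sm)).
- by move=> z; apply: smoothB; [exact: openT|exact: smooth_reg_fundamental|exact: smooth_reg_fundamental].
- by move=> z Kz; exact: AP.
by rewrite mulrA ler_wpM2r// lerDl.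
Qed.

(** Convergence of the integrals as [d] tends to 0. Unlike in [probe_close], the
constant may depend on [u]: it only serves to identify the limit. *)
Lemma primitive_probe u : smooth Omega u -> exists2 A : R, 0 <= A &
  forall d x, 0 < d < 1 ->
    `|chi x * primitive u x - intR (fun y => u y * probe d x y)| <= A * d.
Proof.
move=> su.
have sF := smooth_cut su; have cF := smoothT_continuous sF.
have Fq := supported_cut u.
have cE : continuous (@fundamental R n N) by exact: continuous_fundamental.
have [M M0 MP] := supported_bounded cF Fq.
have [A A0 AP] := reg_fundamental_close_fundamental K'q (ltn0Sn m).
have [D D0 DP] := chi_le.
exists (D * (M * A * (2 * q) ^+ n)).
  by rewrite !mulr_ge0// exprn_ge0// mulr_ge0.
move=> d x d01; have /andP[d0 _] := d01.
have sk := smooth_reg_fundamental N x d0; have ck := smoothT_continuous sk.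
have cr : continuous (fun y : 'rV[R]_n => fundamental N (x - y)).
  exact: (@continuous_reflect R n (fundamental N) x cE).
have -> : intR (fun y => u y * probe d x y) =
    chi x * intR (fun y => (chi y * u y) * reg_fundamental N d x y).
  rewrite -(intRZ (continuous_mul cF ck) (supportedMl _ Fq)).
  by apply: eq_intR => y; rewrite /probe; ring.
rewrite -mulrBr normrM -mulrA.
have [Kx|nKx] := pselect (K' x); last first.
  rewrite chi0// normr0 mul0r !mulr_ge0// ?exprn_ge0 ?mulr_ge0//; exact: ltW.
apply: ler_pM => //.
rewrite /primitive (convolC x cF Fq cE).
rewrite -(intRB (continuous_mul cF cr) (supportedMl _ Fq)
  (continuous_mul cF ck) (supportedMl _ Fq)).
rewrite [leRHS]mulrAC.
have E : (fun y => chi y * u y * fundamental N (x - y) -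
    chi y * u y * reg_fundamental N d x y) =
    fun y => (chi y * u y) * (fundamental N (x - y) - reg_fundamental N d x y).
  by apply/funext => y; rewrite mulrBr.
rewrite E; apply: (@intR_bound R n _ q) => //.
- exact: (continuous_mul cF (continuous_sub cr ck)).
- exact: supportedMl.
- by rewrite !mulr_ge0// ltW.
move=> y; have [Ky|nKy] := pselect (K' y); last first.
  by rewrite chi0// !mul0r normr0 !mulr_ge0// ltW.
by rewrite normrM -mulrA ler_pM// AP.
Qed.

End primitives_proof.

Section assembly.
Variables (R : realType) (n : nat) (Omega : set 'rV[R]_n).
Hypothesis Omega_open : open Omega.
Notation X := (Cinfty Omega).
Notation T := (testfun Omega).

Lemma normc_scale (c a b : R) :
  normc (Complex (c * a) (c * b)) = `|c| * normc (Complex a b).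
Proof.
by rewrite /= !exprMn -mulrDr sqrtrM ?sqr_ge0// sqrtr_sqr.
Qed.

Lemma pairing_real (f : X) (phi : T) (w : 'rV[R]_n -> R) :
  (forall y, phi y = Complex (w y) 0) -> pairing f phi =
  Complex (intR (fun y => complex.Re (f y) * w y))
          (intR (fun y => complex.Im (f y) * w y)).
Proof.
move=> phiE; rewrite pairingE; congr Complex; apply: eq_intR => y.
  by rewrite phiE /= mulr0 subr0.
by rewrite phiE /= mulr0 add0r.
Qed.

Lemma probe_integrand (K' : set 'rV[R]_n) (chi u : 'rV[R]_n -> R) q N d x :
  compact K' -> K' `<=` Omega -> smooth setT chi ->
  (forall x, ~ K' x -> chi x = 0) -> (forall x, K' x -> `|x| <= q) -> 0 < d ->
  smooth Omega u ->
  continuous (fun y => u y * probe chi N d x y) /\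
  supported q (fun y => u y * probe chi N d x y).
Proof.
move=> K'co K'O schi chi0 K'q d0 su.
have sF := smooth_cut Omega_open K'co K'O schi chi0 su.
rewrite (_ : (fun y => _) = fun y => (chi y * u y) * (chi x * reg_fundamental N.+1 d x y)).
  split; last by exact: (supportedMl _ (supported_cut chi0 K'q u)).
  apply: (continuous_mul (smoothT_continuous sF)); apply: smoothT_continuous.
  by apply: smoothZ; [exact: openT|exact: smooth_reg_fundamental].
by apply/funext => y; rewrite /probe; ring.
Qed.

(** The parameter [e] is an auxiliary one: the distance from [G f x] to the integral
against the probe of parameter [d] is at most A (e + d) + B e for every [e],
and [e] tends to 0. *)
Lemma small_primitives_hold : small_primitives Omega.
Proof.
move=> K Kco KO.
have [K' [V [chi [[K'co K'O] schi chi0 Vo [KV chi1]]]]] := cutoff Omega_open Kco KO.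
have [q q0 K'q] := compact_ball K'co.
exists K'; split => //; split => // m.
have exG (f : X) : exists phi : T, forall x, phi x =
    Complex (chi x * primitive chi m (fun y => complex.Re (f y)) x)
            (chi x * primitive chi m (fun y => complex.Im (f y)) x).
  have [sr si] := Cinfty_smooth_real f.
  have z u x : ~ K' x -> chi x * primitive chi m u x = 0.
    by move=> /chi0 ->; rewrite mul0r.
  have [phi [phiE _]] := testfun_exists K'co K'O
    (smoothM openT schi (smooth_primitive Omega_open K'co K'O schi chi0 K'q m sr))
    (smoothM openT schi (smooth_primitive Omega_open K'co K'O schi chi0 K'q m si)) (z _) (z _).
  by exists phi.
have [G GE] := choice exG.
have [Phi PhiP] := probes_exist K'co K'O schi chi0 m.
have [A A0 AP] := probe_close K'co schi chi0 K'q m.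
exists (const_index n m.+2), G, A, Phi; split.
- exact: ltW.
- move=> f x Kx; have [sr si] := Cinfty_smooth_real f.
  rewrite dpowE partialsE.
  have -> : (fun y => complex.Re (G f y)) =
      (fun y => chi y * primitive chi m (fun y => complex.Re (f y)) y).
    by apply/funext => y; rewrite GE.
  have -> : (fun y => complex.Im (G f y)) =
      (fun y => chi y * primitive chi m (fun y => complex.Im (f y)) y).
    by apply/funext => y; rewrite GE.
  rewrite !(primitiveP Omega_open K'co K'O schi chi0 K'q m Vo chi1 (KV _ Kx))//.
  by case: (f x).
- by move=> d x d0; exact: (PhiP d x d0).2.
- move=> d beta d0.
  have [C CP] := probe_bnd K'co schi chi0 K'q m (size (index_seq beta)) d0.
  exists C => x y; rewrite dpowE partialsE (le_trans (normc_le _))//=.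
  have -> : (fun y => complex.Re (Phi d x y)) = probe chi m d x.
    by apply/funext => z; rewrite (PhiP d x d0).1.
  have -> : (fun y => complex.Im (Phi d x y)) = fun=> 0.
    by apply/funext => z; rewrite (PhiP d x d0).1.
  have b0 : Cm_bnd (size (index_seq beta)) setT 0 (fun _ : 'rV[R]_n => 0 : R).
    by apply: Cm_bnd_cst; rewrite normr0.
  rewrite -[leRHS]addr0 lerD//; first exact: CP.
  exact: (Cm_bnd_rparts b0 (leqnn _) (I : setT y)).
move=> f fm d x /andP[d0 d1].
have [sr si] := Cinfty_smooth_real f.
have [Br Br0 BrP] := primitive_probe Omega_open K'co K'O schi chi0 q0 K'q m sr.
have [Bi Bi0 BiP] := primitive_probe Omega_open K'co K'O schi chi0 q0 K'q m si.
have pE e : 0 < e -> pairing f (Phi e x) =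
    Complex (intR (fun y => complex.Re (f y) * probe chi m e x y))
            (intR (fun y => complex.Im (f y) * probe chi m e x y)).
  by move=> e0; apply: pairing_real; exact: (PhiP e x e0).1.
have near_d e : 0 < e < 1 ->
    normc (pairing f (Phi e x) - pairing f (Phi d x)) <= A * (e + d).
  move=> e01; have /andP[e0 e1] := e01.
  have Aed : 0 < A * (e + d) by rewrite mulr_gt0// addr_gt0.
  pose c := (A * (e + d))^-1.
  have c0 : 0 < c by rewrite invr_gt0.
  have ste := smooth_probe schi m x e0; have std := smooth_probe schi m x d0.
  pose w y := c * (probe chi m e x y - probe chi m d x y).
  have sw : smooth setT w.
    by apply: smoothZ; [exact: openT|exact: smoothB openT ste std].
  have w0 y : ~ K' y -> w y = 0.
    by move=> nK; rewrite /w !(probe_outside chi0)// subrr mulr0.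
  have [psi [psiE psiK]] := testfun_exists K'co K'O sw (smooth_cst 0 openT)
    w0 (fun _ _ => erefl).
  have : normc (pairing f psi) <= 1.
    apply: fm => // s sm y Oy.
    rewrite partialsE (le_trans (normc_le _))//=.
    have -> : (fun y => complex.Re (psi y)) = w.
      by apply/funext => z; rewrite psiE.
    have -> : (fun y => complex.Im (psi y)) = fun=> 0.
      by apply/funext => z; rewrite psiE.
    have b0 : Cm_bnd (size s) setT 0 (fun _ : 'rV[R]_n => 0 : R).
      by apply: Cm_bnd_cst; rewrite normr0.
    rewrite -[leRHS]addr0 lerD//; last exact: (Cm_bnd_rparts b0 (leqnn _) (I : setT y)).
    rewrite /w (rpartsZ _ _ (smoothB openT ste std)).
    rewrite normrM gtr0_norm// /c ler_pdivrMl// mulr1.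
    by apply: AP => //; rewrite d0.
  rewrite (pairing_real f psiE).
  have lin u : smooth Omega u -> intR (fun y => u y * w y) =
      c * (intR (fun y => u y * probe chi m e x y) -
           intR (fun y => u y * probe chi m d x y)).
    move=> su.
    have [ce se] := probe_integrand m x K'co K'O schi chi0 K'q e0 su.
    have [cd sd] := probe_integrand m x K'co K'O schi chi0 K'q d0 su.
    rewrite -(intRB ce se cd sd) -(intRZ (continuous_sub ce cd) (supportedB se sd)).
    by apply: eq_intR => y; rewrite /w; ring.
  rewrite (lin _ sr) (lin _ si) normc_scale gtr0_norm// /c ler_pdivrMl// mulr1.
  by rewrite !pE.
have near_G e : 0 < e < 1 -> normc (G f x - pairing f (Phi e x)) <= (Br + Bi) * e.
  move=> e01; have /andP[e0 e1] := e01.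
  rewrite GE pE// (le_trans (normc_le _))//= mulrDl lerD//; [exact: BrP|exact: BiP].
apply/ler_addgt0Pl => t t0.
pose B := Br + Bi + A + 1.
have B0 : 0 < B by rewrite /B ltr_wpDl// !addr_ge0 ?(ltW A0).
pose e := Num.min 2^-1 (t / B).
have e0 : 0 < e by rewrite lt_min invr_gt0 ltr0n /= divr_gt0.
have e1 : e < 1 by rewrite gt_min invf_lt1 ?ltr1n ?ltr0n.
have et : e * B <= t by rewrite -ler_pdivlMr// ge_min lexx orbT.
have e01 : 0 < e < 1 by rewrite e0.
rewrite -[G f x](subrK (pairing f (Phi e x))) -addrA.
apply: (le_trans (le_normcD _ _)).
apply: (le_trans (lerD (near_G e e01) (near_d e e01))).
have : (Br + Bi) * e + A * (e + d) = e * B - e + A * d by rewrite /B; ring.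
by move=> ->; rewrite lerD2r (le_trans _ et)// gerDl oppr_le0 ltW.
Qed.

End assembly.

Theorem theorem12 (E : nonstandard_extension) (R : realType) (n : nat)
    (Omega : set 'rV[R]_n) (Omega_open : open Omega)
    (f : star E (Cinfty Omega)) :
  approx0_distr f <->
  (forall K : set 'rV[R]_n, compact K -> K `<=` Omega ->
    exists (alpha : multi_index n) (g : star E (testfun Omega)),
      (forall x, sset E Omega x -> approxC (stest_eval g x) (std E 0)) /\
      (forall x, sset E K x -> seval f x = stest_dpow alpha g x)).
Proof.
split; last exact: approx0_of_primitive Omega_open _ (@weak_bound_holds _ _ Omega).
exact: primitive_of_approx0 (small_primitives_hold Omega_open).
Qed.
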